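(* For $l\in\mathbb Z$ put $\hat\alpha_l=\alpha/w+l$, $\hat\beta=\beta/w$, and for $n\ge0$ define $$d_n^{(l)}=e^{\gamma w}\,\frac{[\hat\alpha_l-n]\,[\hat\beta+(\hat\alpha_l+1)(n+1)]\,[\hat\beta+\hat\alpha_ln]}{[\hat\alpha_l+n+1]\,[\hat\beta+(\hat\alpha_l+1)n]\,[\hat\beta+\hat\alpha_l(n+1)]},$$ $$b_n^{(l)}=-e^{\gamma w}\,\frac{[n]^2\,[\hat\beta+(\hat\alpha_l+1)(n+1)]\,[\hat\beta+\hat\alpha_l(n-1)]}{[\hat\beta+(\hat\alpha_l+1)n]\,[\hat\beta+\hat\alpha_ln]\,[\hat\alpha_l+n]\,[\hat\alpha_l+n+1]}$$ (so $b_0^{(l)}=0$). Then these elliptic expressions solve the two-point $QD$-algorithm (discrete-time relativistic Toda chain): for all $l\in\mathbb Z$, $$b_n^{(l)}\,d_n^{(l+1)}=d_{n-1}^{(l)}\,b_n^{(l+1)}\quad(n\ge1),\qquad b_n^{(l+1)}-d_n^{(l+1)}=b_{n+1}^{(l)}-d_n^{(l)}\quad(n\ge0).$$ Consequently $f_n^{(l)}=b_n^{(l+n-1)}$, $e_n^{(l)}=b_n^{(l+n)}-d_n^{(l+n)}$ solve the ordinary $QD$-algorithm (discrete-time Toda chain): for all $l\in\mathbb Z$, $$e_{n-1}^{(l+1)}f_n^{(l+1)}=e_n^{(l)}f_n^{(l)}\quad(n\ge1),\qquad e_n^{(l+1)}+f_n^{(l+1)}=e_n^{(l)}+f_{n+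1}^{(l)}\quad(n\ge0).$$
   Context: $\sigma$ denotes the Weierstrass sigma function of the lattice $\Lambda=2\omega_1\mathbb Z+2\omega_3\mathbb Z$ with $\omega_1>0$ and $\omega_3\in i\mathbb R_{>0}$. The parameter $w$ is real with $wN_1\ne\omega_1N_2$ for all integers $(N_1,N_2)\ne(0,0)$; $\alpha,\beta,\gamma\in\mathbb C$. Nondegeneracy: $\alpha\notin w\mathbb Z+\Lambda$, and $\beta+n(\alpha+lw)\notin\Lambda$ for all integers $n\ge0$ and $l\in\mathbb Z$. Elliptic numbers: $[x]=\sigma(wx)/\sigma(w)$. *)

(* Defs.v *)
From Stdlib Require Export Reals ZArith List.
From Coquelicot Require Export Coquelicot.
Open Scope C_scope.

Definition Cexp (z : C) : C :=
  (exp (Re z) * cos (Im z), exp (Re z) * sin (Im z))%R.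

(* Componentwise limit; junk components when the sequence does not converge. *)
Definition CLim_seq (u : nat -> C) : C :=
  (real (Lim_seq (fun N => Re (u N))), real (Lim_seq (fun N => Im (u N)))).

Definition Cprod {A : Type} (s : list A) (u : A -> C) : C :=
  fold_right (fun a p => u a * p) (RtoC 1) s.

(* The integers from -N to N. *)
Definition Zball (N : nat) : list Z :=
  map (fun k => (Z.of_nat k - Z.of_nat N)%Z) (seq 0 (2 * N + 1)).

(* The pairs (m, n) <> (0, 0) with |m|, |n| <= N. *)
Definition punctured_square (N : nat) : list (Z * Z) :=
  filter (fun p => negb ((fst p =? 0)%Z && (snd p =? 0)%Z))
         (list_prod (Zball N) (Zball N)).

(* omega1, omega3 are half-periods. *)
Definition lattice_point (omega1 omega3 : C) (p : Z * Z) : C :=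
  2 * omega1 * IZR (fst p) + 2 * omega3 * IZR (snd p).

Definition in_lattice (omega1 omega3 z : C) : Prop :=
  exists p : Z * Z, z = lattice_point omega1 omega3 p.

(* The factor (1 - z/lambda) exp(z/lambda + (z/lambda)^2/2). *)
Definition sigma_factor (z lambda : C) : C :=
  (1 - z / lambda) * Cexp (z / lambda + (z / lambda) * (z / lambda) / 2).

(* The Weierstrass product over the nonzero lattice points.  It converges
   absolutely for independent half-periods, so the choice of exhausting the
   lattice by squares is immaterial. *)
Definition sigma (omega1 omega3 z : C) : C :=
  CLim_seq (fun N =>
    z * Cprod (punctured_square N)
          (fun p => sigma_factor z (lattice_point omega1 omega3 p))).

Definition ell (omega1 omega3 : C) (w : R) (x : C) : C :=
  sigma omega1 omega3 (w * x) / sigma omega1 omega3 w.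

Definition alpha_hat (w : R) (alpha : C) (l : Z) : C := alpha / w + IZR l.

Definition beta_hat (w : R) (beta : C) : C := beta / w.

Definition qd_d (omega1 omega3 : C) (w : R) (alpha beta gamma : C)
    (n : nat) (l : Z) : C :=
  let br := ell omega1 omega3 w in
  let a := alpha_hat w alpha l in
  let b := beta_hat w beta in
  let n := RtoC (INR n) in
  Cexp (gamma * w) *
  ((br (a - n) * br (b + (a + 1) * (n + 1)) * br (b + a * n)) /
   (br (a + n + 1) * br (b + (a + 1) * n) * br (b + a * (n + 1)))).

Definition qd_b (omega1 omega3 : C) (w : R) (alpha beta gamma : C)
    (n : nat) (l : Z) : C :=
  let br := ell omega1 omega3 w in
  let a := alpha_hat w alpha l in
  let b := beta_hat w beta in
  let n := RtoC (INR n) in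
  - Cexp (gamma * w) *
  ((br n * br n * br (b + (a + 1) * (n + 1)) * br (b + a * (n - 1))) /
   (br (b + (a + 1) * n) * br (b + a * n) * br (a + n) * br (a + n + 1))).

Definition qd_f (omega1 omega3 : C) (w : R) (alpha beta gamma : C)
    (n : nat) (l : Z) : C :=
  qd_b omega1 omega3 w alpha beta gamma n (l + Z.of_nat n - 1).

Definition qd_e (omega1 omega3 : C) (w : R) (alpha beta gamma : C)
    (n : nat) (l : Z) : C :=
  qd_b omega1 omega3 w alpha beta gamma n (l + Z.of_nat n) -
  qd_d omega1 omega3 w alpha beta gamma n (l + Z.of_nat n).

(* Main.v *)
Require Import Defs.
From Stdlib Require Import Lra Lia Permutation Classical.
Local Open Scope R_scope.

(** With X = beta + (A + 1) n and c = A + 1, clearing denominators reduces the additive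
    QD relation to two instances of Weierstrass's three-term relation
      sigma(x+y) sigma(x-y) sigma(z)^2 + sigma(y-z) sigma(y+z) sigma(x)^2
        = sigma(y)^2 sigma(x+z) sigma(x-z);
    the multiplicative relation is a plain cancellation, and the ordinary QD relations
    follow from these two.

    The three-term relation is obtained without complex analysis.  Over a rectangle of
    lattice points the Weierstrass product is a polynomial times exp(z^2 R / 2), since the
    linear sums cancel by symmetry, and the exponential factor is common to the three
    terms.  Row by row, Euler's sine product turns the polynomial into the product
    sin x prod (1 - Q^n e^(2ix)) (1 - Q^n e^(-2ix)), which the finite q-binomial theorem
    and dominated convergence turn into the theta series.  For the series, rearranging
    the double sum writes theta(x+y) theta(x-y) as a 2x2 minor, so that the three-term
    relation becomes a Pluecker relation.  The exponents R stay bounded because sigma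
    does not vanish off the lattice. *)

(** * Limits along filters *)

(** Constants stay anonymous throughout: the three-term relation is homogeneous of degree four, so a
    factor independent of the argument drops out, and each infinite product is evaluated only up to
    such a factor.

    The obstacle is that the sum R of the inverse squares of the lattice points does not converge
    absolutely, so the Weierstrass product cannot be split into polynomial and exponential parts in
    an unconditional limit. The full factors are therefore multiplied unconditionally, along the
    filter of finite lists, and this one limit is then read along rectangles whose rows are
    completed first, where the polynomial part converges by itself. Instead of a limit of R, a bound
    is obtained: off the lattice the polynomial part is bounded while the full product tends to a
    nonzero value, which bounds Re(z^2 R) from below, and four choices of z bound R.

    The same freedom of exhaustion lets the double theta series be summed over a rotated square,
    where its partial sums factor exactly. *)

Lemma filter_and2 {T : Type} {F : (T -> Prop) -> Prop} {P Q : T -> Prop} :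
  F P -> F Q -> Filter F -> F (fun x => P x /\ Q x).
Proof. intros HP HQ HF. now apply filter_and. Qed.

(** One notion of limit for the three index sets in use: sequences, finite lists under inclusion,
    and rectangles in an iterated limit. *)
Definition tendsto {T : Type} (F : (T -> Prop) -> Prop) (u : T -> C) (l : C) : Prop :=
  forall eps, 0 < eps -> F (fun x => Cmod (u x - l) < eps).

Lemma Cmod_triangle3 (x y z : C) : Cmod (x - z) <= Cmod (x - y) + Cmod (y - z).
Proof.
  replace (x - z)%C with ((x - y) + (y - z))%C by ring.
  apply Cmod_triangle.
Qed.

Lemma Cmod_minus_sym (x y : C) : Cmod (x - y) = Cmod (y - x).
Proof. rewrite <- Cmod_opp; f_equal; ring. Qed.

Lemma Cmod_triangle_inv (x y : C) : Cmod x - Cmod y <= Cmod (x - y).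
Proof.
  assert (H := Cmod_triangle (x - y) y).
  replace (x - y + y)%C with x in H by ring. lra.
Qed.

Section Tendsto.

Context {T : Type} (F : (T -> Prop) -> Prop) {FF : Filter F}.

Lemma tendsto_const (c : C) : tendsto F (fun _ => c) c.
Proof.
  intros eps Heps. apply filter_forall. intros _.
  replace (c - c)%C with (RtoC 0) by ring. now rewrite Cmod_0.
Qed.

Lemma tendsto_ext (u v : T -> C) (l : C) :
  F (fun x => u x = v x) -> tendsto F u l -> tendsto F v l.
Proof.
  intros Huv Hu eps Heps. generalize (Hu eps Heps).
  intros H. generalize (filter_and2 Huv H _). apply filter_imp.
  intros x [-> H']; exact H'.
Qed.

Lemma tendsto_plus (u v : T -> C) (l m : C) :
  tendsto F u l -> tendsto F v m -> tendsto F (fun x => u x + v x)%C (l + m).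
Proof.
  intros Hu Hv eps Heps.
  assert (H := filter_and2 (Hu (eps / 2) ltac:(lra)) (Hv (eps / 2) ltac:(lra)) _).
  revert H. apply filter_imp. intros x [H1 H2].
  replace (u x + v x - (l + m))%C with ((u x - l) + (v x - m))%C by ring.
  eapply Rle_lt_trans; [apply Cmod_triangle | lra].
Qed.

Lemma tendsto_bounded (u : T -> C) (l : C) :
  tendsto F u l -> F (fun x => Cmod (u x) <= Cmod l + 1).
Proof.
  intros Hu. generalize (Hu 1 ltac:(lra)). apply filter_imp. intros x H.
  assert (H' := Cmod_triangle_inv (u x) l). lra.
Qed.

Lemma tendsto_0_bounded_mult (u v : T -> C) (B : R) :
  F (fun x => Cmod (u x) <= B) -> tendsto F v 0 -> tendsto F (fun x => u x * v x)%C 0.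
Proof.
  intros Hu Hv eps Heps.
  assert (HB : 0 < Rabs B + 1) by (assert (H := Rabs_pos B); lra).
  assert (Heps' : 0 < eps / (Rabs B + 1)) by (apply Rdiv_lt_0_compat; lra).
  generalize (filter_and2 Hu (Hv _ Heps') _). apply filter_imp.
  intros x [H1 H2].
  replace (u x * v x - 0)%C with (u x * (v x - 0))%C by ring.
  rewrite Cmod_mult.
  apply Rle_lt_trans with ((Rabs B + 1) * Cmod (v x - 0)).
  - apply Rmult_le_compat_r; [apply Cmod_ge_0 |]. assert (H := Rle_abs B). lra.
  - apply Rmult_lt_compat_l with (r := Rabs B + 1) in H2; [| lra].
    eapply Rlt_le_trans; [exact H2 | right; field; lra].
Qed.

Lemma tendsto_minus_0 (u : T -> C) (l : C) :
  tendsto F u l <-> tendsto F (fun x => u x - l)%C 0.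
Proof.
  split; intros H eps Heps; generalize (H eps Heps); apply filter_imp; intros x;
    now replace (u x - l - 0)%C with (u x - l)%C by ring.
Qed.

Lemma tendsto_mult (u v : T -> C) (l m : C) :
  tendsto F u l -> tendsto F v m -> tendsto F (fun x => u x * v x)%C (l * m).
Proof.
  intros Hu Hv. apply tendsto_minus_0.
  replace (RtoC 0) with (0 + 0)%C by ring.
  apply tendsto_ext with (fun x => u x * (v x - m) + m * (u x - l))%C.
  { apply filter_forall. intros x. ring. }
  apply tendsto_plus.
  - apply tendsto_0_bounded_mult with (Cmod l + 1).
    + now apply tendsto_bounded.
    + now apply -> tendsto_minus_0.
  - apply tendsto_0_bounded_mult with (Cmod m).
    + apply filter_forall. intros _. apply Rle_refl.
    + now apply -> tendsto_minus_0.
Qed.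

Lemma tendsto_scal (c : C) (u : T -> C) (l : C) :
  tendsto F u l -> tendsto F (fun x => c * u x)%C (c * l).
Proof. apply tendsto_mult, tendsto_const. Qed.

Lemma tendsto_minus (u v : T -> C) (l m : C) :
  tendsto F u l -> tendsto F v m -> tendsto F (fun x => u x - v x)%C (l - m).
Proof.
  intros Hu Hv. replace (l - m)%C with (l + (- (1)) * m)%C by ring.
  apply tendsto_ext with (fun x => u x + (- (1)) * v x)%C.
  { apply filter_forall. intros x. ring. }
  apply tendsto_plus, tendsto_scal; assumption.
Qed.

Lemma tendsto_squeeze (u : T -> C) (l : C) (e : T -> R) :
  F (fun x => Cmod (u x - l) <= e x) ->
  (forall eps, 0 < eps -> F (fun x => e x < eps)) -> tendsto F u l.
Proof.
  intros Hu He eps Heps. generalize (filter_and2 Hu (He eps Heps) _).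
  apply filter_imp. intros x [H1 H2]. lra.
Qed.

Lemma tendsto_Cprod {A : Type} (s : list A) (u : A -> T -> C) (l : A -> C) :
  (forall a, In a s -> tendsto F (u a) (l a)) ->
  tendsto F (fun x => Cprod s (fun a => u a x)) (Cprod s l).
Proof.
  induction s as [| a s IH]; intros H; simpl.
  - apply tendsto_const.
  - apply tendsto_mult.
    + apply H. now left.
    + apply IH. intros b Hb. apply H. now right.
Qed.

End Tendsto.

Lemma tendsto_unique {T : Type} (F : (T -> Prop) -> Prop) {FF : ProperFilter' F}
  (u : T -> C) (l m : C) : tendsto F u l -> tendsto F u m -> l = m.
Proof.
  intros Hl Hm. destruct (Ceq_dec l m) as [E | E]; [exact E | exfalso].
  assert (Hd : 0 < Cmod (l - m)).
  { apply Cmod_gt_0. intros H. apply E.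
    replace l with ((l - m) + m)%C by ring. rewrite H. ring. }
  apply (filter_not_empty (F := F)).
  assert (F' : Filter F) by apply filter_filter'.
  generalize (filter_and2 (Hl (Cmod (l - m) / 2) ltac:(lra)) (Hm (Cmod (l - m) / 2) ltac:(lra)) _).
  apply filter_imp. intros x [H1 H2].
  rewrite Cmod_minus_sym in H1.
  assert (H := Cmod_triangle3 l (u x) m). lra.
Qed.

Lemma tendsto_comp {T U : Type} (F : (T -> Prop) -> Prop) (G : (U -> Prop) -> Prop)
  (u : U -> C) (s : T -> U) (l : C) :
  filterlim s F G -> tendsto G u l -> tendsto F (fun x => u (s x)) l.
Proof. intros Hs Hu eps Heps. exact (Hs _ (Hu eps Heps)). Qed.

(** Bridge to the definition of [sigma]: convergence in modulus rules out the junk values of the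
    componentwise limit. *)
Lemma CLim_seq_tendsto (u : nat -> C) (l : C) :
  tendsto eventually u l -> CLim_seq u = l.
Proof.
  intros H. unfold CLim_seq.
  assert (HR : is_lim_seq (fun N => Re (u N)) (Re l)).
  { apply is_lim_seq_spec. intros eps. generalize (H eps (cond_pos eps)).
    apply filter_imp. intros N HN. eapply Rle_lt_trans; [| exact HN].
    eapply Rle_trans; [| apply re_le_Cmod]. right. reflexivity. }
  assert (HI : is_lim_seq (fun N => Im (u N)) (Im l)).
  { apply is_lim_seq_spec. intros eps. generalize (H eps (cond_pos eps)).
    apply filter_imp. intros N HN. eapply Rle_lt_trans; [| exact HN].
    eapply Rle_trans; [| apply Rmax_Cmod].
    eapply Rle_trans; [| apply Rmax_r]. right. reflexivity. }
  rewrite (is_lim_seq_unique _ _ HR), (is_lim_seq_unique _ _ HI). simpl.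
  now destruct l.
Qed.

Lemma tendsto_cauchy (u : nat -> C) :
  (forall eps, 0 < eps ->
     exists N, forall n m, (N <= n)%nat -> (N <= m)%nat -> Cmod (u n - u m) < eps) ->
  exists l, tendsto eventually u l.
Proof.
  intros H.
  assert (HR : ex_finite_lim_seq (fun N => Re (u N))).
  { apply ex_lim_seq_cauchy_corr. intros eps.
    destruct (H eps (cond_pos eps)) as [N HN]. exists N. intros n m Hn Hm.
    eapply Rle_lt_trans; [| exact (HN n m Hn Hm)].
    eapply Rle_trans; [| apply re_le_Cmod]. right. reflexivity. }
  assert (HI : ex_finite_lim_seq (fun N => Im (u N))).
  { apply ex_lim_seq_cauchy_corr. intros eps.
    destruct (H eps (cond_pos eps)) as [N HN]. exists N. intros n m Hn Hm.
    eapply Rle_lt_trans; [| exact (HN n m Hn Hm)].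
    eapply Rle_trans; [| apply Rmax_Cmod].
    eapply Rle_trans; [| apply Rmax_r]. right. reflexivity. }
  destruct HR as [a Ha], HI as [b Hb]. exists (a, b). intros eps Heps.
  apply is_lim_seq_spec in Ha. apply is_lim_seq_spec in Hb.
  assert (Heps2 : 0 < eps / 2) by lra.
  generalize (filter_and2 (Ha (mkposreal _ Heps2)) (Hb (mkposreal _ Heps2)) _).
  apply filter_imp. simpl. intros N [H1 H2].
  eapply Rle_lt_trans; [apply Cmod_2Rmax |].
  assert (Hs : sqrt 2 < 2).
  { rewrite <- (sqrt_square 2) at 2 by lra. apply sqrt_lt_1; lra. }
  assert (Hm : Rmax (Rabs (fst (u N - (a, b))%C)) (Rabs (snd (u N - (a, b))%C)) < eps / 2).
  { apply Rmax_lub_lt; [exact H1 | exact H2]. }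
  assert (Hm0 : 0 <= Rmax (Rabs (fst (u N - (a, b))%C)) (Rabs (snd (u N - (a, b))%C))).
  { eapply Rle_trans; [| apply Rmax_l]. apply Rabs_pos. }
  nra.
Qed.

(** * Sums and products over finite lists *)

Definition Csum {A : Type} (s : list A) (u : A -> C) : C :=
  fold_right (fun a p => (u a + p)%C) (RtoC 0) s.

Definition Rsum {A : Type} (s : list A) (u : A -> R) : R :=
  fold_right (fun a p => u a + p) 0 s.

Section Lists.

Context {A : Type}.
Implicit Types (s t : list A).

Lemma Rsum_nonneg s (u : A -> R) : (forall a, 0 <= u a) -> 0 <= Rsum s u.
Proof. intros H. induction s as [| a s IH]; simpl; [lra | specialize (H a); lra]. Qed.

Lemma Rsum_le s (u v : A -> R) : (forall a, In a s -> u a <= v a) -> Rsum s u <= Rsum s v.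
Proof.
  induction s as [| a s IH]; intros H; simpl; [lra |].
  apply Rplus_le_compat; [apply H; now left | apply IH; intros b Hb; apply H; now right].
Qed.

Lemma Rsum_scal s (c : R) (u : A -> R) : Rsum s (fun a => c * u a) = c * Rsum s u.
Proof. induction s as [| a s IH]; simpl; [ring | rewrite IH; ring]. Qed.

Lemma Rsum_app s t (u : A -> R) : Rsum (s ++ t) u = Rsum s u + Rsum t u.
Proof. induction s as [| a s IH]; simpl; [ring | rewrite IH; ring]. Qed.

Lemma Rsum_perm s t (u : A -> R) : Permutation s t -> Rsum s u = Rsum t u.
Proof. induction 1; simpl; [reflexivity | now f_equal | ring | congruence]. Qed.

Lemma Csum_app s t (u : A -> C) : Csum (s ++ t) u = (Csum s u + Csum t u)%C.
Proof. induction s as [| a s IH]; simpl; [ring | rewrite IH; ring]. Qed.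

Lemma Csum_perm s t (u : A -> C) : Permutation s t -> Csum s u = Csum t u.
Proof. induction 1; simpl; [reflexivity | now f_equal | ring | congruence]. Qed.

Lemma Csum_ext s (u v : A -> C) : (forall a, In a s -> u a = v a) -> Csum s u = Csum s v.
Proof.
  induction s as [| a s IH]; intros H; simpl; [reflexivity |].
  rewrite (H a) by now left. f_equal. apply IH. intros b Hb. apply H. now right.
Qed.

Lemma Csum_plus s (u v : A -> C) : Csum s (fun a => u a + v a)%C = (Csum s u + Csum s v)%C.
Proof. induction s as [| a s IH]; simpl; [ring | rewrite IH; ring]. Qed.

Lemma Csum_scal s (c : C) (u : A -> C) : Csum s (fun a => c * u a)%C = (c * Csum s u)%C.
Proof. induction s as [| a s IH]; simpl; [ring | rewrite IH; ring]. Qed.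

Lemma Cmod_Csum_le s (u : A -> C) : Cmod (Csum s u) <= Rsum s (fun a => Cmod (u a)).
Proof.
  induction s as [| a s IH]; simpl; [rewrite Cmod_0; lra |].
  eapply Rle_trans; [apply Cmod_triangle | lra].
Qed.

Lemma Cprod_app s t (u : A -> C) : Cprod (s ++ t) u = (Cprod s u * Cprod t u)%C.
Proof. induction s as [| a s IH]; simpl; [ring | rewrite IH; ring]. Qed.

Lemma Cprod_perm s t (u : A -> C) : Permutation s t -> Cprod s u = Cprod t u.
Proof. induction 1; simpl; [reflexivity | now f_equal | ring | congruence]. Qed.

Lemma Cprod_ext s (u v : A -> C) : (forall a, In a s -> u a = v a) -> Cprod s u = Cprod s v.
Proof.
  induction s as [| a s IH]; intros H; simpl; [reflexivity |].
  rewrite (H a) by now left. f_equal. apply IH. intros b Hb. apply H. now right.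
Qed.

Lemma Cprod_mult s (u v : A -> C) : Cprod s (fun a => u a * v a)%C = (Cprod s u * Cprod s v)%C.
Proof. induction s as [| a s IH]; simpl; [ring | rewrite IH; ring]. Qed.

Lemma Cprod_neq_0 s (u : A -> C) : (forall a, In a s -> u a <> 0%C) -> Cprod s u <> 0%C.
Proof.
  induction s as [| a s IH]; intros H; simpl.
  - intros E. apply (f_equal fst) in E. simpl in E. lra.
  - apply Cmult_neq_0; [apply H; now left | apply IH; intros b Hb; apply H; now right].
Qed.

(** From uv - 1 = (u-1)(v-1) + (u-1) + (v-1), the distance of a product to 1 is at most the product
    of the 1 + h minus 1, and 1 + h <= exp h. *)
Lemma Cmod_Cprod_minus_1_le s (u : A -> C) (h : A -> R) :
  (forall a, In a s -> Cmod (u a - 1) <= h a) ->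
  Cmod (Cprod s u) <= exp (Rsum s h) /\ Cmod (Cprod s u - 1) <= exp (Rsum s h) - 1.
Proof.
  intros H.
  assert (H1 : Cmod (Cprod s u - 1) <= exp (Rsum s h) - 1).
  { induction s as [| a s IH]; simpl.
    - replace (1 - 1)%C with (RtoC 0) by ring. rewrite Cmod_0, exp_0. lra.
    - replace (u a * Cprod s u - 1)%C
        with ((u a - 1) * (Cprod s u - 1) + ((u a - 1) + (Cprod s u - 1)))%C by ring.
      eapply Rle_trans; [apply Cmod_triangle |].
      assert (Ht := Cmod_triangle (u a - 1) (Cprod s u - 1)).
      rewrite Cmod_mult.
      assert (Ha : Cmod (u a - 1) <= h a) by (apply H; now left).
      assert (Hs : Cmod (Cprod s u - 1) <= exp (Rsum s h) - 1)
        by (apply IH; intros b Hb; apply H; now right).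
      assert (Hp := Cmod_ge_0 (u a - 1)). assert (Hq := Cmod_ge_0 (Cprod s u - 1)).
      assert (He := exp_ineq1_le (h a)).
      assert (Hm : (1 + Cmod (u a - 1)) * (1 + Cmod (Cprod s u - 1)) <= exp (h a) * exp (Rsum s h))
        by (apply Rmult_le_compat; lra).
      rewrite exp_plus. lra. }
  split; [| exact H1].
  assert (Ht := Cmod_triangle (Cprod s u - 1) 1).
  replace (Cprod s u - 1 + 1)%C with (Cprod s u) in Ht by ring.
  rewrite Cmod_1 in Ht. lra.
Qed.

(** Telescoping: the factors are exchanged one at a time, and the product of the remaining ones is
    at most the exponential of the sum of [h]. *)
Lemma Cmod_Cprod_minus_le s (u v : A -> C) (h : A -> R) :
  (forall a, In a s -> Cmod (u a - 1) <= h a) ->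
  (forall a, In a s -> Cmod (v a - 1) <= h a) ->
  Cmod (Cprod s u - Cprod s v) <= exp (Rsum s h) * Rsum s (fun a => Cmod (u a - v a)).
Proof.
  intros Hu Hv. induction s as [| a s IH]; simpl.
  - replace (1 - 1)%C with (RtoC 0) by ring. rewrite Cmod_0. lra.
  - assert (Hu' : forall b, In b s -> Cmod (u b - 1) <= h b) by (intros; apply Hu; now right).
    assert (Hv' : forall b, In b s -> Cmod (v b - 1) <= h b) by (intros; apply Hv; now right).
    specialize (IH Hu' Hv').
    replace (u a * Cprod s u - v a * Cprod s v)%C
      with ((u a - v a) * Cprod s u + v a * (Cprod s u - Cprod s v))%C by ring.
    eapply Rle_trans; [apply Cmod_triangle |]. rewrite !Cmod_mult, exp_plus.
    destruct (Cmod_Cprod_minus_1_le s u h Hu') as [Hp _].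
    assert (Ha : Cmod (v a) <= exp (h a)).
    { assert (Ht := Cmod_triangle (v a - 1) 1).
      replace (v a - 1 + 1)%C with (v a) in Ht by ring. rewrite Cmod_1 in Ht.
      assert (He := exp_ineq1_le (h a)).
      assert (Ha := Hv a (or_introl eq_refl)). lra. }
    assert (Hh : 1 <= exp (h a)).
    { assert (He := exp_ineq1_le (h a)). assert (Ha' := Hv a (or_introl eq_refl)).
      assert (H0 := Cmod_ge_0 (v a - 1)). lra. }
    assert (H1 : Cmod (u a - v a) * Cmod (Cprod s u)
                 <= Cmod (u a - v a) * (exp (h a) * exp (Rsum s h))).
    { apply Rmult_le_compat_l; [apply Cmod_ge_0 |].
      assert (Hx := exp_pos (Rsum s h)). nra. }
    assert (H2 : Cmod (v a) * Cmod (Cprod s u - Cprod s v)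
                 <= exp (h a) * (exp (Rsum s h) * Rsum s (fun a => Cmod (u a - v a)))).
    { apply Rmult_le_compat; try apply Cmod_ge_0; assumption. }
    lra.
Qed.

(** Splits a large list into a fixed core and a tail disjoint from it; every unconditional limit
    below is estimated through this splitting. *)
Lemma Permutation_incl_app s t :
  NoDup s -> NoDup t -> incl s t ->
  exists r, Permutation t (s ++ r) /\ NoDup r /\ (forall a, In a r -> ~ In a s).
Proof.
  intros Hs Ht Hi.
  assert (E : exists r, Permutation t (s ++ r)).
  { revert t Ht Hi. induction s as [| a s IH]; intros t Ht Hi.
    - exists t. simpl. apply Permutation_refl.
    - destruct (in_split a t (Hi a (or_introl eq_refl))) as (t1 & t2 & ->).
      inversion Hs as [| ? ? Ha Hs' ]; subst.
      destruct (IH Hs' (t1 ++ t2)) as [r Hr].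
      + now apply NoDup_remove_1 in Ht.
      + intros b Hb. assert (Hb' := Hi b (or_intror Hb)).
        apply in_app_or in Hb'. apply in_or_app.
        destruct Hb' as [Hb' | [Hb' | Hb']]; [now left | subst; contradiction | now right].
      + exists r. simpl.
        apply Permutation_trans with (a :: t1 ++ t2); [| now constructor].
        apply Permutation_sym, Permutation_middle. }
  destruct E as [r Hr]. exists r. split; [exact Hr |].
  assert (Hn := Permutation_NoDup Hr Ht). split.
  - now apply NoDup_app_remove_l in Hn.
  - intros a Ha Ha'. apply in_split in Ha' as (s1 & s2 & ->).
    rewrite <- app_assoc in Hn. simpl in Hn. apply NoDup_remove_2 in Hn.
    apply Hn. rewrite !in_app_iff. tauto.
Qed.

Lemma Rsum_incl s t (u : A -> R) :
  (forall a, 0 <= u a) -> NoDup s -> incl s t -> Rsum s u <= Rsum t u.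
Proof.
  intros Hu Hs. revert t. induction s as [| a s IH]; intros t Hi; simpl.
  - now apply Rsum_nonneg.
  - destruct (in_split a t (Hi a (or_introl eq_refl))) as (t1 & t2 & ->).
    inversion Hs as [| ? ? Ha Hs']; subst.
    rewrite (Rsum_perm (t1 ++ a :: t2) (a :: t1 ++ t2))
      by apply Permutation_sym, Permutation_middle.
    simpl. apply Rplus_le_compat_l, IH; [assumption |].
    intros b Hb. assert (Hb' := Hi b (or_intror Hb)).
    apply in_app_or in Hb'. apply in_or_app.
    destruct Hb' as [Hb' | [Hb' | Hb']]; [now left | subst; contradiction | now right].
Qed.

End Lists.

Lemma Csum_map {A B : Type} (g : A -> B) (s : list A) (u : B -> C) :
  Csum (map g s) u = Csum s (fun a => u (g a)).
Proof. induction s as [| a s IH]; simpl; [reflexivity | now rewrite IH]. Qed.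

Lemma Cprod_map {A B : Type} (g : A -> B) (s : list A) (u : B -> C) :
  Cprod (map g s) u = Cprod s (fun a => u (g a)).
Proof. induction s as [| a s IH]; simpl; [reflexivity | now rewrite IH]. Qed.

Lemma Rsum_map {A B : Type} (g : A -> B) (s : list A) (u : B -> R) :
  Rsum (map g s) u = Rsum s (fun a => u (g a)).
Proof. induction s as [| a s IH]; simpl; [reflexivity | now rewrite IH]. Qed.

Lemma Cprod_list_prod {A B : Type} (s : list A) (t : list B) (u : A * B -> C) :
  Cprod (list_prod s t) u = Cprod s (fun a => Cprod t (fun b => u (a, b))).
Proof.
  induction s as [| a s IH]; simpl; [reflexivity |].
  now rewrite Cprod_app, Cprod_map, IH.
Qed.

Lemma Csum_list_prod {A B : Type} (s : list A) (t : list B) (u : A -> C) (v : B -> C) :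
  Csum (list_prod s t) (fun p => u (fst p) * v (snd p))%C = (Csum s u * Csum t v)%C.
Proof.
  induction s as [| a s IH]; simpl; [ring |].
  rewrite Csum_app, Csum_map, IH. simpl. rewrite Csum_scal. ring.
Qed.

Lemma Rsum_list_prod {A B : Type} (s : list A) (t : list B) (u : A -> R) (v : B -> R) :
  Rsum (list_prod s t) (fun p => u (fst p) * v (snd p)) = Rsum s u * Rsum t v.
Proof.
  induction s as [| a s IH]; simpl; [ring |].
  rewrite Rsum_app, Rsum_map, IH. simpl. rewrite Rsum_scal. ring.
Qed.

Lemma Cprod_comm {A B : Type} (s : list A) (t : list B) (u : A -> B -> C) :
  Cprod s (fun a => Cprod t (u a)) = Cprod t (fun b => Cprod s (fun a => u a b)).
Proof.
  induction s as [| a s IH]; simpl.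
  - induction t as [| b t IHt]; simpl; [reflexivity | rewrite <- IHt; ring].
  - now rewrite IH, Cprod_mult.
Qed.

(** * Summable families and unconditional products *)

(** For nonnegative [h] this is convergence of the sum, expressed without enumerating the index
    set. *)
Definition summable {A : Type} (h : A -> R) : Prop :=
  exists B, forall s, NoDup s -> Rsum s h <= B.

(** The net of finite subsets, duplicate-free lists standing for sets: limits along it are
    unconditional. *)
Definition finite_lists {A : Type} (P : list A -> Prop) : Prop :=
  exists s, forall t, NoDup t -> incl s t -> P t.

Definition exhausts {A : Type} (s : nat -> list A) : Prop :=
  (forall N, NoDup (s N)) /\ (forall a, eventually (fun N => In a (s N))).

#[local] Instance finite_lists_filter {A : Type} : Filter (@finite_lists A).
Proof.
  constructor.
  - exists nil. trivial.
  - intros P Q [s Hs] [t Ht]. exists (s ++ t). intros r Hr Hi.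
    split; [apply Hs | apply Ht]; trivial; intros a Ha; apply Hi, in_or_app; tauto.
  - intros P Q HPQ [s Hs]. exists s. intros t Ht Hi. now apply HPQ, Hs.
Qed.

Lemma eventually_incl {A : Type} (s : nat -> list A) (t : list A) :
  (forall a, eventually (fun N => In a (s N))) -> eventually (fun N => incl t (s N)).
Proof.
  intros H. induction t as [| a t IH].
  - apply filter_forall. intros N a [].
  - generalize (filter_and2 (H a) IH _). apply filter_imp. intros N [H1 H2] b [<- | Hb].
    + exact H1.
    + now apply H2.
Qed.

(** Transfers one unconditional limit to any convenient exhaustion: balls, squares, shifted ranges,
    rotated squares. *)
Lemma exhausts_filterlim {A : Type} (s : nat -> list A) :
  exhausts s -> filterlim s eventually finite_lists.
Proof.
  intros [Hn Hs] P [t Ht]. unfold filtermap.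
  generalize (eventually_incl s t Hs). apply filter_imp. intros N HN. now apply Ht.
Qed.

Section Summable.

Context {A : Type}.
Implicit Types (h : A -> R).

Lemma summable_le h (k : A -> R) (c : R) :
  0 <= c -> summable k -> (forall a, h a <= c * k a) -> summable h.
Proof.
  intros Hc [B HB] Hle. exists (c * B). intros s Hs.
  eapply Rle_trans; [apply Rsum_le; intros a _; apply Hle |].
  rewrite Rsum_scal. apply Rmult_le_compat_l; auto.
Qed.

(** A list whose sum is within [eps] of the supremum leaves less than [eps] to any list disjoint
    from it. *)
Lemma summable_tail h (eps : R) :
  (forall a, 0 <= h a) -> summable h -> 0 < eps ->
  exists s, NoDup s /\ forall t, NoDup t -> (forall a, In a t -> ~ In a s) -> Rsum t h < eps.
Proof.
  intros Hh [B HB] Heps.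
  destruct (completeness (fun x => exists s, NoDup s /\ x = Rsum s h)) as [m [Hm1 Hm2]].
  - exists B. intros x (s & Hs & ->). now apply HB.
  - exists 0. exists nil. split; [constructor | reflexivity].
  - destruct (classic (exists s, NoDup s /\ m - eps < Rsum s h)) as [(s & Hs & Hlt) | Hno].
    + exists s. split; [exact Hs |]. intros t Ht Hd.
      assert (H : Rsum (s ++ t) h <= m).
      { apply Hm1. exists (s ++ t). split; [| reflexivity].
        apply NoDup_app; try assumption. intros a H1 H2. exact (Hd a H2 H1). }
      rewrite Rsum_app in H. lra.
    + assert (H : m <= m - eps); [| lra].
      apply Hm2. intros x (s & Hs & ->). apply Rnot_lt_le. intros Hlt.
      apply Hno. now exists s.
Qed.

(* Tannery's theorem, in the form needed both for sums and for products. *)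
Lemma Rsum_dominated (s : nat -> list A) (D : nat -> A -> R) h :
  (forall a, 0 <= h a) -> summable h -> (forall N, NoDup (s N)) ->
  (forall N a, 0 <= D N a) ->
  eventually (fun N => forall a, In a (s N) -> D N a <= h a) ->
  (forall a eps, 0 < eps -> eventually (fun N => D N a < eps)) ->
  forall eps, 0 < eps -> eventually (fun N => Rsum (s N) (D N) < eps).
Proof.
  intros Hh Hsum Hs HD0 HDh HD eps Heps.
  destruct (summable_tail h (eps / 2) Hh Hsum ltac:(lra)) as (t & Ht & Htail).
  assert (Hfin : forall del, 0 < del -> eventually (fun N => Rsum t (D N) < del)).
  { clear Ht Htail. induction t as [| a t IH]; intros del Hdel; simpl.
    - now apply filter_forall.
    - generalize (filter_and2 (HD a (del / 2) ltac:(lra)) (IH (del / 2) ltac:(lra)) _).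
      apply filter_imp. intros N [H1 H2]. lra. }
  generalize (filter_and2 HDh (Hfin (eps / 2) ltac:(lra)) _). apply filter_imp.
  intros N [H1 H2].
  (* Inside [t] there are finitely many terms, each tending to 0; outside [t] the tail of [h]
     dominates. *)
  assert (Hsplit : forall r : list A, NoDup r -> incl r (s N) ->
    exists r1 r2, Permutation r (r1 ++ r2) /\ incl r1 t /\ (forall a, In a r2 -> ~ In a t)).
  { intros r _ _. induction r as [| a r (r1 & r2 & P & I1 & I2)].
    - exists nil, nil. repeat split; [constructor | intros a [] | intros a []].
    - destruct (classic (In a t)) as [Hat | Hat].
      + exists (a :: r1), r2. repeat split; [now constructor | | exact I2].
        intros b [<- | Hb]; [exact Hat | now apply I1].
      + exists r1, (a :: r2). repeat split; [| exact I1 |].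
        * apply Permutation_trans with (a :: r1 ++ r2); [now constructor |].
          apply Permutation_middle.
        * intros b [<- | Hb]; [exact Hat | now apply I2]. }
  destruct (Hsplit (s N) (Hs N) (fun a Ha => Ha)) as (r1 & r2 & P & I1 & I2).
  assert (Hn := Permutation_NoDup P (Hs N)).
  rewrite (Rsum_perm _ _ _ P), Rsum_app.
  assert (Hr1 : Rsum r1 (D N) <= Rsum t (D N)).
  { apply Rsum_incl; [apply HD0 | now apply NoDup_app_remove_r in Hn | exact I1]. }
  assert (Hr2 : Rsum r2 (D N) <= Rsum r2 h).
  { apply Rsum_le. intros a Ha. apply H1.
    apply (Permutation_in _ (Permutation_sym P)), in_or_app. now right. }
  assert (Hr3 : Rsum r2 h < eps / 2)
    by (apply Htail; [now apply NoDup_app_remove_l in Hn | exact I2]).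
  lra.
Qed.

(** Tannery's theorem for products. Stating it as a difference leaves the limit of the product of
    [v] to be identified separately. The terms |u - v| are dominated by 2 h, passing through 1. *)
Lemma Cprod_dominated (s : nat -> list A) (u : nat -> A -> C) (v : A -> C) h :
  (forall a, 0 <= h a) -> summable h -> (forall N, NoDup (s N)) ->
  eventually (fun N => forall a, In a (s N) -> Cmod (u N a - 1) <= h a) ->
  (forall a, Cmod (v a - 1) <= h a) ->
  (forall a, tendsto eventually (fun N => u N a) (v a)) ->
  tendsto eventually (fun N => Cprod (s N) (u N) - Cprod (s N) v)%C 0.
Proof.
  intros Hh Hsum Hs Hu Hv Huv.
  destruct Hsum as [B HB].
  apply tendsto_squeeze with
    (fun N => exp B * Rsum (s N) (fun a => Cmod (u N a - v a))).
  - apply eventually_filter.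
  - revert Hu. apply filter_imp. intros N HN.
    match goal with |- Cmod ?x <= _ =>
      replace x with (Cprod (s N) (u N) - Cprod (s N) v)%C by ring end.
    eapply Rle_trans; [apply Cmod_Cprod_minus_le with (h := h); auto |].
    apply Rmult_le_compat_r.
    + apply Rsum_nonneg. intros a. apply Cmod_ge_0.
    + assert (HBs := HB _ (Hs N)). destruct HBs as [HBs | HBs].
      * left. now apply exp_increasing.
      * right. now f_equal.
  - intros eps Heps.
    assert (Heps' : 0 < eps / exp B) by (apply Rdiv_lt_0_compat; [lra | apply exp_pos]).
    assert (H2h : summable (fun a => 2 * h a)).
    { apply summable_le with h 2; [lra | now exists B | intros; lra]. }
    generalize (Rsum_dominated s (fun N a => Cmod (u N a - v a)) (fun a => 2 * h a)
      ltac:(intros a; specialize (Hh a); lra) H2h Hs (fun N a => Cmod_ge_0 _)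
      ltac:(revert Hu; apply filter_imp; intros N HN a Ha;
            assert (H1 := HN a Ha); assert (H2 := Hv a);
            assert (H3 := Cmod_triangle3 (u N a) 1 (v a));
            rewrite (Cmod_minus_sym 1 (v a)) in H3; lra)
      ltac:(intros a e He; exact (Huv a e He)) _ Heps').
    apply filter_imp. intros N HN.
    apply Rmult_lt_compat_l with (r := exp B) in HN; [| apply exp_pos].
    replace (exp B * (eps / exp B)) with eps in HN; [exact HN |].
    field. assert (He := exp_pos B). lra.
Qed.

Lemma exp_minus_1_small (eps : R) : 0 < eps ->
  exists del, 0 < del /\ forall x, x < del -> exp x - 1 < eps.
Proof.
  intros Heps. exists (ln (1 + eps)). split.
  - rewrite <- ln_1. apply ln_increasing; lra.
  - intros x Hx. apply exp_increasing in Hx. rewrite exp_ln in Hx by lra. lra.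
Qed.

(** The exhausting sequence supplies the candidate limit by completeness for sequences; the uniform
    estimate [HC] then extends the convergence to the whole net. *)
Lemma Cprod_tendsto (s : nat -> list A) (u : A -> C) h :
  exhausts s -> (forall a, 0 <= h a) -> summable h -> (forall a, Cmod (u a - 1) <= h a) ->
  exists l, tendsto finite_lists (fun t => Cprod t u) l.
Proof.
  intros Hex Hh Hsum Hu. assert (Hsum' := Hsum). destruct Hsum' as [B HB].
  assert (HC : forall eps, 0 < eps -> exists L, NoDup L /\ forall t, NoDup t -> incl L t ->
            Cmod (Cprod t u - Cprod L u) < eps).
  { intros eps Heps.
    assert (Heps' : 0 < eps / exp B) by (apply Rdiv_lt_0_compat; [lra | apply exp_pos]).
    destruct (exp_minus_1_small _ Heps') as (del & Hdel & Hexp).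
    destruct (summable_tail h del Hh Hsum Hdel) as (L & HL & Htail).
    exists L. split; [exact HL |]. intros t Ht Hi.
    destruct (Permutation_incl_app L t HL Ht Hi) as (r & P & Hr & Hd).
    rewrite (Cprod_perm _ _ _ P), Cprod_app.
    replace (Cprod L u * Cprod r u - Cprod L u)%C
      with (Cprod L u * (Cprod r u - 1))%C by ring.
    rewrite Cmod_mult.
    destruct (Cmod_Cprod_minus_1_le L u h (fun a _ => Hu a)) as [H1 _].
    destruct (Cmod_Cprod_minus_1_le r u h (fun a _ => Hu a)) as [_ H2].
    assert (H3 := Hexp _ (Htail r Hr Hd)).
    assert (H4 : exp (Rsum L h) <= exp B).
    { destruct (HB _ HL) as [Hlt | ->]; [left; now apply exp_increasing | lra]. }
    apply Rle_lt_trans with (exp B * Cmod (Cprod r u - 1)).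
    - apply Rmult_le_compat_r; [apply Cmod_ge_0 | lra].
    - replace eps with (exp B * (eps / exp B))
        by (field; assert (He := exp_pos B); lra).
      apply Rmult_lt_compat_l; [apply exp_pos | lra]. }
  destruct Hex as [Hn Hin].
  destruct (tendsto_cauchy (fun N => Cprod (s N) u)) as [l Hl].
  - intros eps Heps. destruct (HC (eps / 2) ltac:(lra)) as (L & HL & HLt).
    destruct (eventually_incl s L Hin) as [N HN]. exists N. intros n m Hnn Hm.
    assert (H1 := HLt _ (Hn n) (HN n Hnn)). assert (H2 := HLt _ (Hn m) (HN m Hm)).
    rewrite Cmod_minus_sym in H2.
    assert (H3 := Cmod_triangle3 (Cprod (s n) u) (Cprod L u) (Cprod (s m) u)). lra.
  - exists l. intros eps Heps. destruct (HC (eps / 3) ltac:(lra)) as (L & HL & HLt).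
    exists L. intros t Ht Hi.
    destruct (filter_and2 (eventually_incl s L Hin) (Hl (eps / 3) ltac:(lra)) _) as [N HN].
    destruct (HN N (Nat.le_refl N)) as [H1 H2].
    assert (H3 := HLt _ (Hn N) H1). assert (H4 := HLt t Ht Hi).
    rewrite Cmod_minus_sym in H3.
    assert (H5 := Cmod_triangle3 (Cprod t u) (Cprod L u) l).
    assert (H6 := Cmod_triangle3 (Cprod L u) (Cprod (s N) u) l). lra.
Qed.

(** Beyond a suitable finite list [L] the remaining product stays within 1/2 of 1, so every larger
    product has modulus at least half of that over [L], which is nonzero. *)
Lemma Cprod_limit_neq_0 (u : A -> C) h (l : C) :
  (forall a, 0 <= h a) -> summable h -> (forall a, Cmod (u a - 1) <= h a) ->
  (forall a, u a <> 0%C) -> tendsto finite_lists (fun t => Cprod t u) l -> l <> 0%C.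
Proof.
  intros Hh Hsum Hu Hu0 Hl ->.
  destruct (exp_minus_1_small (1 / 2) ltac:(lra)) as (del & Hdel & Hexp).
  destruct (summable_tail h del Hh Hsum Hdel) as (L & HL & Htail).
  assert (HLp : 0 < Cmod (Cprod L u)) by (apply Cmod_gt_0, Cprod_neq_0; auto).
  destruct (Hl (Cmod (Cprod L u) / 2) ltac:(lra)) as [t Ht].
  assert (Hex : exists r, NoDup r /\ incl L r /\ incl t r).
  { clear -HL. induction t as [| a t (r & H1 & H2 & H3)].
    - exists L. repeat split; [exact HL | intros a Ha; exact Ha | intros a []].
    - destruct (classic (In a r)) as [Ha | Ha].
      + exists r. repeat split; try assumption. intros b [<- | Hb]; [exact Ha | now apply H3].
      + exists (a :: r). repeat split.
        * now constructor.
        * intros b Hb. right. now apply H2.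
        * intros b [<- | Hb]; [now left | right; now apply H3]. }
  destruct Hex as (r & Hr & HLr & Htr).
  assert (H1 := Ht r Hr Htr).
  destruct (Permutation_incl_app L r HL Hr HLr) as (q & P & Hq & Hd).
  rewrite (Cprod_perm _ _ _ P), Cprod_app in H1.
  replace (Cprod L u * Cprod q u - 0)%C with (Cprod L u * Cprod q u)%C in H1 by ring.
  rewrite Cmod_mult in H1.
  destruct (Cmod_Cprod_minus_1_le q u h (fun a _ => Hu a)) as [_ H2].
  assert (H3 := Hexp _ (Htail q Hq Hd)).
  assert (H4 := Cmod_triangle_inv 1 (Cprod q u)).
  rewrite Cmod_1, (Cmod_minus_sym 1) in H4. nra.
Qed.

Lemma Csum_tendsto (s : nat -> list A) (u : A -> C) h :
  exhausts s -> (forall a, 0 <= h a) -> summable h -> (forall a, Cmod (u a) <= h a) ->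
  exists l, tendsto finite_lists (fun t => Csum t u) l.
Proof.
  intros [Hn Hin] Hh Hsum Hu.
  assert (HC : forall eps, 0 < eps -> exists L, forall t, NoDup t -> incl L t ->
            Cmod (Csum t u - Csum L u) < eps).
  { intros eps Heps. destruct (summable_tail h eps Hh Hsum Heps) as (L & HL & Htail).
    exists L. intros t Ht Hi.
    destruct (Permutation_incl_app L t HL Ht Hi) as (q & P & Hq & Hd).
    rewrite (Csum_perm _ _ _ P), Csum_app.
    replace (Csum L u + Csum q u - Csum L u)%C with (Csum q u) by ring.
    eapply Rle_lt_trans; [apply Cmod_Csum_le |].
    eapply Rle_lt_trans; [apply Rsum_le; intros a _; apply Hu | now apply Htail]. }
  destruct (tendsto_cauchy (fun N => Csum (s N) u)) as [l Hl].
  - intros eps Heps. destruct (HC (eps / 2) ltac:(lra)) as (L & HLt).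
    destruct (eventually_incl s L Hin) as [N HN]. exists N. intros n m Hnn Hm.
    assert (H1 := HLt _ (Hn n) (HN n Hnn)). assert (H2 := HLt _ (Hn m) (HN m Hm)).
    rewrite Cmod_minus_sym in H2.
    assert (H3 := Cmod_triangle3 (Csum (s n) u) (Csum L u) (Csum (s m) u)). lra.
  - exists l. intros eps Heps. destruct (HC (eps / 3) ltac:(lra)) as (L & HLt).
    exists L. intros t Ht Hi.
    destruct (filter_and2 (eventually_incl s L Hin) (Hl (eps / 3) ltac:(lra)) _) as [N HN].
    destruct (HN N (Nat.le_refl N)) as [H1 H2].
    assert (H3 := HLt _ (Hn N) H1). assert (H4 := HLt t Ht Hi).
    rewrite Cmod_minus_sym in H3.
    assert (H5 := Cmod_triangle3 (Csum t u) (Csum L u) l).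
    assert (H6 := Cmod_triangle3 (Csum L u) (Csum (s N) u) l). lra.
Qed.

(** Made for the finite q-binomial sums, where only the weights depend on [N], are bounded, and tend
    to one common constant. *)
Lemma Csum_dominated (s : nat -> list A) (w : nat -> A -> C) (c : C) (u : A -> C) h (W : R) :
  (forall a, 0 <= h a) -> summable h -> (forall N, NoDup (s N)) ->
  (forall a, Cmod (u a) <= h a) ->
  (forall N a, In a (s N) -> Cmod (w N a) <= W) ->
  (forall a, tendsto eventually (fun N => w N a) c) ->
  tendsto eventually (fun N => Csum (s N) (fun a => w N a * u a)%C - c * Csum (s N) u)%C 0.
Proof.
  intros Hh Hsum Hs Hu HW Hw.
  apply tendsto_squeeze with (fun N => Rsum (s N) (fun a => Cmod ((w N a - c) * u a))).
  - apply eventually_filter.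
  - apply filter_forall. intros N.
    rewrite <- Csum_scal.
    match goal with |- Cmod ?x <= _ =>
      replace x with (Csum (s N) (fun a => (w N a - c) * u a)%C) end.
    + apply Cmod_Csum_le.
    + generalize (s N). intros r. induction r as [| a r IH]; simpl; [ring | rewrite IH; ring].
  - assert (HK : 0 <= Rabs W + Cmod c) by (assert (H := Rabs_pos W); assert (H' := Cmod_ge_0 c); lra).
    apply Rsum_dominated with (h := fun a => (Rabs W + Cmod c) * h a).
    + intros a. apply Rmult_le_pos; auto.
    + apply summable_le with h (Rabs W + Cmod c); auto. intros a. lra.
    + exact Hs.
    + intros. apply Cmod_ge_0.
    + apply filter_forall. intros N a Ha. rewrite Cmod_mult.
      apply Rmult_le_compat; try apply Cmod_ge_0; [| apply Hu].
      assert (H1 := HW N a Ha). assert (H2 := Rle_abs W).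
      assert (H3 := Cmod_triangle (w N a) (- c)). rewrite Cmod_opp in H3.
      unfold Cminus. lra.
    + intros a eps Heps.
      assert (H0 : tendsto eventually (fun N => u a * (w N a - c))%C 0).
      { apply tendsto_0_bounded_mult with (Cmod (u a)).
        - apply eventually_filter.
        - apply filter_forall. intros _. lra.
        - apply -> (tendsto_minus_0 eventually); apply Hw. }
      generalize (H0 eps Heps). apply filter_imp. intros N HN.
      replace (u a * (w N a - c) - 0)%C with ((w N a - c) * u a)%C in HN by ring. exact HN.
Qed.

End Summable.

(** A finite set of pairs lies in the product of its two projections, where the sum factors;
    decidable equality serves to deduplicate the projections. *)
Lemma summable_prod {A B : Type}
  (decA : forall x y : A, {x = y} + {x <> y}) (decB : forall x y : B, {x = y} + {x <> y})
  (h : A -> R) (k : B -> R) :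
  (forall a, 0 <= h a) -> (forall b, 0 <= k b) -> summable h -> summable k ->
  summable (fun p => h (fst p) * k (snd p)).
Proof.
  intros Hh Hk [B1 H1] [B2 H2]. exists (B1 * B2). intros s Hs.
  apply Rle_trans with
    (Rsum (list_prod (nodup decA (map fst s)) (nodup decB (map snd s)))
          (fun p => h (fst p) * k (snd p))).
  - apply Rsum_incl; [| exact Hs |].
    + intros p. now apply Rmult_le_pos.
    + intros [a b] Hp. apply in_prod; apply nodup_In.
      * now apply in_map with (f := fst) in Hp.
      * now apply in_map with (f := snd) in Hp.
  - rewrite Rsum_list_prod.
    apply Rmult_le_compat; try (now apply Rsum_nonneg);
      [apply H1 | apply H2]; apply NoDup_nodup.
Qed.

(** * The complex exponential *)

Lemma Cexp_plus (x y : C) : Cexp (x + y) = (Cexp x * Cexp y)%C.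
Proof.
  destruct x as [a b], y as [c d]. unfold Cexp, Cmult, Cplus. simpl.
  rewrite exp_plus, cos_plus, sin_plus. f_equal; ring.
Qed.

Lemma Cexp_0 : Cexp 0 = 1%C.
Proof. unfold Cexp. simpl. rewrite exp_0, cos_0, sin_0. unfold RtoC. f_equal; ring. Qed.

Lemma Cexp_opp_r (x : C) : (Cexp x * Cexp (- x))%C = 1%C.
Proof. rewrite <- Cexp_plus. replace (x + - x)%C with (RtoC 0) by ring. apply Cexp_0. Qed.

Lemma C1_neq_0 : RtoC 1 <> RtoC 0.
Proof. intros E. apply (f_equal fst) in E. simpl in E. lra. Qed.

Lemma Cexp_neq_0 (x : C) : Cexp x <> 0%C.
Proof.
  intros E. assert (H := Cexp_opp_r x). rewrite E in H.
  apply C1_neq_0. rewrite <- H. ring.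
Qed.

Lemma Cexp_RtoC (x : R) : Cexp x = RtoC (exp x).
Proof. unfold Cexp. simpl. rewrite cos_0, sin_0. unfold RtoC. f_equal; ring. Qed.

Lemma Cexp_PI : Cexp (Ci * PI) = (- (1))%C.
Proof.
  unfold Cexp, Ci. simpl. replace (0 * PI - 1 * 0) with 0 by ring.
  replace (0 * 0 + 1 * PI) with PI by ring.
  rewrite exp_0, cos_PI, sin_PI. unfold RtoC, Copp. simpl. f_equal; ring.
Qed.

Lemma Cmod_Cexp (x : C) : Cmod (Cexp x) = exp (Re x).
Proof.
  unfold Cmod, Cexp. simpl.
  replace (exp (Re x) * cos (Im x) * (exp (Re x) * cos (Im x) * 1)
           + exp (Re x) * sin (Im x) * (exp (Re x) * sin (Im x) * 1))
    with (exp (Re x) * exp (Re x)).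
  - apply sqrt_square. left. apply exp_pos.
  - assert (H := sin2_cos2 (Im x)). unfold Rsqr in H.
    replace (exp (Re x) * exp (Re x))
      with (exp (Re x) * exp (Re x) * (sin (Im x) * sin (Im x) + cos (Im x) * cos (Im x)))
      by (rewrite H; ring).
    ring.
Qed.

Lemma Cexp_Csum {A : Type} (s : list A) (u : A -> C) :
  Cprod s (fun a => Cexp (u a)) = Cexp (Csum s u).
Proof.
  induction s as [| a s IH]; simpl; [now rewrite Cexp_0 | now rewrite Cexp_plus, IH].
Qed.

Lemma mean_value_le (f df : R -> R) (K : R) :
  (forall t, 0 <= t <= 1 -> is_derive f t (df t)) ->
  (forall t, 0 <= t <= 1 -> Rabs (df t) <= K) -> Rabs (f 1 - f 0) <= K.
Proof.
  intros Hd HK.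
  destruct (MVT_gen f 0 1 df) as (c & Hc & E).
  - intros x Hx. rewrite Rmin_left, Rmax_right in Hx by lra. apply Hd. lra.
  - intros x Hx. rewrite Rmin_left, Rmax_right in Hx by lra.
    apply continuity_pt_filterlim, (ex_derive_continuous f).
    exists (df x). apply Hd. lra.
  - rewrite Rmin_left, Rmax_right in Hc by lra.
    rewrite E. replace (df c * (1 - 0)) with (df c) by ring. now apply HK.
Qed.

(** The mean value theorem applies only to each component separately; this is where the factors 2 in
    the exponential estimates come from. *)
Lemma Cmod_le_2_components (z : C) (K : R) :
  Rabs (fst z) <= K -> Rabs (snd z) <= K -> Cmod z <= 2 * K.
Proof.
  intros H1 H2. eapply Rle_trans; [apply Cmod_2Rmax |].
  assert (Hs : sqrt 2 <= 2).
  { rewrite <- (sqrt_square 2) at 2 by lra. apply sqrt_le_1; lra. }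
  assert (Hm : Rmax (Rabs (fst z)) (Rabs (snd z)) <= K) by now apply Rmax_lub.
  assert (H0 := Rabs_pos (fst z)).
  apply Rmult_le_compat; try lra; [apply sqrt_pos |].
  eapply Rle_trans; [exact H0 | apply Rmax_l].
Qed.

Lemma Rabs_Im_le_Cmod (z : C) : Rabs (snd z) <= Cmod z.
Proof. eapply Rle_trans; [apply Rmax_r | apply Rmax_Cmod]. Qed.

Lemma Rabs_Re_le_Cmod (z : C) : Rabs (fst z) <= Cmod z.
Proof. eapply Rle_trans; [apply Rmax_l | apply Rmax_Cmod]. Qed.

Lemma Cexp_minus_1_le (u : C) : Cmod (Cexp u - 1) <= 2 * (Cmod u * exp (Cmod u)).
Proof.
  destruct u as [a b].
  assert (HK : forall t, 0 <= t <= 1 ->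
     Cmod ((a, b) * Cexp (t * (a, b))) <= Cmod (a, b) * exp (Cmod (a, b))).
  { intros t Ht. rewrite Cmod_mult, Cmod_Cexp.
    apply Rmult_le_compat_l; [apply Cmod_ge_0 |].
    assert (H1 := re_le_Cmod (a, b)). simpl in *.
    assert (H2 := Rle_abs a). assert (H3 := Rabs_pos a).
    assert (H4 : t * a - 0 * b <= Cmod (a, b)) by nra.
    destruct H4 as [H4 | H4]; [left; now apply exp_increasing | right; now f_equal]. }
  apply Cmod_le_2_components.
  - set (g := fun t => exp (t * a) * cos (t * b)).
    replace (fst (Cexp (a, b) - 1)%C) with (g 1 - g 0).
    2: { unfold g. simpl. replace (1 * a) with a by ring. replace (1 * b) with b by ring.
         replace (0 * a) with 0 by ring. replace (0 * b) with 0 by ring.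
         rewrite exp_0, cos_0. ring. }
    apply mean_value_le with (df := fun t => fst ((a, b) * Cexp (t * (a, b)))%C).
    + intros t _. unfold g. auto_derive; [trivial |]. simpl.
      replace (t * a - 0 * b) with (t * a) by ring.
      replace (t * b + 0 * a) with (t * b) by ring. ring.
    + intros t Ht. eapply Rle_trans; [apply Rabs_Re_le_Cmod | now apply HK].
  - set (g := fun t => exp (t * a) * sin (t * b)).
    replace (snd (Cexp (a, b) - 1)%C) with (g 1 - g 0).
    2: { unfold g. simpl. replace (1 * a) with a by ring. replace (1 * b) with b by ring.
         replace (0 * a) with 0 by ring. replace (0 * b) with 0 by ring.
         rewrite exp_0, sin_0. ring. }
    apply mean_value_le with (df := fun t => snd ((a, b) * Cexp (t * (a, b)))%C).
    + intros t _. unfold g. auto_derive; [trivial |]. simpl.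
      replace (t * a - 0 * b) with (t * a) by ring.
      replace (t * b + 0 * a) with (t * b) by ring. ring.
    + intros t Ht. eapply Rle_trans; [apply Rabs_Im_le_Cmod | now apply HK].
Qed.

Definition primary_factor (u : C) : C := ((1 - u) * Cexp (u + u * u / 2))%C.

(* Along the ray through u, the factor E(u) = (1 - u) exp(u + u^2/2) satisfies
   d/dt E(t u) = - t^2 u^3 exp(t u + t^2 u^2/2): this is where the third order comes from. *)
Lemma primary_factor_minus_1_le (u : C) :
  Cmod (primary_factor u - 1) <= 2 * (Cmod u ^ 3 * exp (Cmod u + Cmod u ^ 2)).
Proof.
  destruct u as [a b].
  set (K := Cmod (a, b) ^ 3 * exp (Cmod (a, b) + Cmod (a, b) ^ 2)).
  (* [p] and [r] are the real and imaginary parts of t u + (t u)^2 / 2; [g1] and [g2] below are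
     those of the factor at t u, and [D] is its derivative in t. *)
  set (p := fun t => t * a + t * t * (a * a - b * b) / 2).
  set (r := fun t => t * b + t * t * (a * b)).
  set (D := fun t : R => (RtoC (- (t * t)) * ((a, b) * ((a, b) * (a, b))) * Cexp (p t, r t))%C).
  assert (HK : forall t, 0 <= t <= 1 -> Cmod (D t) <= K).
  { intros t Ht. unfold D, K. rewrite !Cmod_mult, Cmod_Cexp, Cmod_R, Rabs_Ropp.
    rewrite (Rabs_right (t * t)) by nra.
    assert (H0 := Cmod_ge_0 (a, b)).
    apply Rmult_le_compat.
    - assert (0 <= Cmod (a, b) * (Cmod (a, b) * Cmod (a, b))) by (repeat apply Rmult_le_pos; lra).
      apply Rmult_le_pos; nra.
    - left. apply exp_pos.
    - assert (0 <= Cmod (a, b) * (Cmod (a, b) * Cmod (a, b))) by (repeat apply Rmult_le_pos; lra).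
      replace (Cmod (a, b) ^ 3) with (1 * (Cmod (a, b) * (Cmod (a, b) * Cmod (a, b)))) by ring.
      apply Rmult_le_compat_r; nra.
    - assert (H1 := re_le_Cmod (a, b)). simpl in H1.
      assert (H2 := Rle_abs a). assert (H3 := Rabs_pos a).
      assert (H4 := Rsqr_abs a). unfold Rsqr in H4.
      assert (H5 : p t <= Cmod (a, b) + Cmod (a, b) ^ 2).
      { unfold p. assert (a * a <= Cmod (a, b) ^ 2) by nra.
        assert (0 <= b * b) by nra. assert (0 <= t * t <= 1) by nra.
        assert (t * a <= Cmod (a, b)) by nra.
        assert (t * t * (a * a - b * b) <= 1 * (a * a)) by nra. nra. }
      simpl. simpl in H5.
      destruct H5 as [H5 | H5]; [left; now apply exp_increasing | right; now f_equal]. }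
  set (g1 := fun t => exp (p t) * ((1 - t * a) * cos (r t) + t * b * sin (r t))).
  set (g2 := fun t => exp (p t) * ((1 - t * a) * sin (r t) - t * b * cos (r t))).
  assert (E : (primary_factor (a, b) - 1)%C = (g1 1 - g1 0, g2 1 - g2 0)).
  { unfold g1, g2, p, r, primary_factor, Cexp.
    replace (0 * a + 0 * 0 * (a * a - b * b) / 2) with 0 by field.
    replace (0 * b + 0 * 0 * (a * b)) with 0 by ring.
    rewrite exp_0, cos_0, sin_0.
    replace (Re ((a, b) + (a, b) * (a, b) / 2)%C) with (1 * a + 1 * 1 * (a * a - b * b) / 2)
      by (simpl; field).
    replace (Im ((a, b) + (a, b) * (a, b) / 2)%C) with (1 * b + 1 * 1 * (a * b))
      by (simpl; field).
    unfold Cminus, Cmult, Cplus, Copp. simpl. f_equal; ring. }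
  rewrite E. clear E. apply Cmod_le_2_components; simpl.
  - apply mean_value_le with (df := fun t => fst (D t)).
    + intros t _. unfold g1, D, p, r, Cexp. auto_derive; [trivial |]. simpl. unfold Rdiv. field.
    + intros t Ht. eapply Rle_trans; [apply Rabs_Re_le_Cmod | now apply HK].
  - apply mean_value_le with (df := fun t => snd (D t)).
    + intros t _. unfold g2, D, p, r, Cexp. auto_derive; [trivial |]. simpl. unfold Rdiv. field.
    + intros t Ht. eapply Rle_trans; [apply Rabs_Im_le_Cmod | now apply HK].
Qed.

(** * A convergent comparison series *)

(** A telescoping difference of order m^(-3/2), so its sum is explicit. The exponent 3/2 is chosen
    so that two majorants multiply to the d^(-3) decay of the Weierstrass factors. *)
Definition majorant (m : R) : R := / sqrt (m + 1) - / sqrt (m + 2).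

(** With a and b the two square roots, b^2 - a^2 = 1 gives 1/a - 1/b = 1/(ab(a+b)). *)
Lemma majorant_lower (m d : R) : 0 <= m <= d -> / (2 * sqrt (d + 2) ^ 3) <= majorant m.
Proof.
  intros H. unfold majorant.
  assert (H1 : 0 < sqrt (m + 1)) by (apply sqrt_lt_R0; lra).
  assert (H2 : 0 < sqrt (m + 2)) by (apply sqrt_lt_R0; lra).
  assert (H3 : sqrt (m + 1) <= sqrt (d + 2)) by (apply sqrt_le_1; lra).
  assert (H4 : sqrt (m + 2) <= sqrt (d + 2)) by (apply sqrt_le_1; lra).
  assert (E1 := sqrt_sqrt (m + 1) ltac:(lra)).
  assert (E2 := sqrt_sqrt (m + 2) ltac:(lra)).
  set (a := sqrt (m + 1)) in *. set (b := sqrt (m + 2)) in *. set (c := sqrt (d + 2)) in *.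
  replace (/ a - / b) with (/ (a * b * (a + b))).
  2: { replace (/ a - / b) with ((b * b - a * a) * / (a * b * (a + b))) by (field; lra).
       rewrite E1, E2. field. lra. }
  apply Rinv_le_contravar.
  - repeat apply Rmult_lt_0_compat; lra.
  - assert (a * b <= c * c) by (apply Rmult_le_compat; lra).
    assert (a * b * (a + b) <= c * c * (c + c)).
    { apply Rmult_le_compat; try lra. apply Rmult_le_pos; lra. }
    simpl. lra.
Qed.

Lemma majorant_nonneg (m : R) : 0 <= m -> 0 <= majorant m.
Proof.
  intros H. eapply Rle_trans; [| apply (majorant_lower m m); lra].
  left. apply Rinv_0_lt_compat.
  assert (0 < sqrt (m + 2)) by (apply sqrt_lt_R0; lra).
  assert (0 < sqrt (m + 2) ^ 3) by now apply pow_lt. lra.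
Qed.

Lemma majorant_sq (m d : R) : 0 <= m <= d -> / (d + 2) ^ 2 <= 2 * majorant m.
Proof.
  intros H. assert (H1 := majorant_lower m d H).
  assert (E := sqrt_sqrt (d + 2) ltac:(lra)).
  assert (H2 : 1 <= sqrt (d + 2)) by (rewrite <- sqrt_1; apply sqrt_le_1; lra).
  set (c := sqrt (d + 2)) in *. rewrite <- E.
  apply Rle_trans with (2 * / (2 * c ^ 3)); [| lra].
  replace (2 * / (2 * c ^ 3)) with (/ c ^ 3) by (field; lra).
  assert (0 < c ^ 3) by (apply pow_lt; lra).
  apply Rinv_le_contravar; [assumption |]. simpl. simpl in *. nra.
Qed.

(** Reduces the sum over the lattice to a product of two sums over the integers, [d] being the
    larger of the two indices. *)
Lemma majorant_cube (m n d : R) :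
  0 <= m <= d -> 0 <= n <= d -> / (d + 2) ^ 3 <= 4 * (majorant m * majorant n).
Proof.
  intros Hm Hn. assert (H1 := majorant_lower m d Hm). assert (H2 := majorant_lower n d Hn).
  assert (E := sqrt_sqrt (d + 2) ltac:(lra)).
  assert (Hc : 0 < sqrt (d + 2)) by (apply sqrt_lt_R0; lra).
  set (c := sqrt (d + 2)) in *. rewrite <- E.
  assert (Hp : 0 < / (2 * c ^ 3)).
  { apply Rinv_0_lt_compat. assert (0 < c ^ 3) by now apply pow_lt. lra. }
  replace (/ (c * c) ^ 3) with (4 * (/ (2 * c ^ 3) * / (2 * c ^ 3))) by (field; lra).
  apply Rmult_le_compat_l; [lra |]. apply Rmult_le_compat; lra.
Qed.

Lemma Rsum_majorant_seq (N : nat) :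
  Rsum (seq 0 N) (fun k => majorant (INR k)) = 1 - / sqrt (INR N + 1).
Proof.
  induction N as [| N IH].
  - simpl. replace (0 + 1) with 1 by ring. rewrite sqrt_1. field.
  - rewrite seq_S, Rsum_app, IH. simpl Rsum. rewrite S_INR. unfold majorant. simpl plus.
    replace (INR N + 1 + 1) with (INR N + 2) by ring. ring.
Qed.

Lemma summable_majorant_nat : summable (fun k : nat => majorant (INR k)).
Proof.
  exists 1. intros s Hs.
  destruct (eventually_incl (fun N => seq 0 N) s) as [N HN].
  { intros k. exists (S k). intros n Hn. apply in_seq. lia. }
  eapply Rle_trans.
  - apply Rsum_incl with (t := seq 0 N); [| exact Hs | apply HN, Nat.le_refl].
    intros k. apply majorant_nonneg, pos_INR.
  - rewrite Rsum_majorant_seq.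
    assert (0 < / sqrt (INR N + 1)); [| lra].
    apply Rinv_0_lt_compat, sqrt_lt_R0. assert (H := pos_INR N). lra.
Qed.

Definition majorantZ (k : Z) : R := majorant (Rabs (IZR k)).

Lemma majorantZ_nonneg (k : Z) : 0 <= majorantZ k.
Proof. apply majorant_nonneg, Rabs_pos. Qed.

Lemma summable_majorantZ : summable majorantZ.
Proof.
  exists 2. intros s Hs.
  destruct (eventually_incl
    (fun N => map Z.of_nat (seq 0 N) ++ map (fun k => (- Z.of_nat k)%Z) (seq 0 N)) s) as [N HN].
  { intros k. exists (S (Z.abs_nat k)). intros n Hn. apply in_or_app.
    destruct (Z_le_gt_dec 0 k); [left | right]; apply in_map_iff; exists (Z.abs_nat k);
      split; try lia; apply in_seq; lia. }
  eapply Rle_trans.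
  - apply Rsum_incl; [apply majorantZ_nonneg | exact Hs | apply (HN N), Nat.le_refl].
  - rewrite Rsum_app, !Rsum_map.
    assert (E : forall f : nat -> R, (forall k, f k = majorant (INR k)) -> Rsum (seq 0 N) f <= 1).
    { intros f Hf. eapply Rle_trans; [apply Rsum_le; intros a _; rewrite Hf; apply Rle_refl |].
      rewrite Rsum_majorant_seq.
      assert (0 < / sqrt (INR N + 1)); [| lra].
      apply Rinv_0_lt_compat, sqrt_lt_R0. assert (H := pos_INR N). lra. }
    replace 2 with (1 + 1) by ring.
    apply Rplus_le_compat; apply E; intros k; unfold majorantZ;
      rewrite ?opp_IZR, ?Rabs_Ropp, <- INR_IZR_INZ, Rabs_right; auto; apply Rle_ge, pos_INR.
Qed.

(** * Lists of integers *)

Lemma In_Zball (N : nat) (k : Z) : In k (Zball N) <-> (Z.abs k <= Z.of_nat N)%Z.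
Proof.
  unfold Zball. rewrite in_map_iff. split.
  - intros (j & <- & H). apply in_seq in H. lia.
  - intros H. exists (Z.to_nat (k + Z.of_nat N)). split; [lia |]. apply in_seq. lia.
Qed.

Lemma NoDup_Zball (N : nat) : NoDup (Zball N).
Proof.
  unfold Zball. apply FinFun.Injective_map_NoDup; [intros x y H; lia | apply seq_NoDup].
Qed.

Lemma exhausts_Zball : exhausts Zball.
Proof.
  split; [apply NoDup_Zball |]. intros k. exists (Z.abs_nat k). intros N HN.
  apply In_Zball. lia.
Qed.

Lemma NoDup_list_prod {A B : Type} (s : list A) (t : list B) :
  NoDup s -> NoDup t -> NoDup (list_prod s t).
Proof.
  intros Hs Ht. induction Hs as [| a s Ha Hs IH]; simpl; [constructor |].
  apply NoDup_app; [| exact IH |].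
  - apply FinFun.Injective_map_NoDup; [intros x y H; congruence | exact Ht].
  - intros p Hp Hq. apply in_map_iff in Hp as (b & <- & Hb).
    apply in_prod_iff in Hq. tauto.
Qed.

Lemma exhausts_list_prod {A B : Type} (s : nat -> list A) (t : nat -> list B) :
  exhausts s -> exhausts t -> exhausts (fun N => list_prod (s N) (t N)).
Proof.
  intros [Hs1 Hs2] [Ht1 Ht2]. split.
  - intros N. now apply NoDup_list_prod.
  - intros [a b]. generalize (filter_and2 (Hs2 a) (Ht2 b) _). apply filter_imp.
    intros N [H1 H2]. now apply in_prod.
Qed.

Lemma Permutation_Zball_S (N : nat) :
  Permutation (Zball (S N)) (Zball N ++ (Z.of_nat (S N) :: (- Z.of_nat (S N))%Z :: nil)).
Proof.
  apply NoDup_Permutation.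
  - apply NoDup_Zball.
  - apply NoDup_app; [apply NoDup_Zball | |].
    + constructor; [simpl; lia | constructor; [simpl; tauto | constructor]].
    + intros a Ha. apply In_Zball in Ha. simpl. lia.
  - intros k. rewrite in_app_iff, !In_Zball. simpl In. lia.
Qed.

Lemma Cprod_Zball_S (N : nat) (u : Z -> C) :
  Cprod (Zball (S N)) u
  = (Cprod (Zball N) u * (u (Z.of_nat (S N)) * u (- Z.of_nat (S N))%Z))%C.
Proof. rewrite (Cprod_perm _ _ _ (Permutation_Zball_S N)), Cprod_app. simpl. ring. Qed.

Lemma Cprod_Zball_0 (u : Z -> C) : Cprod (Zball 0) u = u 0%Z.
Proof. unfold Zball. simpl. ring. Qed.

(** * The sine product *)

Lemma tendsto_inv {T : Type} (F : (T -> Prop) -> Prop) {FF : Filter F} (u : T -> C) (l : C) :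
  l <> 0%C -> tendsto F u l -> tendsto F (fun x => / u x)%C (/ l)%C.
Proof.
  intros Hl Hu.
  assert (Hp : 0 < Cmod l) by now apply Cmod_gt_0.
  apply tendsto_minus_0; [exact FF |].
  assert (H1 : F (fun x => Cmod l / 2 < Cmod (u x))).
  { generalize (Hu (Cmod l / 2) ltac:(lra)). apply filter_imp. intros x Hx.
    assert (H := Cmod_triangle_inv l (u x)). rewrite Cmod_minus_sym in H. lra. }
  apply tendsto_ext with (fun x => (- / (u x * l)) * (u x - l))%C; [exact FF | |].
  - revert H1. apply filter_imp. intros x Hx.
    assert (u x <> 0%C) by (apply Cmod_gt_0; lra). field. split; assumption.
  - apply tendsto_0_bounded_mult with (/ (Cmod l / 2 * Cmod l)); [exact FF | |].
    + revert H1. apply filter_imp. intros x Hx.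
      assert (u x <> 0%C) by (apply Cmod_gt_0; lra).
      rewrite Cmod_opp, Cmod_inv by now apply Cmod_gt_0; rewrite Cmod_mult; nra.
      rewrite Cmod_mult. apply Rinv_le_contravar; [nra |].
      apply Rmult_le_compat_r; lra.
    + now apply -> (tendsto_minus_0 F).
Qed.

(** The mean value theorem for exp(t u) - t u, whose derivative u (exp(t u) - 1) is controlled by
    the first-order bound. *)
Lemma Cexp_second_order (u : C) :
  Cmod (Cexp u - 1 - u) <= 4 * (Cmod u ^ 2 * exp (Cmod u)).
Proof.
  destruct u as [a b].
  set (D := fun t : R => ((a, b) * (Cexp (RtoC t * (a, b)) - 1))%C).
  assert (HK : forall t, 0 <= t <= 1 ->
     Cmod (D t) <= 2 * (Cmod (a, b) ^ 2 * exp (Cmod (a, b)))).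
  { intros t Ht. unfold D. rewrite Cmod_mult.
    assert (H := Cexp_minus_1_le (RtoC t * (a, b))).
    rewrite Cmod_mult, Cmod_R, Rabs_right in H by lra.
    assert (H0 := Cmod_ge_0 (a, b)). set (r := Cmod (a, b)) in *.
    assert (H1 : exp (t * r) <= exp r).
    { assert (H1 : t * r <= r) by nra.
      destruct H1 as [H1 | H1]; [left; now apply exp_increasing | right; now f_equal]. }
    assert (H2 : t * r * exp (t * r) <= r * exp r).
    { assert (H3 := exp_pos (t * r)). apply Rmult_le_compat; nra. }
    replace (2 * (r ^ 2 * exp r)) with (r * (2 * (r * exp r))) by ring.
    apply Rmult_le_compat_l; lra. }
  replace (4 * (Cmod (a, b) ^ 2 * exp (Cmod (a, b))))
    with (2 * (2 * (Cmod (a, b) ^ 2 * exp (Cmod (a, b))))) by ring.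
  set (g1 := fun t => exp (t * a) * cos (t * b) - t * a).
  set (g2 := fun t => exp (t * a) * sin (t * b) - t * b).
  assert (E : (Cexp (a, b) - 1 - (a, b))%C = (g1 1 - g1 0, g2 1 - g2 0)).
  { unfold g1, g2, Cexp. simpl.
    replace (1 * a) with a by ring. replace (1 * b) with b by ring.
    replace (0 * a) with 0 by ring. replace (0 * b) with 0 by ring.
    rewrite exp_0, cos_0, sin_0.
    unfold Cminus, Cplus, Copp, RtoC. simpl. f_equal; ring. }
  rewrite E. clear E. apply Cmod_le_2_components; simpl.
  - apply mean_value_le with (df := fun t => fst (D t)).
    + intros t _. unfold g1, D, Cexp. auto_derive; [trivial |]. simpl.
      replace (t * a - 0 * b) with (t * a) by ring.
      replace (t * b + 0 * a) with (t * b) by ring. ring.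
    + intros t Ht. eapply Rle_trans; [apply Rabs_Re_le_Cmod | now apply HK].
  - apply mean_value_le with (df := fun t => snd (D t)).
    + intros t _. unfold g2, D, Cexp. auto_derive; [trivial |]. simpl.
      replace (t * a - 0 * b) with (t * a) by ring.
      replace (t * b + 0 * a) with (t * b) by ring. ring.
    + intros t Ht. eapply Rle_trans; [apply Rabs_Im_le_Cmod | now apply HK].
Qed.

(* dsin u = 2 i sin u *)
Definition dsin (u : C) : C := (Cexp (Ci * u) - Cexp (- (Ci * u)))%C.

Lemma dsin_plus_minus (v a : C) :
  (dsin (v + a) * dsin (v - a))%C = (dsin v * dsin v - dsin a * dsin a)%C.
Proof.
  unfold dsin.
  replace (Ci * (v + a))%C with (Ci * v + Ci * a)%C by ring.
  replace (Ci * (v - a))%C with (Ci * v + - (Ci * a))%C by ring.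
  replace (- (Ci * v + Ci * a))%C with (- (Ci * v) + - (Ci * a))%C by ring.
  replace (- (Ci * v + - (Ci * a)))%C with (- (Ci * v) + Ci * a)%C by ring.
  rewrite !Cexp_plus.
  assert (H1 := Cexp_opp_r (Ci * v)). assert (H2 := Cexp_opp_r (Ci * a)).
  set (x := Cexp (Ci * v)) in *. set (y := Cexp (- (Ci * v))) in *.
  set (p := Cexp (Ci * a)) in *. set (q := Cexp (- (Ci * a))) in *.
  replace ((x * p - y * q) * (x * q - y * p))%C
    with ((x * x + y * y) * (p * q) - (x * y) * (p * p + q * q))%C by ring.
  rewrite H1, H2.
  replace ((x - y) * (x - y) - (p - q) * (p - q))%C
    with (x * x + y * y - 2 * (x * y) - (p * p + q * q) + 2 * (p * q))%C by ring.
  rewrite H1, H2. ring.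
Qed.

(** Triplication is preferred to duplication because the 3^k shifts it produces form a list
    symmetric about 0, hence a [Zball]. *)
Lemma dsin_triple (v : C) :
  dsin (3 * v) = (dsin v * (dsin (v + PI / 3) * dsin (v - PI / 3)))%C.
Proof.
  (* The value is i times the square root of 3, and its square -3 is the constant of the
     triple-angle formula. *)
  assert (Hpi : dsin (PI / 3) = (0, sqrt 3)).
  { unfold dsin, Cexp, Ci. simpl.
    replace (0 * (PI * (3 / (3 * (3 * 1) + 0 * (0 * 1))) - 0 * (- 0 / (3 * (3 * 1) + 0 * (0 * 1)))) -
      1 * (PI * (- 0 / (3 * (3 * 1) + 0 * (0 * 1))) + 0 * (3 / (3 * (3 * 1) + 0 * (0 * 1))))) with 0 by field.
    replace (0 * (PI * (- 0 / (3 * (3 * 1) + 0 * (0 * 1))) + 0 * (3 / (3 * (3 * 1) + 0 * (0 * 1)))) +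
      1 * (PI * (3 / (3 * (3 * 1) + 0 * (0 * 1))) - 0 * (- 0 / (3 * (3 * 1) + 0 * (0 * 1))))) with (PI / 3) by field.
    rewrite Ropp_0, exp_0, cos_neg, sin_neg, cos_PI3, sin_PI3.
    unfold Cminus, Cplus, Copp. simpl. f_equal; field. }
  rewrite dsin_plus_minus, Hpi.
  replace ((0, sqrt 3) * (0, sqrt 3))%C with (RtoC (- 3)).
  2: { assert (H := sqrt_sqrt 3 ltac:(lra)).
       unfold Cmult, RtoC. simpl. f_equal; [| ring].
       rewrite H. ring. }
  unfold dsin.
  replace (Ci * (3 * v))%C with (Ci * v + (Ci * v + Ci * v))%C by ring.
  replace (- (Ci * v + (Ci * v + Ci * v)))%C
    with (- (Ci * v) + (- (Ci * v) + - (Ci * v)))%C by ring.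
  rewrite !Cexp_plus.
  assert (H1 := Cexp_opp_r (Ci * v)).
  set (x := Cexp (Ci * v)) in *. set (y := Cexp (- (Ci * v))) in *.
  replace ((x - y) * ((x - y) * (x - y) - RtoC (- 3)))%C
    with (x * (x * x) - y * (y * y) + 3 * (1 - x * y) * (x - y))%C
    by (replace (RtoC (- 3)) with (- (3))%C by (now rewrite <- RtoC_opp); ring).
  rewrite H1. ring.
Qed.

(** Residues modulo 3: each integer of the larger ball is 3j, 3j + 1 or 3j - 1 for exactly one j of
    the smaller ball. *)
Lemma Cprod_Zball_triple (M : nat) (u : Z -> C) :
  Cprod (Zball (3 * M + 1)) u
  = Cprod (Zball M) (fun j => u (3 * j)%Z * (u (3 * j + 1)%Z * u (3 * j - 1)%Z))%C.
Proof.
  induction M as [| M IH].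
  - replace (3 * 0 + 1)%nat with 1%nat by lia.
    rewrite Cprod_Zball_S, !Cprod_Zball_0. reflexivity.
  - replace (3 * S M + 1)%nat with (S (S (S (3 * M + 1)))) by lia.
    rewrite !Cprod_Zball_S, IH.
    replace (3 * Z.of_nat (S M))%Z with (Z.of_nat (S (S (3 * M + 1)))) by lia.
    replace (Z.of_nat (S (S (3 * M + 1))) + 1)%Z with (Z.of_nat (S (S (S (3 * M + 1))))) by lia.
    replace (Z.of_nat (S (S (3 * M + 1))) - 1)%Z with (Z.of_nat (S (3 * M + 1))) by lia.
    replace (3 * - Z.of_nat (S M))%Z with (- Z.of_nat (S (S (3 * M + 1))))%Z by lia.
    replace (- Z.of_nat (S (S (3 * M + 1))) + 1)%Z with (- Z.of_nat (S (3 * M + 1)))%Z by lia.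
    replace (- Z.of_nat (S (S (3 * M + 1))) - 1)%Z
      with (- Z.of_nat (S (S (S (3 * M + 1)))))%Z by lia.
    ring.
Qed.

(** The radius (3^k - 1)/2 of the ball with 3^k elements. *)
Fixpoint half_pow3 (k : nat) : nat :=
  match k with O => 0%nat | S k => (3 * half_pow3 k + 1)%nat end.

Lemma half_pow3_spec (k : nat) : 2 * INR (half_pow3 k) + 1 = 3 ^ k.
Proof.
  induction k as [| k IH]; [simpl; ring |].
  change (half_pow3 (S k)) with (3 * half_pow3 k + 1)%nat. simpl pow.
  rewrite <- IH, plus_INR, mult_INR. simpl. ring.
Qed.

Lemma pow3_gt_0 (k : nat) : 0 < 3 ^ k.
Proof. apply pow_lt. lra. Qed.

Lemma RtoC_neq_0 (x : R) : x <> 0 -> RtoC x <> 0%C.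
Proof. intros H E. apply H. now apply RtoC_inj. Qed.

(** Iterated triplication, applied to u/3: the arguments u/3, u/3 + pi/3 and u/3 - pi/3 at level k
    become the residues 0, 1 and -1 modulo 3 at level k + 1. *)
Lemma dsin_prod (k : nat) (u : C) :
  dsin u = Cprod (Zball (half_pow3 k)) (fun j => dsin ((u + RtoC (IZR j) * PI) / RtoC (3 ^ k))).
Proof.
  revert u. induction k as [| k IH]; intros u.
  - simpl half_pow3. rewrite Cprod_Zball_0. f_equal. simpl. field.
  - change (half_pow3 (S k)) with (3 * half_pow3 k + 1)%nat. rewrite Cprod_Zball_triple.
    replace (dsin u) with (dsin (3 * (u / 3))) by (f_equal; field; apply RtoC_neq_0; lra).
    rewrite dsin_triple, (IH (u / 3)%C), (IH (u / 3 + PI / 3)%C), (IH (u / 3 - PI / 3)%C).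
    rewrite <- !Cprod_mult. apply Cprod_ext. intros j _.
    assert (H3 : RtoC (3 ^ k) <> 0%C) by (apply RtoC_neq_0; assert (H := pow3_gt_0 k); lra).
    assert (H4 : RtoC 3 <> 0%C) by (apply RtoC_neq_0; lra).
    simpl pow. rewrite RtoC_mult, plus_IZR, minus_IZR, mult_IZR, RtoC_plus, RtoC_minus, RtoC_mult.
    f_equal; [| f_equal]; f_equal; field; assumption.
Qed.

Lemma Cprod_seq_S (M : nat) (u : nat -> C) :
  Cprod (seq 0 (S M)) u = (Cprod (seq 0 M) u * u M)%C.
Proof. rewrite seq_S, Cprod_app. simpl. ring. Qed.

Lemma Cprod_Zball_seq (M : nat) (u : Z -> C) :
  Cprod (Zball M) u
  = (u 0%Z * Cprod (seq 0 M) (fun j => u (Z.of_nat (S j)) * u (- Z.of_nat (S j))%Z))%C.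
Proof.
  induction M as [| M IH].
  - rewrite Cprod_Zball_0. simpl. ring.
  - rewrite Cprod_Zball_S, IH, Cprod_seq_S. ring.
Qed.

Lemma Cmod_dsin_real (a : R) : Cmod (dsin a) = 2 * Rabs (sin a).
Proof.
  replace (dsin a) with (RtoC (2 * sin a) * Ci)%C.
  - rewrite Cmod_mult, Cmod_Ci, Cmod_R, Rabs_mult, (Rabs_right 2) by lra. ring.
  - unfold dsin, Cexp, Ci, RtoC. simpl.
    replace (0 * a - 1 * 0) with 0 by ring. replace (0 * 0 + 1 * a) with a by ring.
    rewrite Ropp_0, exp_0, cos_neg, sin_neg.
    unfold Cmult, Cminus, Cplus, Copp. simpl. f_equal; ring.
Qed.

(** For 0 <= a <= 2 one has a - a^3/6 >= a/3, and the next two Taylor terms are together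
    nonnegative. This keeps the denominators of the finite sine product away from 0. *)
Lemma sin_ge_third (a : R) : 0 <= a <= PI / 2 -> a / 3 <= sin a.
Proof.
  intros H. assert (H1 := PI_4).
  destruct (SIN a) as [Hs _]; [lra | lra |].
  eapply Rle_trans; [| exact Hs].
  unfold sin_lb, sin_approx, sin_term. simpl.
  assert (Ha : 0 <= a <= 2) by lra.
  assert (H2 : 0 <= a * a <= 4) by nra.
  assert (H3 : 0 <= a * (a * a) * (a * a) * (1 - a * a / 42)).
  { repeat apply Rmult_le_pos; lra. }
  assert (H4 : 0 <= a * (4 - a * a)) by (apply Rmult_le_pos; lra).
  field_simplify. field_simplify in H3. field_simplify in H4. lra.
Qed.

Lemma dsin_linear (u : C) : Cmod (dsin u - 2 * Ci * u) <= 8 * (Cmod u ^ 2 * exp (Cmod u)).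
Proof.
  unfold dsin.
  replace (Cexp (Ci * u) - Cexp (- (Ci * u)) - 2 * Ci * u)%C
    with ((Cexp (Ci * u) - 1 - Ci * u) - (Cexp (- (Ci * u)) - 1 - - (Ci * u)))%C by ring.
  assert (H1 := Cexp_second_order (Ci * u)). assert (H2 := Cexp_second_order (- (Ci * u))).
  rewrite Cmod_opp in H2. rewrite Cmod_mult, Cmod_Ci, Rmult_1_l in H1, H2.
  unfold Cminus at 1. eapply Rle_trans; [apply Cmod_triangle |]. rewrite Cmod_opp. lra.
Qed.

(** Bounds [K * dsin (u / K)] uniformly in K >= 1: the linear part plus the largest quadratic
    error. *)
Definition dsin_bound (u : C) : R := 2 * Cmod u + 8 * (Cmod u ^ 2 * exp (Cmod u)).

Lemma dsin_scaled (u : C) (K : R) : 1 <= K ->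
  Cmod (RtoC K * dsin (u / RtoC K) - 2 * Ci * u) <= 8 * (Cmod u ^ 2 * exp (Cmod u)) * / K.
Proof.
  intros HK.
  assert (HK0 : RtoC K <> 0%C) by (apply RtoC_neq_0; lra).
  replace (RtoC K * dsin (u / RtoC K) - 2 * Ci * u)%C
    with (RtoC K * (dsin (u / RtoC K) - 2 * Ci * (u / RtoC K)))%C by (field; assumption).
  rewrite Cmod_mult, Cmod_R, Rabs_right by lra.
  assert (H := dsin_linear (u / RtoC K)).
  rewrite Cmod_div, Cmod_R, Rabs_right in H by (try assumption; lra).
  assert (H0 := Cmod_ge_0 u). set (r := Cmod u) in *.
  assert (Hi : 0 < / K) by (apply Rinv_0_lt_compat; lra).
  assert (Hi1 : / K <= 1) by (rewrite <- Rinv_1; apply Rinv_le_contravar; lra).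
  assert (H1 : exp (r / K) <= exp r).
  { assert (H1 : r / K <= r) by (unfold Rdiv; nra).
    destruct H1 as [H1 | H1]; [left; now apply exp_increasing | right; now f_equal]. }
  apply Rle_trans with (K * (8 * ((r / K) ^ 2 * exp r))).
  - apply Rmult_le_compat_l; [lra |]. eapply Rle_trans; [exact H |].
    apply Rmult_le_compat_l; [lra |]. apply Rmult_le_compat_l; [apply pow2_ge_0 | exact H1].
  - right. field. lra.
Qed.

Lemma Cmod_2Ci (u : C) : Cmod (2 * Ci * u) = 2 * Cmod u.
Proof. rewrite !Cmod_mult, Cmod_Ci, Cmod_R, Rabs_right by lra. ring. Qed.

Lemma dsin_scaled_bound (u : C) (K : R) : 1 <= K ->
  Cmod (RtoC K * dsin (u / RtoC K)) <= dsin_bound u.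
Proof.
  intros HK. assert (H := dsin_scaled u K HK).
  assert (H1 := Cmod_triangle_inv (RtoC K * dsin (u / RtoC K)) (2 * Ci * u)).
  rewrite Cmod_2Ci in H1.
  assert (Hi : 0 < / K) by (apply Rinv_0_lt_compat; lra).
  assert (Hi1 : / K <= 1) by (rewrite <- Rinv_1; apply Rinv_le_contravar; lra).
  assert (H2 : 0 <= Cmod u ^ 2 * exp (Cmod u))
    by (apply Rmult_le_pos; [apply pow2_ge_0 | left; apply exp_pos]).
  unfold dsin_bound. nra.
Qed.

Lemma eventually_inv_pow3 (B eps : R) :
  0 < eps -> eventually (fun k => B * / 3 ^ k < eps).
Proof.
  intros Heps.
  assert (H : is_lim_seq (fun k => B * (/ 3) ^ k) 0).
  { replace (Finite 0) with (Rbar_mult B 0) by (simpl; f_equal; ring).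
    apply is_lim_seq_scal_l, is_lim_seq_geom. rewrite Rabs_right; lra. }
  apply is_lim_seq_spec in H. generalize (H (mkposreal _ Heps)). apply filter_imp.
  simpl. intros k Hk. rewrite Rminus_0_r, pow_inv in Hk.
  eapply Rle_lt_trans; [apply Rle_abs | exact Hk].
Qed.

Lemma pow3_ge_1 (k : nat) : 1 <= 3 ^ k.
Proof. apply pow_R1_Rle. lra. Qed.

Lemma dsin_scaled_tendsto (u : C) :
  tendsto eventually (fun k => RtoC (3 ^ k) * dsin (u / RtoC (3 ^ k)))%C (2 * Ci * u).
Proof.
  apply tendsto_squeeze with (fun k => 8 * (Cmod u ^ 2 * exp (Cmod u)) * / 3 ^ k).
  - apply eventually_filter.
  - apply filter_forall. intros k. apply dsin_scaled, pow3_ge_1.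
  - intros eps Heps. now apply eventually_inv_pow3.
Qed.

(** The shift by one matches [seq 0 M]: the zero at the origin is split off from the sine
    product. *)
Definition pi_multiple (j : nat) : C := (RtoC (INR (S j)) * PI)%C.

Lemma pi_multiple_neq_0 (j : nat) : pi_multiple j <> 0%C.
Proof.
  assert (H := PI_RGT_0). assert (Hj : 0 < INR (S j)) by (apply lt_0_INR; lia).
  apply Cmult_neq_0; apply RtoC_neq_0; lra.
Qed.

Lemma Cmod_pi_multiple (j : nat) : INR (S j) <= Cmod (pi_multiple j).
Proof.
  assert (H := PI2_1). assert (Hj : 0 < INR (S j)) by (apply lt_0_INR; lia).
  unfold pi_multiple. rewrite Cmod_mult, !Cmod_R, !Rabs_right by lra. nra.
Qed.

(** The condition on [j] puts the angle in [0, pi/2], where [sin_ge_third] applies, and the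
    remaining constant 2 pi / 3 exceeds 1. *)
Lemma dsin_scaled_lower (k j : nat) : (j < half_pow3 k)%nat ->
  INR (S j) <= Cmod (RtoC (3 ^ k) * dsin (pi_multiple j / RtoC (3 ^ k))).
Proof.
  intros Hj. assert (HK := pow3_ge_1 k). assert (E := half_pow3_spec k).
  assert (Hpi := PI_RGT_0). assert (Hpi' := PI2_3_2).
  assert (Hj' : INR (S j) <= INR (half_pow3 k)) by (apply le_INR; lia).
  assert (Hj0 : 0 < INR (S j)) by (apply lt_0_INR; lia).
  unfold pi_multiple. rewrite <- RtoC_mult, <- RtoC_div by lra.
  rewrite Cmod_mult, Cmod_R, Cmod_dsin_real, (Rabs_right (3 ^ k)) by lra.
  assert (Hx : 0 <= INR (S j) * PI / 3 ^ k <= PI / 2).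
  { split.
    - apply Rle_div_r; [lra |]. nra.
    - apply Rle_div_l; [lra |]. rewrite <- E. nra. }
  assert (Hs := sin_ge_third _ Hx).
  rewrite Rabs_right by lra.
  apply Rle_trans with (3 ^ k * (2 * (INR (S j) * PI / 3 ^ k / 3))).
  - replace (3 ^ k * (2 * (INR (S j) * PI / 3 ^ k / 3))) with (INR (S j) * (2 * PI / 3))
      by (field; lra). nra.
  - apply Rmult_le_compat_l; lra.
Qed.

Lemma inv_sq_le_majorant (j : nat) : / INR (S j) ^ 2 <= 8 * majorant (INR j).
Proof.
  assert (H := pos_INR j).
  assert (H1 := majorant_sq (INR j) (INR j) ltac:(lra)).
  rewrite S_INR.
  apply Rle_trans with (4 * / (INR j + 2) ^ 2); [| lra].
  replace (4 * / (INR j + 2) ^ 2) with (/ ((INR j + 2) ^ 2 / 4)) by (field; lra).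
  apply Rinv_le_contravar; simpl; nra.
Qed.

Lemma Cmod_sq_quot_le (x y : C) (B r : R) :
  0 < r -> r <= Cmod y -> Cmod x <= B ->
  Cmod (1 - (x / y) * (x / y) - 1) <= B ^ 2 * / r ^ 2.
Proof.
  intros Hr Hy Hx.
  replace (1 - (x / y) * (x / y) - 1)%C with (- ((x / y) * (x / y)))%C by ring.
  assert (Hy0 : y <> 0%C) by (apply Cmod_gt_0; lra).
  rewrite Cmod_opp, Cmod_mult, Cmod_div by assumption.
  assert (H0 := Cmod_ge_0 x).
  assert (H : Cmod x / Cmod y <= B * / r).
  { apply Rmult_le_compat; try lra.
    - left. apply Rinv_0_lt_compat. lra.
    - now apply Rinv_le_contravar. }
  assert (H1 : 0 <= Cmod x / Cmod y) by (apply Rdiv_le_0_compat; lra).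
  replace (B ^ 2 * / r ^ 2) with ((B * / r) * (B * / r)) by (field; lra).
  now apply Rmult_le_compat.
Qed.

Definition sine_product (M : nat) (u : C) : C :=
  (u * Cprod (seq 0 M) (fun j => 1 - (u / pi_multiple j) * (u / pi_multiple j)))%C.

Lemma exhausts_seq : exhausts (fun M => seq 0 M).
Proof.
  split; [intros M; apply seq_NoDup |]. intros j. exists (S j). intros M HM. apply in_seq. lia.
Qed.

Definition sine_majorant (u : C) (j : nat) : R := 8 * dsin_bound u ^ 2 * majorant (INR j).

Lemma sine_majorant_nonneg (u : C) (j : nat) : 0 <= sine_majorant u j.
Proof.
  apply Rmult_le_pos; [| apply majorant_nonneg, pos_INR].
  assert (H := pow2_ge_0 (dsin_bound u)). lra.
Qed.

Lemma summable_sine_majorant (u : C) : summable (sine_majorant u).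
Proof.
  apply summable_le with (fun j => majorant (INR j)) (8 * dsin_bound u ^ 2).
  - assert (H := pow2_ge_0 (dsin_bound u)). lra.
  - apply summable_majorant_nat.
  - intros j. apply Rle_refl.
Qed.

Lemma sine_majorant_spec (u x y : C) (j : nat) :
  INR (S j) <= Cmod y -> Cmod x <= dsin_bound u ->
  Cmod (1 - (x / y) * (x / y) - 1) <= sine_majorant u j.
Proof.
  intros Hy Hx.
  eapply Rle_trans; [apply Cmod_sq_quot_le with (r := INR (S j)); try eassumption |].
  - apply lt_0_INR. lia.
  - unfold sine_majorant. assert (H := inv_sq_le_majorant j).
    assert (H1 := pow2_ge_0 (dsin_bound u)). nra.
Qed.

Lemma sine_factor_le (u : C) (j : nat) :
  Cmod (1 - (u / pi_multiple j) * (u / pi_multiple j) - 1) <= sine_majorant u j.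
Proof.
  apply sine_majorant_spec; [apply Cmod_pi_multiple |].
  unfold dsin_bound. assert (H := Cmod_ge_0 u).
  assert (H2 : 0 <= Cmod u ^ 2 * exp (Cmod u))
    by (apply Rmult_le_pos; [apply pow2_ge_0 | left; apply exp_pos]). lra.
Qed.

(** The level-k counterpart of 1 - (u / (j pi))^2, both entries of the quotient being scaled so that
    they converge as k grows. *)
Definition sine_factor (k : nat) (u : C) (j : nat) : C :=
  let q := (RtoC (3 ^ k) * dsin (u / RtoC (3 ^ k))
            / (RtoC (3 ^ k) * dsin (pi_multiple j / RtoC (3 ^ k))))%C in
  (1 - q * q)%C.

Definition sine_approx (k : nat) (u : C) : C :=
  (RtoC (3 ^ k) * dsin (u / RtoC (3 ^ k)) * Cprod (seq 0 (half_pow3 k)) (sine_factor k u))%C.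

(** Pairing j with -j, [dsin_plus_minus] turns each pair into a constant times 1 - q^2. The constant
    depends on [k] but not on [u], so it cancels when two arguments are compared. *)
Lemma dsin_sine_approx (k : nat) : exists c, forall u, dsin u = (c * sine_approx k u)%C.
Proof.
  set (K := RtoC (3 ^ k)).
  assert (HK : K <> 0%C) by (apply RtoC_neq_0; assert (H := pow3_gt_0 k); lra).
  exists (/ K * Cprod (seq 0 (half_pow3 k))
            (fun j => - (dsin (pi_multiple j / K) * dsin (pi_multiple j / K))))%C.
  intros u. rewrite (dsin_prod k u), Cprod_Zball_seq. fold K. unfold sine_approx. fold K.
  replace ((u + RtoC (IZR 0) * PI) / K)%C with (u / K)%C by (field; assumption).
  match goal with |- (?d * ?P)%C = (/ ?k * ?Q * (?k' * ?d' * ?W))%C =>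
    transitivity (d * (Q * W))%C; [f_equal | field; assumption] end.
  rewrite <- Cprod_mult. apply Cprod_ext. intros j Hj. apply in_seq in Hj.
  assert (Hlow := dsin_scaled_lower k j ltac:(lia)). fold K in Hlow.
  assert (Hd : dsin (pi_multiple j / K) <> 0%C).
  { intros E. rewrite E in Hlow. replace (K * 0)%C with (RtoC 0) in Hlow by ring.
    rewrite Cmod_0 in Hlow. assert (0 < INR (S j)) by (apply lt_0_INR; lia). lra. }
  replace ((u + RtoC (IZR (Z.of_nat (S j))) * PI) / K)%C with (u / K + pi_multiple j / K)%C
    by (unfold pi_multiple; rewrite <- INR_IZR_INZ; field; assumption).
  replace ((u + RtoC (IZR (- Z.of_nat (S j))) * PI) / K)%C with (u / K - pi_multiple j / K)%C
    by (unfold pi_multiple; rewrite opp_IZR, <- INR_IZR_INZ, RtoC_opp; field; assumption).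
  rewrite dsin_plus_minus. unfold sine_factor. fold K. field. now split.
Qed.

Lemma exhausts_half_pow3 : exhausts (fun k => seq 0 (half_pow3 k)).
Proof.
  split; [intros k; apply seq_NoDup |]. intros j. exists (S j). intros k Hk. apply in_seq.
  assert (H : forall k, (k <= half_pow3 k)%nat) by (induction k0; simpl; lia).
  specialize (H k). lia.
Qed.

(** Euler's product up to a factor. As the factor is nonzero and independent of [u], it cancels in
    quotients of rows and survives only once, in row 0. *)
Lemma sine_product_tendsto : exists c : C, c <> RtoC 0 /\
  forall u, tendsto eventually (fun M => sine_product M u) (c * dsin u).
Proof.
  assert (HP : forall u, exists p, tendsto finite_lists
    (fun t => Cprod t (fun j => 1 - (u / pi_multiple j) * (u / pi_multiple j)))%C p).
  { intros u. apply Cprod_tendsto with (s := fun M => seq 0 M) (h := sine_majorant u).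
    - apply exhausts_seq.
    - apply sine_majorant_nonneg.
    - apply summable_sine_majorant.
    - apply sine_factor_le. }
  assert (Happrox : forall u p, tendsto finite_lists
    (fun t => Cprod t (fun j => 1 - (u / pi_multiple j) * (u / pi_multiple j)))%C p ->
    tendsto eventually (fun k => sine_approx k u) (2 * Ci * u * p)).
  { intros u p Hp. unfold sine_approx. apply tendsto_mult; [apply eventually_filter | |].
    - apply dsin_scaled_tendsto.
    - assert (H1 := tendsto_comp _ _ _ _ _ (exhausts_filterlim _ exhausts_half_pow3) Hp).
      replace p with (0 + p)%C by ring.
      apply tendsto_ext with (fun k => (Cprod (seq 0 (half_pow3 k)) (sine_factor k u)
          - Cprod (seq 0 (half_pow3 k)) (fun j => 1 - (u / pi_multiple j) * (u / pi_multiple j)))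
          + Cprod (seq 0 (half_pow3 k)) (fun j => 1 - (u / pi_multiple j) * (u / pi_multiple j)))%C;
        [apply eventually_filter | apply filter_forall; intros k; ring |].
      apply tendsto_plus; [apply eventually_filter | | exact H1].
      apply Cprod_dominated with (h := sine_majorant u).
      + apply sine_majorant_nonneg.
      + apply summable_sine_majorant.
      + intros k. apply seq_NoDup.
      + apply filter_forall. intros k j Hj. apply in_seq in Hj.
        apply sine_majorant_spec; [apply dsin_scaled_lower; lia |].
        apply dsin_scaled_bound, pow3_ge_1.
      + apply sine_factor_le.
      + intros j.
        assert (Hd : (2 * Ci * pi_multiple j)%C <> 0%C).
        { apply Cmod_gt_0. rewrite Cmod_2Ci. apply Rmult_lt_0_compat; [lra |].
          apply Cmod_gt_0, pi_multiple_neq_0. }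
        assert (Hq : tendsto eventually (fun k => RtoC (3 ^ k) * dsin (u / RtoC (3 ^ k))
             / (RtoC (3 ^ k) * dsin (pi_multiple j / RtoC (3 ^ k))))%C (u / pi_multiple j)).
        { replace (u / pi_multiple j)%C with (2 * Ci * u * / (2 * Ci * pi_multiple j))%C.
          - apply tendsto_mult; [apply eventually_filter | apply dsin_scaled_tendsto |].
            apply tendsto_inv; [apply eventually_filter | exact Hd | apply dsin_scaled_tendsto].
          - field. repeat split; try apply pi_multiple_neq_0; try (apply RtoC_neq_0; lra).
            intros E. apply (f_equal snd) in E. simpl in E. lra. }
        apply tendsto_minus; [apply eventually_filter | |].
        * apply tendsto_const, eventually_filter.
        * now apply tendsto_mult; [apply eventually_filter | |]. }
  (* Cross-multiplying eliminates the constant of [dsin_sine_approx], whose behaviour in [k] is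
     never examined. *)
  assert (Hprop : forall u v p q,
    tendsto finite_lists
      (fun t => Cprod t (fun j => 1 - (u / pi_multiple j) * (u / pi_multiple j)))%C p ->
    tendsto finite_lists
      (fun t => Cprod t (fun j => 1 - (v / pi_multiple j) * (v / pi_multiple j)))%C q ->
    (dsin u * (v * q))%C = (dsin v * (u * p))%C).
  { intros u v p q Hp Hq.
    assert (E : (dsin u * (2 * Ci * v * q))%C = (dsin v * (2 * Ci * u * p))%C).
    { apply (tendsto_unique eventually) with (fun k => dsin u * sine_approx k v)%C.
      - apply tendsto_scal; [apply eventually_filter | now apply Happrox].
      - apply tendsto_ext with (fun k => dsin v * sine_approx k u)%C; [apply eventually_filter | |].
        + apply filter_forall. intros k. destruct (dsin_sine_approx k) as [c Hc].
          rewrite (Hc u), (Hc v). ring.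
        + apply tendsto_scal; [apply eventually_filter | now apply Happrox]. }
    replace (dsin u * (v * q))%C with (/ (2 * Ci) * (dsin u * (2 * Ci * v * q)))%C
      by (field; repeat split; try (apply RtoC_neq_0; lra);
          intros E'; apply (f_equal snd) in E'; simpl in E'; lra).
    rewrite E. field. repeat split; try (apply RtoC_neq_0; lra).
    intros E'. apply (f_equal snd) in E'. simpl in E'. lra. }
  (* The normalisation is taken at i: there the factors are 1 + 1/x^2 with x real, so the product is
     nonzero, and [dsin] does not vanish. *)
  destruct (HP Ci) as [p0 Hp0].
  assert (Hi2 : (Ci * Ci)%C = (- (1))%C).
  { unfold Ci, Cmult, RtoC, Copp. simpl. f_equal; ring. }
  assert (Hp0n : p0 <> 0%C).
  { apply Cprod_limit_neq_0 with (3 := sine_factor_le Ci) (5 := Hp0).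
    - apply sine_majorant_nonneg.
    - apply summable_sine_majorant.
    - intros j. assert (Hj := pi_multiple_neq_0 j).
      replace (Ci / pi_multiple j * (Ci / pi_multiple j))%C
        with (Ci * Ci / (pi_multiple j * pi_multiple j))%C by (now field).
      rewrite Hi2. unfold pi_multiple in *. rewrite <- RtoC_mult in *.
      set (x := INR (S j) * PI) in *.
      assert (Hx : 0 < x).
      { unfold x. apply Rmult_lt_0_compat; [apply lt_0_INR; lia | apply PI_RGT_0]. }
      replace (1 - - (1) / (RtoC x * RtoC x))%C with (RtoC (1 + / (x * x))).
      + apply RtoC_neq_0. assert (0 < / (x * x)) by (apply Rinv_0_lt_compat; nra). lra.
      + rewrite RtoC_plus, RtoC_inv, RtoC_mult by nra. field. now apply RtoC_neq_0, Rgt_not_eq. }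
  assert (Hdi : dsin Ci <> 0%C).
  { unfold dsin. rewrite Hi2. replace (- - (1))%C with (RtoC 1) by ring.
    replace (- (1))%C with (RtoC (- (1))) by (now rewrite RtoC_opp).
    rewrite !Cexp_RtoC, <- RtoC_minus. apply RtoC_neq_0.
    assert (exp (- (1)) < exp 1) by (apply exp_increasing; lra). lra. }
  exists (Ci * p0 / dsin Ci)%C. split.
  - apply Cmult_neq_0; [apply Cmult_neq_0; [| exact Hp0n] |].
    + intros E. apply (f_equal snd) in E. simpl in E. lra.
    + intros E. apply C1_neq_0. rewrite <- (Cinv_r _ Hdi), E. ring.
  - intros u. destruct (HP u) as [p Hp].
    replace (Ci * p0 / dsin Ci * dsin u)%C with (u * p)%C.
    + apply tendsto_scal; [apply eventually_filter |].
      exact (tendsto_comp _ _ _ _ _ (exhausts_filterlim _ exhausts_seq) Hp).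
    + assert (E := Hprop u Ci p p0 Hp Hp0).
      replace (Ci * p0 / dsin Ci * dsin u)%C with (dsin u * (Ci * p0) / dsin Ci)%C
        by (now field).
      rewrite E. now field.
Qed.

(** * The triple product *)

(** Write exp(a m) as a square: exp(a m / 2) >= 1 + a m / 2 >= d (m + 2), with d the minimum of 1/2
    and a/2, and then compare (m + 2)^(-2) with the majorant. *)
Lemma exp_le_majorant (a : R) : 0 < a ->
  exists c, 0 <= c /\ forall m, 0 <= m -> exp (- (a * m)) <= c * majorant m.
Proof.
  intros Ha. set (d := Rmin (/ 2) (a / 2)).
  assert (Hd : 0 < d) by (apply Rmin_glb_lt; lra).
  assert (Hd1 : d <= / 2) by apply Rmin_l. assert (Hd2 : d <= a / 2) by apply Rmin_r.
  exists (2 * / d ^ 2). assert (Hd3 : 0 < / d ^ 2) by (apply Rinv_0_lt_compat, pow_lt; lra).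
  split; [lra |]. intros m Hm.
  assert (H1 := majorant_sq m m ltac:(lra)).
  apply Rle_trans with (/ d ^ 2 * / (m + 2) ^ 2); [| nra].
  rewrite exp_Ropp, <- Rinv_mult.
  assert (H2 := exp_ineq1_le (a * m / 2)).
  assert (H3 : d * (m + 2) <= 1 + a * m / 2) by nra.
  assert (H4 : exp (a * m) = exp (a * m / 2) * exp (a * m / 2))
    by (rewrite <- exp_plus; f_equal; field).
  apply Rinv_le_contravar.
  - apply Rmult_lt_0_compat; apply pow_lt; lra.
  - rewrite H4. replace (d ^ 2 * (m + 2) ^ 2) with ((d * (m + 2)) * (d * (m + 2))) by ring.
    assert (0 <= d * (m + 2)) by nra. apply Rmult_le_compat; lra.
Qed.

(** * The finite q-binomial theorem *)

Fixpoint qbinom (Q : R) (M j : nat) : R :=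
  match M, j with
  | _, O => 1
  | O, S _ => 0
  | S M, S j => qbinom Q M (S j) + Q ^ (M - j) * qbinom Q M j
  end.

(** The q-Pochhammer symbol (Q; Q)_n, that is, the q-factorial without division by (1 - Q)^n; it has
    a nonzero limit. *)
Fixpoint qfact (Q : R) (n : nat) : R :=
  match n with O => 1 | S m => qfact Q m * (1 - Q ^ S m) end.

Lemma qbinom_0_r (Q : R) (M : nat) : qbinom Q M 0 = 1.
Proof. now destruct M. Qed.

(** Makes the truncated [M - j] in the recursion harmless: for j > M the power is multiplied by
    0. *)
Lemma qbinom_gt (Q : R) (M j : nat) : (M < j)%nat -> qbinom Q M j = 0.
Proof.
  revert j. induction M as [| M IH]; intros [| j] H; try lia; [reflexivity |].
  simpl. rewrite !IH by lia. ring.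
Qed.

(** The Pascal step amounts to (1 - Q^(M-j)) + Q^(M-j) (1 - Q^(j+1)) = 1 - Q^(M+1); j = M is
    separate because the first coefficient then vanishes. *)
Lemma qbinom_qfact (Q : R) (M j : nat) :
  (j <= M)%nat -> qbinom Q M j * (qfact Q j * qfact Q (M - j)) = qfact Q M.
Proof.
  revert j. induction M as [| M IH]; intros [| j] H; try lia.
  - simpl. ring.
  - simpl. ring.
  - change (qbinom Q (S M) (S j)) with (qbinom Q M (S j) + Q ^ (M - j) * qbinom Q M j).
    change (qfact Q (S j)) with (qfact Q j * (1 - Q ^ S j)).
    change (qfact Q (S M)) with (qfact Q M * (1 - Q ^ S M)).
    replace (S M - S j)%nat with (M - j)%nat by lia.
    assert (E1 := IH j ltac:(lia)).
    assert (EQ : Q ^ (M - j) * Q ^ S j = Q ^ S M) by (rewrite <- pow_add; f_equal; lia).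
    destruct (Nat.eq_dec j M) as [-> | Hj].
    + rewrite (qbinom_gt Q M (S M)) by lia.
      replace (M - M)%nat with 0%nat in * by lia.
      transitivity (qbinom Q M M * (qfact Q M * qfact Q 0) * (1 - Q ^ S M)); [| now rewrite E1].
      simpl (Q ^ 0). ring.
    + assert (E2 := IH (S j) ltac:(lia)).
      change (qfact Q (S j)) with (qfact Q j * (1 - Q ^ S j)) in E2.
      replace (M - j)%nat with (S (M - S j)) in * by lia.
      change (qfact Q (S (M - S j))) with (qfact Q (M - S j) * (1 - Q ^ S (M - S j))) in *.
      rewrite <- EQ.
      transitivity ((qbinom Q M (S j) * (qfact Q j * (1 - Q ^ S j) * qfact Q (M - S j)))
                      * (1 - Q ^ S (M - S j))
        + (qbinom Q M j * (qfact Q j * (qfact Q (M - S j) * (1 - Q ^ S (M - S j)))))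
          * (Q ^ S (M - S j) * (1 - Q ^ S j))); [ring |].
      rewrite E1, E2. ring.
Qed.

Lemma Csum_seq_S (M : nat) (u : nat -> C) :
  Csum (seq 0 (S M)) u = (Csum (seq 0 M) u + u M)%C.
Proof. rewrite seq_S, Csum_app. simpl. ring. Qed.

Lemma Csum_seq_shift (M : nat) (u : nat -> C) :
  Csum (seq 0 (S M)) u = (u 0%nat + Csum (seq 0 M) (fun j => u (S j)))%C.
Proof. simpl. rewrite <- seq_shift, Csum_map. reflexivity. Qed.

(* [t j] stands for Q^(j(j-1)/2) y^j. *)
Lemma qbinom_theorem (Q : R) (y : C) (t : nat -> C) (M : nat) :
  t 0%nat = 1%C -> (forall j, t (S j) = t j * (RtoC (Q ^ j) * y))%C ->
  Cprod (seq 0 M) (fun i => 1 + RtoC (Q ^ i) * y)%C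
  = Csum (seq 0 (S M)) (fun j => RtoC (qbinom Q M j) * t j)%C.
Proof.
  intros H0 HS. induction M as [| M IH].
  - simpl. rewrite H0. ring.
  - rewrite Cprod_seq_S, IH, (Csum_seq_shift (S M)), qbinom_0_r, H0.
    (* Multiply the induction hypothesis by 1 + Q^M y. Coefficients of t(j+1) then agree by the
       recursion, since Q^M = Q^(M-j) Q^j. *)
    transitivity (Csum (seq 0 (S (S M))) (fun j => RtoC (qbinom Q M j) * t j)%C
       + RtoC (Q ^ M) * y * Csum (seq 0 (S M)) (fun j => RtoC (qbinom Q M j) * t j)%C)%C.
    + rewrite (Csum_seq_S (S M)), (qbinom_gt Q M (S M)) by lia. ring.
    + rewrite (Csum_seq_shift (S M)), qbinom_0_r, H0, <- Csum_scal, <- Cplus_assoc, <- Csum_plus.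
      f_equal. apply Csum_ext. intros j Hj. apply in_seq in Hj.
      change (qbinom Q (S M) (S j)) with (qbinom Q M (S j) + Q ^ (M - j) * qbinom Q M j).
      rewrite HS, RtoC_plus, RtoC_mult.
      replace (Q ^ M) with (Q ^ (M - j) * Q ^ j) by (rewrite <- pow_add; f_equal; lia).
      rewrite RtoC_mult. ring.
Qed.

Lemma qfact_pos (Q : R) (n : nat) : 0 < Q < 1 -> 0 < qfact Q n <= 1.
Proof.
  intros H. induction n as [| n IH]; simpl; [lra |].
  assert (H1 : 0 < Q * Q ^ n) by (apply (pow_lt Q (S n)); lra).
  assert (H2 : Q * Q ^ n < 1) by (apply (pow_lt_1_compat Q (S n)); [lra | lia]).
  nra.
Qed.

(** * The theta series and its product *)

Section Theta.

Variable L : R.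
Hypothesis L_pos : 0 < L.

(** In terms of the nome q = exp(-L) of the theta series, this is q^2. *)
Let Q : R := exp (- (2 * L)).

Lemma nome_bounds : 0 < Q < 1.
Proof.
  unfold Q. split; [apply exp_pos |]. rewrite <- exp_0. apply exp_increasing. lra.
Qed.

Lemma nome_pow (n : nat) : Q ^ n = exp (- (2 * L * INR n)).
Proof.
  induction n as [| n IH].
  - simpl. rewrite Rmult_0_r, Ropp_0, exp_0. reflexivity.
  - rewrite S_INR. simpl. rewrite IH. unfold Q. rewrite <- exp_plus. f_equal. ring.
Qed.

Lemma qfact_tendsto : exists l : C, l <> RtoC 0 /\
  tendsto eventually (fun n => RtoC (qfact Q n)) l /\ forall n, Cmod l <= qfact Q n.
Proof.
  destruct (exp_le_majorant (2 * L) ltac:(lra)) as (c & Hc & Hm).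
  assert (Hu : forall i : nat, Cmod (RtoC (1 - Q ^ S i) - 1) <= c * majorant (INR i)).
  { intros i. replace (RtoC (1 - Q ^ S i) - 1)%C with (RtoC (- Q ^ S i))
      by (rewrite RtoC_minus, RtoC_opp; ring).
    assert (HQ := nome_bounds).
    rewrite Cmod_R, Rabs_Ropp, Rabs_right by (apply Rle_ge, pow_le; lra).
    assert (H1 := Hm (INR i) (pos_INR i)). rewrite <- nome_pow in H1.
    assert (0 < Q ^ i) by (apply pow_lt; lra). simpl. nra. }
  assert (Hh : forall i : nat, 0 <= c * majorant (INR i))
    by (intros i; apply Rmult_le_pos; [exact Hc | apply majorant_nonneg, pos_INR]).
  assert (Hsum : summable (fun i : nat => c * majorant (INR i))).
  { apply summable_le with (fun i : nat => majorant (INR i)) c;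
      [exact Hc | apply summable_majorant_nat | intros; lra]. }
  destruct (Cprod_tendsto (fun M => seq 0 M) (fun i => RtoC (1 - Q ^ S i)) _
    exhausts_seq Hh Hsum Hu) as [l Hl].
  assert (Hl' : tendsto eventually (fun n => RtoC (qfact Q n)) l).
  { apply tendsto_ext with (fun n => Cprod (seq 0 n) (fun i => RtoC (1 - Q ^ S i))).
    - apply eventually_filter.
    - apply filter_forall. intros n. induction n as [| n IH]; [reflexivity |].
      rewrite Cprod_seq_S, IH, <- RtoC_mult. reflexivity.
    - exact (tendsto_comp _ _ _ _ _ (exhausts_filterlim _ exhausts_seq) Hl). }
  exists l. repeat split.
  - apply Cprod_limit_neq_0 with (3 := Hu) (5 := Hl); [exact Hh | exact Hsum |].
    intros i. apply RtoC_neq_0. assert (HQ := nome_bounds).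
    assert (Q ^ S i < 1) by (apply pow_lt_1_compat; [lra | lia]). lra.
  - exact Hl'.
  (* The sequence decreases, so a value below the modulus of the limit would keep all later values
     below it. The bound serves as a uniform lower bound for denominators. *)
  - intros n. apply Rnot_lt_le. intros Hn.
    destruct (filter_and2 (Hl' (Cmod l - qfact Q n) ltac:(lra))
      (ex_intro _ n (fun m (H : (n <= m)%nat) => H)) _) as [N HN].
    destruct (HN N (Nat.le_refl N)) as [H1 H2].
    assert (Hdec : qfact Q N <= qfact Q n).
    { clear -H2 L_pos. induction H2 as [| m H IH]; [lra |].
      change (qfact Q (S m)) with (qfact Q m * (1 - Q ^ S m)).
      assert (H1 := qfact_pos Q m nome_bounds). assert (HQ := nome_bounds).
      assert (0 < Q ^ S m) by (apply pow_lt; lra). nra. }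
    rewrite Cmod_minus_sym in H1.
    assert (H3 := Cmod_triangle_inv l (RtoC (qfact Q N))).
    assert (H4 := qfact_pos Q N nome_bounds).
    rewrite (Cmod_R (qfact Q N)), Rabs_right in H3 by lra. lra.
Qed.

(** The series is i times Jacobi's theta_1. The sign (-1)^k is written exp(i pi k), so that
    identities between terms become ring identities between exponents. *)
Definition theta_term (x : C) (k : Z) : C :=
  Cexp (Ci * PI * RtoC (IZR k) - RtoC L * ((RtoC (IZR k) + / 2) * (RtoC (IZR k) + / 2))
        + Ci * (2 * RtoC (IZR k) + 1) * x).

(** From -N-1 to N, symmetric under k -> -1-k: one index for each of the 2N + 2 terms of the
    q-binomial sum for 2N + 1 factors. *)
Definition theta_range (N : nat) : list Z :=
  map (fun j => (Z.of_nat j - Z.of_nat N - 1)%Z) (seq 0 (2 * N + 2)).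

Lemma exhausts_theta_range : exhausts theta_range.
Proof.
  split.
  - intros N. unfold theta_range.
    apply FinFun.Injective_map_NoDup; [intros x y H; lia | apply seq_NoDup].
  - intros k. exists (S (Z.abs_nat k)). intros N HN. unfold theta_range. apply in_map_iff.
    exists (Z.to_nat (k + Z.of_nat N + 1)). split; [lia |]. apply in_seq. lia.
Qed.

Lemma theta_term_le (x : C) : exists c, 0 <= c /\
  forall k, Cmod (theta_term x k) <= c * majorantZ k.
Proof.
  destruct (exp_le_majorant 1 ltac:(lra)) as (c & Hc & Hm).
  (* With s = k + 1/2, completing the square bounds -L s^2 + (1 + 2|b|)|s|; the added 1 absorbs the
     gap of 1/2 between |s| and |k|, leaving exp(-|k|). *)
  set (b := Im x). set (K := (1 + 2 * Rabs b) ^ 2 / (4 * L) + 1).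
  exists (exp K * c). split; [apply Rmult_le_pos; [left; apply exp_pos | exact Hc] |].
  intros k. unfold theta_term. rewrite Cmod_Cexp.
  match goal with |- exp ?e <= _ => set (E := e) end.
  assert (HE : E = - L * (IZR k + / 2) ^ 2 - 2 * (IZR k + / 2) * b).
  { unfold E, b. destruct x as [x1 x2]. simpl. field. }
  assert (HK : E <= K - 1 * Rabs (IZR k)).
  { rewrite HE. unfold K. set (s := IZR k + / 2).
    assert (Hs : Rabs (IZR k) <= Rabs s + / 2).
    { unfold s. replace (IZR k) with ((IZR k + / 2) + - / 2) at 1 by ring.
      eapply Rle_trans; [apply Rabs_triang |]. rewrite Rabs_Ropp, (Rabs_right (/ 2)) by lra. lra. }
    assert (Hb : - (2 * s * b) <= 2 * Rabs s * Rabs b).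
    { assert (H := Rle_abs (- (s * b))). rewrite Rabs_Ropp, Rabs_mult in H. lra. }
    assert (Hsq : s ^ 2 = Rabs s ^ 2) by (now rewrite <- pow2_abs).
    assert (Hq : - L * s ^ 2 + (1 + 2 * Rabs b) * Rabs s <= (1 + 2 * Rabs b) ^ 2 / (4 * L)).
    { rewrite Hsq. set (r := Rabs s). set (d := 1 + 2 * Rabs b).
      assert (Hz : 0 <= L * (r - d / (2 * L)) ^ 2)
        by (apply Rmult_le_pos; [lra | apply pow2_ge_0]).
      replace (d ^ 2 / (4 * L)) with (- L * r ^ 2 + d * r + L * (r - d / (2 * L)) ^ 2)
        by (field; lra). lra. }
    lra. }
  apply Rle_trans with (exp K * exp (- (1 * Rabs (IZR k)))).
  - rewrite <- exp_plus. replace (K + - (1 * Rabs (IZR k))) with (K - 1 * Rabs (IZR k)) by ring.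
    destruct HK as [HK | HK]; [left; now apply exp_increasing | right; now f_equal].
  - rewrite Rmult_assoc. apply Rmult_le_compat_l; [left; apply exp_pos |].
    apply Hm, Rabs_pos.
Qed.

Definition is_theta (x l : C) : Prop :=
  tendsto finite_lists (fun s => Csum s (theta_term x)) l.

Lemma theta_exists (x : C) : exists l, is_theta x l.
Proof.
  destruct (theta_term_le x) as (c & Hc & Hle).
  apply Csum_tendsto with (s := Zball) (h := fun k => c * majorantZ k).
  - apply exhausts_Zball.
  - intros k. apply Rmult_le_pos; [exact Hc | apply majorantZ_nonneg].
  - apply summable_le with majorantZ c; [exact Hc | apply summable_majorantZ | intros; lra].
  - exact Hle.
Qed.

(** Each factor is -exp(L n - i x) (1 - exp(2 i x - 2 L n)). With j = n + N the bracket is 1 + Q^j y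
    for a [y] free of j, so the q-binomial theorem applies, and k = j - N - 1 completes the square
    in the exponent. The sign exponent 3N + 2 adds 2N + 1 from the prefactors to N + 1 from the
    reindexing. *)
Lemma Cprod_dsin_Csum (x : C) (N : nat) :
  Cprod (Zball N) (fun n => dsin (x + Ci * RtoC (L * IZR n)))%C
  = (Cexp (RtoC (L * (INR N + / 2) ^ 2) + Ci * PI * RtoC (3 * INR N + 2))
     * Csum (theta_range N) (fun k => RtoC (qbinom Q (2 * N + 1) (Z.to_nat (k + Z.of_nat N + 1)))
                                      * theta_term x k))%C.
Proof.
  set (e := (2 * Ci * x + RtoC (2 * L * INR N))%C).
  set (y := (- Cexp e)%C).
  set (t := fun j => (Cexp (RtoC (- (L * (INR j * (INR j - 1)))) + RtoC (INR j) * (Ci * PI + e)))%C).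
  assert (Hq := qbinom_theorem Q y t (2 * N + 1)).
  assert (Ht0 : t 0%nat = 1%C).
  { unfold t. simpl INR.
    replace (RtoC (- (L * (0 * (0 - 1)))) + 0 * (Ci * PI + e))%C with (RtoC 0).
    - apply Cexp_0.
    - replace (- (L * (0 * (0 - 1)))) with 0 by ring. ring. }
  assert (HtS : forall j, t (S j) = (t j * (RtoC (Q ^ j) * y))%C).
  { intros j. unfold t, y. rewrite nome_pow, <- Cexp_RtoC.
    replace (- Cexp e)%C with (Cexp (Ci * PI) * Cexp e)%C by (rewrite Cexp_PI; ring).
    rewrite <- !Cexp_plus. f_equal. rewrite S_INR.
    rewrite !RtoC_opp, !RtoC_mult, !RtoC_minus, !RtoC_plus. ring. }
  specialize (Hq Ht0 HtS).
  unfold theta_range. rewrite Csum_map.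
  unfold Zball. rewrite Cprod_map.
  transitivity (Cprod (seq 0 (2 * N + 1))
      (fun i => Cexp (Ci * PI - Ci * x + RtoC (L * (INR i - INR N)))) *
      Cprod (seq 0 (2 * N + 1)) (fun i => 1 + RtoC (Q ^ i) * y))%C.
  - rewrite <- Cprod_mult. apply Cprod_ext. intros i _.
    unfold y. rewrite nome_pow, <- Cexp_RtoC.
    replace (1 + Cexp (RtoC (- (2 * L * INR i))) * - Cexp e)%C
      with (1 - Cexp (RtoC (- (2 * L * INR i)) + e))%C by (rewrite Cexp_plus; ring).
    set (v := (RtoC (L * (INR i - INR N)))).
    replace (Cexp (Ci * PI - Ci * x + v)) with (- Cexp (v - Ci * x))%C.
    2: { replace (Ci * PI - Ci * x + v)%C with (Ci * PI + (v - Ci * x))%C by ring.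
         rewrite Cexp_plus, Cexp_PI. ring. }
    replace (- Cexp (v - Ci * x) * (1 - Cexp (RtoC (- (2 * L * INR i)) + e)))%C
      with (Cexp (v - Ci * x + (RtoC (- (2 * L * INR i)) + e)) - Cexp (v - Ci * x))%C
      by (rewrite (Cexp_plus (v - Ci * x)); ring).
    unfold dsin. rewrite minus_IZR, <- !INR_IZR_INZ.
    fold v.
    assert (Hi : (Ci * (x + Ci * v) = Ci * x - v)%C).
    { replace (Ci * (x + Ci * v))%C with (Ci * x + (Ci * Ci) * v)%C by ring.
      replace (Ci * Ci)%C with (- (1))%C; [ring |].
      unfold Ci, Cmult, RtoC, Copp. simpl. f_equal; ring. }
    rewrite Hi. f_equal; [f_equal | f_equal; f_equal; ring].
    unfold v, e. rewrite !RtoC_opp, !RtoC_mult, !RtoC_minus. ring.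
  - rewrite Hq, Cexp_Csum. replace (S (2 * N + 1)) with (2 * N + 2)%nat by lia.
    rewrite <- !Csum_scal. apply Csum_ext. intros j _.
    replace (Z.to_nat (Z.of_nat j - Z.of_nat N - 1 + Z.of_nat N + 1)) with j by lia.
    (* Adds up the exponents of the prefactors; for M = 2N + 1 their real shifts cancel by symmetry
       about N. *)
    assert (HS : forall M (a : C), Csum (seq 0 M) (fun i => a + RtoC (L * (INR i - INR N)))%C
        = (RtoC (INR M) * a + RtoC (L * (INR M * (INR M - 1) / 2 - INR M * INR N)))%C).
    { clear. induction M as [| M IH]; intros a.
      - simpl. replace (L * (0 * (0 - 1) / 2 - 0 * INR N)) with 0 by field. ring.
      - rewrite Csum_seq_S, IH, S_INR.
        replace ((INR M + 1) * (INR M + 1 - 1) / 2 - (INR M + 1) * INR N)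
          with ((INR M * (INR M - 1) / 2 - INR M * INR N) + (INR M - INR N)) by field.
        rewrite Rmult_plus_distr_l, !RtoC_plus. ring. }
    rewrite HS. unfold t, theta_term, e.
    replace (INR (2 * N + 1)) with (2 * INR N + 1) by (rewrite plus_INR, mult_INR; simpl; ring).
    rewrite !minus_IZR, <- !INR_IZR_INZ.
    match goal with |- (Cexp ?a * (?g * Cexp ?b))%C = (Cexp ?c * (?g * Cexp ?d))%C =>
      transitivity (g * (Cexp a * Cexp b))%C; [ring |];
      transitivity (g * (Cexp c * Cexp d))%C; [| ring] end.
    rewrite <- !Cexp_plus. f_equal. f_equal.
    replace (L * ((2 * INR N + 1) * (2 * INR N + 1 - 1) / 2 - (2 * INR N + 1) * INR N)) with 0 by field.
    replace (/ 2)%C with (RtoC (/ 2)) by (rewrite RtoC_inv; [reflexivity | lra]).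
    replace (L * (INR N + / 2) ^ 2) with (L * ((INR N + / 2) * (INR N + / 2))) by ring.
    rewrite !RtoC_opp, !RtoC_mult, !RtoC_minus, !RtoC_plus, !RtoC_mult.
    replace (RtoC (/ 2)) with (/ 2)%C by (rewrite RtoC_inv; [reflexivity | lra]).
    field.
Qed.

Lemma Cexp_even_PI (N : nat) : Cexp (Ci * PI * RtoC (2 * INR N + 2)) = 1%C.
Proof.
  assert (H2 : Cexp (Ci * PI * 2) = 1%C).
  { replace (Ci * PI * 2)%C with (Ci * PI + Ci * PI)%C by ring.
    rewrite Cexp_plus, Cexp_PI. ring. }
  induction N as [| N IH].
  - simpl. now replace (2 * 0 + 2) with 2 by ring.
  - rewrite S_INR. replace (2 * (INR N + 1) + 2) with ((2 * INR N + 2) + 2) by ring.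
    rewrite RtoC_plus, Cmult_plus_distr_l, Cexp_plus, IH, H2. ring.
Qed.

Lemma dsin_imaginary (v : R) : dsin (Ci * RtoC v) = RtoC (exp (- v) - exp v).
Proof.
  unfold dsin. replace (Ci * (Ci * RtoC v))%C with (RtoC (- v)).
  - replace (- RtoC (- v))%C with (RtoC v) by (rewrite RtoC_opp; ring).
    now rewrite !Cexp_RtoC, <- RtoC_minus.
  - unfold Ci, Cmult, RtoC. simpl. f_equal; ring.
Qed.

Lemma dsin_imaginary_neq_0 (v : R) : v <> 0 -> dsin (Ci * RtoC v) <> 0%C.
Proof.
  intros Hv. rewrite dsin_imaginary. apply RtoC_neq_0. intros E.
  destruct (Rdichotomy _ _ Hv) as [H | H].
  - assert (exp v < exp (- v)) by (apply exp_increasing; lra). lra.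
  - assert (exp (- v) < exp v) by (apply exp_increasing; lra). lra.
Qed.

Lemma dsin_opp (u : C) : dsin (- u) = (- dsin u)%C.
Proof.
  unfold dsin. replace (Ci * - u)%C with (- (Ci * u))%C by ring.
  replace (- - (Ci * u))%C with (Ci * u)%C by ring. ring.
Qed.

(** Evaluates the denominators of [theta_product]: the pair at m and -m gives -(exp(L m) - exp(-L
    m))^2 = -exp(2 L m) (1 - Q^m)^2. *)
Lemma Cprod_dsin_imaginary (N : nat) :
  Cprod (seq 0 N) (fun j => dsin (Ci * RtoC (L * IZR (Z.of_nat (S j))))
                            * dsin (Ci * RtoC (L * IZR (- Z.of_nat (S j)))))%C
  = (Cexp (RtoC (L * (INR N * (INR N + 1))) + Ci * PI * RtoC (INR N))
     * RtoC (qfact Q N * qfact Q N))%C.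
Proof.
  induction N as [| N IH].
  - simpl. replace (L * (0 * (0 + 1))) with 0 by ring.
    replace (0 + Ci * PI * 0)%C with (RtoC 0) by ring. rewrite Cexp_0.
    replace (1 * 1) with 1 by ring. ring.
  - rewrite Cprod_seq_S, IH. clear IH.
    rewrite opp_IZR, <- INR_IZR_INZ.
    change (qfact Q (S N)) with (qfact Q N * (1 - Q ^ S N)). rewrite nome_pow.
    rewrite S_INR. set (n := INR N). set (v := L * (n + 1)).
    replace (L * - (n + 1)) with (- v) by (unfold v; ring).
    replace (L * ((n + 1) * (n + 1 + 1))) with (L * (n * (n + 1)) + (v + v)) by (unfold v; ring).
    replace (2 * L * (n + 1)) with (v + v) by (unfold v; ring).
    rewrite !dsin_imaginary, Ropp_involutive.
    replace (RtoC (L * (n * (n + 1)) + (v + v)) + Ci * PI * RtoC (n + 1))%C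
      with ((RtoC (L * (n * (n + 1))) + Ci * PI * RtoC n) + (RtoC (v + v) + Ci * PI))%C
      by (rewrite !RtoC_plus; ring).
    rewrite (Cexp_plus (RtoC (L * (n * (n + 1))) + Ci * PI * RtoC n)).
    rewrite (Cexp_plus (RtoC (v + v))), Cexp_PI, Cexp_RtoC.
    rewrite Ropp_plus_distr, !exp_plus.
    assert (Hv : exp v * exp (- v) = 1) by (rewrite <- exp_plus, Rplus_opp_r; apply exp_0).
    set (E := Cexp _).
    match goal with |- (?a * RtoC ?b * (RtoC ?c * RtoC ?d))%C = (?a * (RtoC ?e * _) * RtoC ?f)%C =>
      transitivity (a * RtoC (b * (c * d)))%C; [rewrite !RtoC_mult; ring |];
      transitivity (a * RtoC (- (e * f)))%C; [| rewrite RtoC_opp, RtoC_mult; ring] end.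
    f_equal. f_equal. set (x := exp v) in *. set (y := exp (- v)) in *.
    transitivity (- (qfact Q N * qfact Q N * ((x - y) * (x - y)))); [ring |].
    transitivity (- (qfact Q N * qfact Q N * ((x - (x * y) * y) * (x - (x * y) * y))));
      [rewrite Hv; ring | ring].
Qed.

(** Up to a constant, the rectangle product with its rows completed, for a lattice rescaled to
    spacing pi along each row and L between rows: row 0 gives a sine, any other row a quotient of
    sines. *)
Definition theta_product (N : nat) (x : C) : C :=
  Cprod (Zball N) (fun n =>
    if (n =? 0)%Z then dsin x
    else dsin (Ci * RtoC (L * IZR n) - x) / dsin (Ci * RtoC (L * IZR n)))%C.

Definition theta_weight (N : nat) (k : Z) : C :=
  (- RtoC (exp (L / 4) * (qbinom Q (2 * N + 1) (Z.to_nat (k + Z.of_nat N + 1)))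
             / (qfact Q N * qfact Q N)))%C.

Lemma theta_product_Csum (N : nat) (x : C) :
  theta_product N x
  = Csum (theta_range N) (fun k => theta_weight N k * theta_term (- x) k)%C.
Proof.
  assert (Hf := qfact_pos Q N nome_bounds).
  (* Clear the denominators. The sign comes from row 0, where the product on the right has
     dsin(-x). *)
  assert (E : (theta_product N x *
     Cprod (seq 0 N) (fun j => dsin (Ci * RtoC (L * IZR (Z.of_nat (S j))))
                            * dsin (Ci * RtoC (L * IZR (- Z.of_nat (S j)))))
     = - Cprod (Zball N) (fun n => dsin (- x + Ci * RtoC (L * IZR n))))%C).
  { unfold theta_product. rewrite !Cprod_Zball_seq.
    change (0 =? 0)%Z with true. cbv iota.
    replace (- x + Ci * RtoC (L * IZR 0))%C with (- x)%C
      by (rewrite Rmult_0_r; ring).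
    rewrite dsin_opp.
    match goal with |- (?a * ?P * ?R)%C = (- (- ?a * ?S))%C =>
      transitivity (a * (P * R))%C; [ring |]; transitivity (a * S)%C; [| ring] end.
    f_equal. rewrite <- Cprod_mult. apply Cprod_ext. intros j _.
    assert (Hj : 0 < INR (S j)) by (apply lt_0_INR; lia).
    replace (Z.of_nat (S j) =? 0)%Z with false by (symmetry; apply Z.eqb_neq; lia).
    replace (- Z.of_nat (S j) =? 0)%Z with false by (symmetry; apply Z.eqb_neq; lia).
    rewrite opp_IZR, <- INR_IZR_INZ.
    assert (H1 : dsin (Ci * RtoC (L * INR (S j))) <> 0%C) by (apply dsin_imaginary_neq_0; nra).
    assert (H2 : dsin (Ci * RtoC (L * - INR (S j))) <> 0%C) by (apply dsin_imaginary_neq_0; nra).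
    replace (- x + Ci * RtoC (L * INR (S j)))%C with (Ci * RtoC (L * INR (S j)) - x)%C by ring.
    replace (- x + Ci * RtoC (L * - INR (S j)))%C with (Ci * RtoC (L * - INR (S j)) - x)%C by ring.
    field. split; assumption. }
  rewrite Cprod_dsin_imaginary, Cprod_dsin_Csum in E.
  unfold theta_weight.
  set (g := fun k => (RtoC (qbinom Q (2 * N + 1) (Z.to_nat (k + Z.of_nat N + 1))) * theta_term (- x) k)%C).
  assert (Hff : RtoC (qfact Q N * qfact Q N) <> 0%C) by (apply RtoC_neq_0; nra).
  transitivity (- (RtoC (exp (L / 4)) / RtoC (qfact Q N * qfact Q N)) * Csum (theta_range N) g)%C.
  2: { rewrite <- Csum_scal. apply Csum_ext. intros k _. unfold g.
       rewrite RtoC_div by nra. rewrite (RtoC_mult (exp (L / 4))). now field. }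
  fold g in E.
  (* The exponents of numerator and denominator differ by L (N + 1/2)^2 - L N (N + 1) = L/4, and
     their signs by an even power. *)
  set (a := (RtoC (L * (INR N * (INR N + 1))) + Ci * PI * RtoC (INR N))%C) in *.
  replace (RtoC (L * (INR N + / 2) ^ 2) + Ci * PI * RtoC (3 * INR N + 2))%C
    with (a + (RtoC (L / 4) + Ci * PI * RtoC (2 * INR N + 2)))%C in E.
  2: { unfold a.
       replace (L * (INR N + / 2) ^ 2) with (L * (INR N * (INR N + 1)) + L / 4) by field.
       replace (3 * INR N + 2) with (INR N + (2 * INR N + 2)) by ring.
       rewrite !(RtoC_plus (L * _)), (RtoC_plus (INR N) (2 * INR N + 2)). ring. }
  rewrite !Cexp_plus, Cexp_even_PI, Cexp_RtoC in E.
  assert (Ha := Cexp_neq_0 a).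
  replace (theta_product N x)
    with (theta_product N x * (Cexp a * RtoC (qfact Q N * qfact Q N))
          / (Cexp a * RtoC (qfact Q N * qfact Q N)))%C by (field; split; assumption).
  rewrite E. field. split; assumption.
Qed.

Lemma tendsto_nat_comp (f : nat -> nat) (u : nat -> C) (l : C) :
  (forall m, eventually (fun N => (m <= f N)%nat)) ->
  tendsto eventually u l -> tendsto eventually (fun N => u (f N)) l.
Proof.
  intros Hf Hu eps Heps. destruct (Hu eps Heps) as [m Hm].
  generalize (Hf m). apply filter_imp. intros N HN. now apply Hm.
Qed.

Definition theta (x : C) : C := CLim_seq (fun N => Csum (Zball N) (theta_term x)).

Lemma theta_spec (x : C) : is_theta x (theta x).
Proof.
  destruct (theta_exists x) as [l Hl].
  replace (theta x) with l; [exact Hl |]. symmetry. apply CLim_seq_tendsto.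
  exact (tendsto_comp _ _ _ _ _ (exhausts_filterlim _ exhausts_Zball) Hl).
Qed.

Lemma theta_product_tendsto : exists c : C,
  forall x, tendsto eventually (fun N => theta_product N x) (c * theta (- x)).
Proof.
  destruct qfact_tendsto as (l & Hl0 & Hl & Hlow).
  assert (Hlp : 0 < Cmod l) by now apply Cmod_gt_0.
  assert (Hq : forall n, 0 < qfact Q n <= 1) by (intros n; apply qfact_pos, nome_bounds).
  assert (Hqb : forall M j, (j <= M)%nat ->
            qbinom Q M j = qfact Q M / (qfact Q j * qfact Q (M - j))).
  { intros M j Hj. assert (H1 := Hq j). assert (H2 := Hq (M - j)%nat).
    rewrite <- (qbinom_qfact Q M j Hj). field. lra. }
  (* The common limit of the weights: for fixed k all five q-factorials tend to [l], one in the
     numerator and four in the denominator. *)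
  set (c := (- (RtoC (exp (L / 4)) * (l * / (l * l) * / (l * l))))%C).
  exists c. intros x.
  destruct (theta_term_le (- x)) as (b & Hb & Hle).
  assert (H0 : tendsto eventually (fun N =>
     Csum (theta_range N) (fun k => theta_weight N k * theta_term (- x) k)
     - c * Csum (theta_range N) (theta_term (- x)))%C 0).
  { apply Csum_dominated with (h := fun k => b * majorantZ k)
      (W := exp (L / 4) * / (Cmod l * Cmod l * (Cmod l * Cmod l))).
    - intros k. apply Rmult_le_pos; [exact Hb | apply majorantZ_nonneg].
    - apply summable_le with majorantZ b; [exact Hb | apply summable_majorantZ | intros; lra].
    - apply exhausts_theta_range.
    - exact Hle.
    - intros N k Hk. unfold theta_range in Hk. apply in_map_iff in Hk as (j & <- & Hj).
      apply in_seq in Hj. unfold theta_weight.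
      replace (Z.to_nat (Z.of_nat j - Z.of_nat N - 1 + Z.of_nat N + 1)) with j by lia.
      rewrite Hqb by lia. rewrite Cmod_opp, Cmod_R.
      assert (H1 := Hq (2 * N + 1)%nat). assert (H2 := Hq j).
      assert (H3 := Hq (2 * N + 1 - j)%nat). assert (H4 := Hq N).
      assert (K2 := Hlow j). assert (K3 := Hlow (2 * N + 1 - j)%nat). assert (K4 := Hlow N).
      set (p := qfact Q (2 * N + 1)) in *. set (p2 := qfact Q j) in *.
      set (p3 := qfact Q (2 * N + 1 - j)) in *. set (p4 := qfact Q N) in *.
      assert (He := exp_pos (L / 4)).
      replace (exp (L / 4) * (p / (p2 * p3)) / (p4 * p4))
        with (exp (L / 4) * (p * / (p2 * p3 * (p4 * p4)))) by (field; lra).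
      assert (Hd : 0 < p2 * p3 * (p4 * p4)) by (repeat apply Rmult_lt_0_compat; lra).
      assert (Hd' := Rinv_0_lt_compat _ Hd).
      rewrite Rabs_right by (apply Rle_ge; repeat apply Rmult_le_pos; lra).
      apply Rmult_le_compat_l; [lra |].
      apply Rle_trans with (/ (p2 * p3 * (p4 * p4))); [nra |].
      apply Rinv_le_contravar; [repeat apply Rmult_lt_0_compat; lra |].
      apply Rmult_le_compat; try (apply Rmult_le_pos; lra); apply Rmult_le_compat; lra.
    - intros k. unfold theta_weight, c.
      apply tendsto_ext with (fun N => - (1) * (RtoC (exp (L / 4)) *
         (RtoC (qfact Q (2 * N + 1))
          * / (RtoC (qfact Q (Z.to_nat (k + Z.of_nat N + 1)))
               * RtoC (qfact Q (2 * N + 1 - Z.to_nat (k + Z.of_nat N + 1))))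
          * / (RtoC (qfact Q N) * RtoC (qfact Q N)))))%C.
      + apply eventually_filter.
      + exists (S (Z.abs_nat k)). intros N HN.
        assert (H1 := Hq (2 * N + 1)%nat). assert (H2 := Hq (Z.to_nat (k + Z.of_nat N + 1))).
        assert (H3 := Hq (2 * N + 1 - Z.to_nat (k + Z.of_nat N + 1))%nat). assert (H4 := Hq N).
        rewrite Hqb by lia.
        set (p2 := qfact Q (Z.to_nat (k + Z.of_nat N + 1))) in *.
        set (p3 := qfact Q (2 * N + 1 - Z.to_nat (k + Z.of_nat N + 1))) in *.
        rewrite !RtoC_div, !RtoC_mult by nra. rewrite RtoC_div, RtoC_mult by nra.
        field. repeat split; apply RtoC_neq_0; lra.
      + replace (- (RtoC (exp (L / 4)) * (l * / (l * l) * / (l * l))))%C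
          with (- (1) * (RtoC (exp (L / 4)) * (l * / (l * l) * / (l * l))))%C by ring.
        assert (EF : Filter eventually) by apply eventually_filter.
        assert (Hll : (l * l)%C <> 0%C) by now apply Cmult_neq_0.
        apply tendsto_scal; [exact EF |]. apply tendsto_scal; [exact EF |].
        apply tendsto_mult; [exact EF | apply tendsto_mult; [exact EF | |] |].
        * apply (tendsto_nat_comp (fun N => (2 * N + 1)%nat) (fun n => RtoC (qfact Q n))); [| exact Hl].
          intros m. exists m. intros N HN. lia.
        * apply tendsto_inv; [exact EF | exact Hll |]. apply tendsto_mult; [exact EF | |].
          -- apply (tendsto_nat_comp (fun N => Z.to_nat (k + Z.of_nat N + 1))
               (fun n => RtoC (qfact Q n))); [| exact Hl].
             intros m. exists (m + Z.abs_nat k)%nat. intros N HN. lia.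
          -- apply (tendsto_nat_comp (fun N => (2 * N + 1 - Z.to_nat (k + Z.of_nat N + 1))%nat)
               (fun n => RtoC (qfact Q n))); [| exact Hl].
             intros m. exists (m + Z.abs_nat k)%nat. intros N HN. lia.
        * apply tendsto_inv; [exact EF | exact Hll |]. now apply tendsto_mult. }
  assert (EF : Filter eventually) by apply eventually_filter.
  apply tendsto_ext with (fun N =>
     (Csum (theta_range N) (fun k => theta_weight N k * theta_term (- x) k)
     - c * Csum (theta_range N) (theta_term (- x)))
     + c * Csum (theta_range N) (theta_term (- x)))%C.
  - exact EF.
  - apply filter_forall. intros N. rewrite theta_product_Csum. ring.
  - replace (c * theta (- x))%C with (0 + c * theta (- x))%C by ring.
    apply tendsto_plus; [exact EF | exact H0 |]. apply tendsto_scal; [exact EF |].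
    exact (tendsto_comp _ _ _ _ _ (exhausts_filterlim _ exhausts_theta_range) (theta_spec (- x))).
Qed.

(** * The three-term relation for theta *)

Definition split_term (x : C) (r : Z) : C :=
  Cexp (- (RtoC (L / 2) * (RtoC (IZR r) * RtoC (IZR r))) + 2 * Ci * RtoC (IZR r) * x).

(** Partial sums of theta functions of argument 2x and squared nome: theta_3 here, theta_2 for odd
    indices. *)
Definition even_sum (N : nat) (x : C) : C :=
  Csum (Zball N) (fun r => if Z.even r then split_term x r else 0)%C.

Definition odd_sum (N : nat) (x : C) : C :=
  Csum (Zball N) (fun r => if Z.even r then 0 else split_term x r)%C.

(** The pairs (k, l) for which r = k + l + 1 and s = k - l fill a square; the parity condition makes
    both divisions exact. *)
Definition diagonal_range (N : nat) : list (Z * Z) :=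
  map (fun p => ((fst p + snd p - 1) / 2, (fst p - snd p - 1) / 2)%Z)
      (filter (fun p => Z.odd (fst p + snd p)) (list_prod (Zball N) (Zball N))).

Lemma exhausts_diagonal_range : exhausts diagonal_range.
Proof.
  split.
  - intros N. unfold diagonal_range. apply NoDup_map_NoDup_ForallPairs.
    + intros [r s] [r' s'] H H'. apply filter_In in H as [_ H]. apply filter_In in H' as [_ H'].
      simpl in *. apply Z.odd_spec in H as [a Ha]. apply Z.odd_spec in H' as [a' Ha'].
      intros E. apply pair_equal_spec in E as [E1 E2].
      assert (Z.odd (r - s) = true) by (apply Z.odd_spec; exists (a - s)%Z; lia).
      replace (r + s - 1)%Z with (a * 2)%Z in E1 by lia.
      replace (r' + s' - 1)%Z with (a' * 2)%Z in E1 by lia.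
      replace (r - s - 1)%Z with ((a - s) * 2)%Z in E2 by lia.
      replace (r' - s' - 1)%Z with ((a' - s') * 2)%Z in E2 by lia.
      rewrite !Z.div_mul in E1, E2 by lia. f_equal; lia.
    + apply NoDup_filter, NoDup_list_prod; apply NoDup_Zball.
  - intros [k l]. exists (Z.abs_nat k + Z.abs_nat l + 1)%nat. intros N HN.
    unfold diagonal_range. apply in_map_iff. exists (k + l + 1, k - l)%Z. simpl. split.
    + f_equal.
      * replace (k + l + 1 + (k - l) - 1)%Z with (k * 2)%Z by lia. now apply Z.div_mul.
      * replace (k + l + 1 - (k - l) - 1)%Z with (l * 2)%Z by lia. now apply Z.div_mul.
    + apply filter_In. split; [apply in_prod; apply In_Zball; lia |]. simpl.
      apply Z.odd_spec. exists k. lia.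
Qed.

Lemma Csum_filter {A : Type} (p : A -> bool) (s : list A) (u : A -> C) :
  Csum (filter p s) u = Csum s (fun a => if p a then u a else 0)%C.
Proof.
  induction s as [| a s IH]; simpl; [reflexivity |].
  destruct (p a); simpl; rewrite IH; ring.
Qed.

Lemma Cexp_PI_even (k : Z) : Cexp (Ci * PI * RtoC (IZR (2 * k))) = 1%C.
Proof.
  assert (H : forall n : nat, Cexp (Ci * PI * RtoC (IZR (2 * Z.of_nat n))) = 1%C).
  { intros n. destruct n as [| n].
    - simpl. replace (Ci * PI * 0)%C with (RtoC 0) by ring. apply Cexp_0.
    - replace (IZR (2 * Z.of_nat (S n))) with (2 * INR n + 2); [apply Cexp_even_PI |].
      rewrite mult_IZR, <- INR_IZR_INZ, S_INR. ring. }
  destruct (Z_le_gt_dec 0 k) as [Hk | Hk].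
  - replace k with (Z.of_nat (Z.to_nat k)) by lia. apply H.
  - assert (E := H (Z.to_nat (- k))). replace (2 * Z.of_nat (Z.to_nat (- k)))%Z with (- (2 * k))%Z in E by lia.
    rewrite opp_IZR, RtoC_opp in E.
    replace (Ci * PI * - RtoC (IZR (2 * k)))%C with (- (Ci * PI * RtoC (IZR (2 * k))))%C in E by ring.
    assert (E2 := Cexp_opp_r (Ci * PI * RtoC (IZR (2 * k)))). rewrite E in E2.
    rewrite <- E2. ring.
Qed.

(* With r = k + l + 1 and s = k - l, the quadratic exponents satisfy
   (k + 1/2)^2 + (l + 1/2)^2 = (r^2 + s^2)/2, and r, s have opposite parities. *)
Lemma theta_term_mult (x y : C) (r s : Z) : Z.odd (r + s) = true ->
  (theta_term (x + y) ((r + s - 1) / 2) * theta_term (x - y) ((r - s - 1) / 2))%C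
  = ((if Z.even r then - (1) else 1) * (split_term x r * split_term y s))%C.
Proof.
  intros H. apply Z.odd_spec in H as [k Hk].
  replace (r + s - 1)%Z with (k * 2)%Z by lia.
  replace (r - s - 1)%Z with ((k - s) * 2)%Z by lia.
  rewrite !Z.div_mul by lia.
  assert (Hr : r = (2 * k + 1 - s)%Z) by lia.
  assert (Hsign : (if Z.even r then - (1) else 1)%C
                  = Cexp (Ci * PI * RtoC (IZR (2 * k - s)))).
  { destruct (Z.even r) eqn:Er.
    - apply Z.even_spec in Er as [j Hj].
      replace (2 * k - s)%Z with (2 * (j - 1) + 1)%Z by lia.
      rewrite plus_IZR, RtoC_plus, Cmult_plus_distr_l, Cexp_plus, Cexp_PI_even.
      replace (Ci * PI * 1)%C with (Ci * PI)%C by ring. rewrite Cexp_PI. ring.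
    - assert (Eo : Z.odd r = true) by (rewrite <- Z.negb_even, Er; reflexivity).
      apply Z.odd_spec in Eo as [j Hj].
      replace (2 * k - s)%Z with (2 * j)%Z by lia. now rewrite Cexp_PI_even. }
  rewrite Hsign. unfold theta_term, split_term. rewrite <- !Cexp_plus. f_equal.
  rewrite Hr. rewrite ?minus_IZR, ?plus_IZR, ?mult_IZR, ?minus_IZR, ?plus_IZR, ?mult_IZR.
  rewrite RtoC_div by lra.
  rewrite ?RtoC_minus, ?RtoC_plus, ?RtoC_mult, ?RtoC_minus, ?RtoC_plus, ?RtoC_mult.
  field; apply RtoC_neq_0; lra.
Qed.

(** In the coordinates r, s each term splits, and opposite parities leave odd-even pairs with sign +
    and even-odd pairs with sign -: the partial sum is already a minor. *)
Lemma Csum_diagonal (N : nat) (x y : C) :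
  Csum (diagonal_range N) (fun p => theta_term (x + y) (fst p) * theta_term (x - y) (snd p))%C
  = (odd_sum N x * even_sum N y - even_sum N x * odd_sum N y)%C.
Proof.
  unfold diagonal_range. rewrite Csum_map, Csum_filter.
  unfold odd_sum, even_sum.
  rewrite <- !Csum_list_prod.
  match goal with |- _ = (Csum ?l ?f - Csum ?l ?g)%C =>
    transitivity (Csum l f + (- (1)) * Csum l g)%C; [| ring] end.
  rewrite <- Csum_scal, <- Csum_plus. apply Csum_ext. intros [r s] _. simpl fst. simpl snd.
  destruct (Z.odd (r + s)) eqn:E.
  - rewrite theta_term_mult by exact E.
    rewrite Z.odd_add, <- !Z.negb_even in E.
    destruct (Z.even r), (Z.even s); try discriminate; ring.
  - rewrite Z.odd_add, <- !Z.negb_even in E.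
    destruct (Z.even r), (Z.even s); try discriminate; ring.
Qed.

(** One absolutely convergent double series exhausted twice: squares in (k, l) give the product of
    theta values, squares in (r, s) give the minors. *)
Lemma theta_mult_tendsto (x y : C) :
  tendsto eventually (fun N => odd_sum N x * even_sum N y - even_sum N x * odd_sum N y)%C
    (theta (x + y) * theta (x - y)).
Proof.
  assert (EF : Filter eventually) by apply eventually_filter.
  destruct (theta_term_le (x + y)) as (a & Ha & Hxa).
  destruct (theta_term_le (x - y)) as (b & Hb & Hxb).
  set (h := fun p : Z * Z => (a * majorantZ (fst p)) * (b * majorantZ (snd p))).
  assert (Hs : forall c, 0 <= c -> summable (fun k => c * majorantZ k)).
  { intros c Hc. apply summable_le with majorantZ c; [exact Hc | apply summable_majorantZ | intros; lra]. }
  assert (Hn : forall c k, 0 <= c -> 0 <= c * majorantZ k)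
    by (intros; apply Rmult_le_pos; [assumption | apply majorantZ_nonneg]).
  destruct (Csum_tendsto (fun N => list_prod (Zball N) (Zball N))
    (fun p => theta_term (x + y) (fst p) * theta_term (x - y) (snd p))%C h) as [V HV].
  - apply exhausts_list_prod; apply exhausts_Zball.
  - intros p. apply Rmult_le_pos; now apply Hn.
  - apply (summable_prod Z.eq_dec Z.eq_dec (fun k => a * majorantZ k) (fun k => b * majorantZ k)); auto.
  - intros [k l]. unfold h. simpl. rewrite Cmod_mult.
    apply Rmult_le_compat; auto using Cmod_ge_0.
  - assert (E : V = (theta (x + y) * theta (x - y))%C).
    { apply (tendsto_unique eventually) with
        (fun N => Csum (list_prod (Zball N) (Zball N))
           (fun p => theta_term (x + y) (fst p) * theta_term (x - y) (snd p)))%C.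
      - refine (tendsto_comp _ _ _ _ _ (exhausts_filterlim _ _) HV).
        apply exhausts_list_prod; apply exhausts_Zball.
      - apply tendsto_ext with (fun N => Csum (Zball N) (theta_term (x + y))
                                         * Csum (Zball N) (theta_term (x - y)))%C.
        + exact EF.
        + apply filter_forall. intros N. now rewrite Csum_list_prod.
        + apply tendsto_mult; [exact EF | |];
            exact (tendsto_comp _ _ _ _ _ (exhausts_filterlim _ exhausts_Zball) (theta_spec _)). }
    rewrite <- E.
    apply tendsto_ext with (fun N => Csum (diagonal_range N)
      (fun p => theta_term (x + y) (fst p) * theta_term (x - y) (snd p))%C).
    + exact EF.
    + apply filter_forall. intros N. apply Csum_diagonal.
    + exact (tendsto_comp _ _ _ _ _ (exhausts_filterlim _ exhausts_diagonal_range) HV).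
Qed.

End Theta.

Definition three_term (f : C -> C) (x y z : C) : C :=
  (f (x + y) * f (x - y) * (f z * f z) + f (y - z) * f (y + z) * (f x * f x)
   - f y * f y * (f (x + z) * f (x - z)))%C.

(* Each product theta(x+y) theta(x-y) is a 2x2 minor, so this is a Pluecker relation. *)
Lemma theta_three_term (L : R) (x y z : C) : 0 < L -> three_term (theta L) x y z = 0%C.
Proof.
  intros HL. assert (EF : Filter eventually) by apply eventually_filter. unfold three_term.
  assert (H : forall u v, tendsto eventually
     (fun N => odd_sum L N u * even_sum L N v - even_sum L N u * odd_sum L N v)%C
     (theta L (u + v) * theta L (u - v))) by (intros; now apply theta_mult_tendsto).
  (* The fourth vector of the Pluecker relation sits at argument 0; its minor with the vector at u
     yields theta(u)^2. *)
  assert (H0 : forall u, tendsto eventually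
     (fun N => odd_sum L N u * even_sum L N 0 - even_sum L N u * odd_sum L N 0)%C
     (theta L u * theta L u)).
  { intros u. assert (Hu := H u 0%C). replace (u + 0)%C with u in Hu by ring.
    now replace (u - 0)%C with u in Hu by ring. }
  apply (tendsto_unique eventually) with (fun N =>
    (odd_sum L N x * even_sum L N y - even_sum L N x * odd_sum L N y)
      * (odd_sum L N z * even_sum L N 0 - even_sum L N z * odd_sum L N 0)
    + (odd_sum L N y * even_sum L N z - even_sum L N y * odd_sum L N z)
      * (odd_sum L N x * even_sum L N 0 - even_sum L N x * odd_sum L N 0)
    - (odd_sum L N y * even_sum L N 0 - even_sum L N y * odd_sum L N 0)
      * (odd_sum L N x * even_sum L N z - even_sum L N x * odd_sum L N z))%C.
  - rewrite (Cmult_comm (theta L (y - z))).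
    apply tendsto_minus; [exact EF | apply tendsto_plus; [exact EF | |] |];
      apply tendsto_mult; try exact EF; auto.
  - apply tendsto_ext with (fun _ => RtoC 0); [exact EF | | now apply tendsto_const].
    apply filter_forall. intros N. ring.
Qed.

(** * The Weierstrass product *)

(** [M] bounds the position within a row and tends to infinity first, so that each row becomes a
    sine before the product over rows is taken. *)
Definition iterated (P : nat * nat -> Prop) : Prop :=
  eventually (fun N => eventually (fun M => P (M, N))).

#[local] Instance iterated_filter : ProperFilter' iterated.
Proof.
  constructor.
  - intros [N HN]. destruct (HN N (Nat.le_refl N)) as [M HM]. exact (HM M (Nat.le_refl M)).
  - constructor.
    + apply (filter_forall (F := eventually)). intros N. now apply filter_forall.
    + intros P Q HP HQ. unfold iterated in *. generalize (filter_and2 HP HQ _). apply filter_imp.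
      intros N [H1 H2]. exact (filter_and2 H1 H2 _).
    + intros P Q HPQ. apply (filter_imp (F := eventually)). intros N. apply filter_imp. intros M. apply HPQ.
Qed.

Lemma tendsto_iterated (u : nat * nat -> C) (v : nat -> C) (l : C) :
  (forall N, tendsto eventually (fun M => u (M, N)) (v N)) ->
  tendsto eventually v l -> tendsto iterated u l.
Proof.
  intros Hu Hv eps Heps. generalize (Hv (eps / 2) ltac:(lra)). apply (filter_imp (F := eventually)).
  intros N HN. generalize (Hu N (eps / 2) ltac:(lra)). apply filter_imp. intros M HM.
  assert (H := Cmod_triangle3 (u (M, N)) (v N) l). lra.
Qed.

(** The quotient is given as x b = a because [b] may vanish at some indices. *)
Lemma tendsto_quot {T : Type} (F : (T -> Prop) -> Prop) {FF : Filter F}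
  (x a b : T -> C) (l m : C) :
  (forall t, x t * b t = a t)%C -> m <> 0%C -> tendsto F a l -> tendsto F b m ->
  tendsto F x (l / m).
Proof.
  intros E Hm Ha Hb.
  apply tendsto_ext with (fun t => a t * / b t)%C; [exact FF | |].
  - generalize (Hb (Cmod m) (proj1 (Cmod_gt_0 m) Hm)). apply filter_imp. intros t Ht.
    assert (H : b t <> 0%C).
    { intros E0. rewrite E0, Cmod_minus_sym in Ht.
      replace (m - 0)%C with m in Ht by ring. lra. }
    rewrite <- E. now field.
  - apply tendsto_mult; [exact FF | exact Ha |]. now apply tendsto_inv.
Qed.

Lemma Cinv_0 : (/ 0)%C = 0%C.
Proof. unfold Cinv, RtoC. simpl. unfold Rdiv. f_equal; ring. Qed.

Lemma Cinv_opp (z : C) : (/ - z)%C = (- / z)%C.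
Proof.
  destruct (Ceq_dec z 0) as [-> | Hz].
  - replace (- 0)%C with (RtoC 0) by ring. rewrite Cinv_0. ring.
  - now field.
Qed.

Lemma Cprod_filter {A : Type} (p : A -> bool) (s : list A) (u : A -> C) :
  (forall a, p a = false -> u a = 1%C) -> Cprod (filter p s) u = Cprod s u.
Proof.
  intros H. induction s as [| a s IH]; simpl; [reflexivity |].
  destruct (p a) eqn:E; simpl; rewrite IH; [reflexivity |].
  rewrite (H a E). ring.
Qed.

(** Moves the prefactor z of the Weierstrass product into row 0. *)
Lemma Cprod_Zball_scal_0 (N : nat) (c : C) (u : Z -> C) :
  Cprod (Zball N) (fun n => if (n =? 0)%Z then c * u n else u n)%C
  = (c * Cprod (Zball N) u)%C.
Proof.
  rewrite !Cprod_Zball_seq. change (0 =? 0)%Z with true. cbv iota.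
  now rewrite <- Cmult_assoc.
Qed.

(** Pairing m with -m, a row through [b] off the real axis is a quotient of two finite sine
    products: (p + a)(-p + a) = -p^2 (1 - a^2/p^2), and likewise for [b]. *)
Lemma Cprod_shifted_quot (M : nat) (a b : C) :
  (forall m : Z, RtoC (IZR m) * PI + b <> 0)%C ->
  (Cprod (Zball M) (fun m => (RtoC (IZR m) * PI + a) / (RtoC (IZR m) * PI + b))
   * sine_product M b)%C = sine_product M a.
Proof.
  intros Hb. rewrite Cprod_Zball_seq. unfold sine_product.
  assert (Hb0 := Hb 0%Z). replace (RtoC (IZR 0) * PI + b)%C with b in * by ring.
  replace (RtoC (IZR 0) * PI + a)%C with a by ring.
  match goal with |- (?q * ?P * (b * ?B) = a * ?X)%C =>
    transitivity (a * (P * B))%C; [now field |] end.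
  f_equal. rewrite <- Cprod_mult. apply Cprod_ext. intros j _.
  assert (H1 := Hb (Z.of_nat (S j))). assert (H2 := Hb (- Z.of_nat (S j))%Z).
  rewrite opp_IZR, <- INR_IZR_INZ, RtoC_opp in *.
  assert (Hp := pi_multiple_neq_0 j). unfold pi_multiple in *.
  set (p := (RtoC (INR (S j)) * PI)%C) in *.
  replace (- RtoC (INR (S j)) * PI)%C with (- p)%C in * by (unfold p; ring).
  field. repeat split; assumption.
Qed.

(* Since z / 0 = 0, the origin may be put back into the punctured squares. *)
Lemma sigma_factor_0 (z : C) : sigma_factor z 0 = 1%C.
Proof.
  unfold sigma_factor, Cdiv. rewrite Cinv_0.
  replace (z * 0 + z * 0 * (z * 0) * / 2)%C with (RtoC 0) by ring.
  rewrite Cexp_0. ring.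
Qed.

(** * Sigma as an iterated limit of rectangle products *)

Section Sigma.

Variables (omega1 : R) (omega3 : C).
Hypothesis omega1_pos : 0 < omega1.
Hypothesis omega3_imaginary : Re omega3 = 0 /\ 0 < Im omega3.

Let point (p : Z * Z) : C := lattice_point omega1 omega3 p.
Let sig (z : C) : C := sigma omega1 omega3 z.

Lemma point_components (p : Z * Z) :
  point p = (2 * omega1 * IZR (fst p), 2 * Im omega3 * IZR (snd p)).
Proof.
  unfold point, lattice_point. destruct omega3 as [x y], omega3_imaginary as [H _].
  simpl in *. rewrite H. unfold Cmult, Cplus, RtoC. simpl. f_equal; ring.
Qed.

Lemma point_eq_0 (p : Z * Z) : point p = 0%C <-> p = (0%Z, 0%Z).
Proof.
  rewrite point_components. destruct p as [m n]. simpl. split.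
  - intros E. assert (E1 := f_equal fst E). assert (E2 := f_equal snd E). simpl in E1, E2.
    destruct omega3_imaginary as [_ Hpos].
    apply Rmult_integral in E1 as [E1 | E1]; [lra |].
    apply Rmult_integral in E2 as [E2 | E2]; [lra |].
    f_equal; now apply eq_IZR.
  - intros E. apply pair_equal_spec in E as [-> ->]. unfold RtoC. f_equal; ring.
Qed.

Lemma sigma_factor_le (z : C) : exists c, 0 <= c /\
  forall p, Cmod (sigma_factor z (point p) - 1) <= c * (majorantZ (fst p) * majorantZ (snd p)).
Proof.
  set (k := Rmin omega1 (Im omega3)).
  assert (Hk : 0 < k) by (apply Rmin_glb_lt; tauto).
  set (A := Cmod z / k).
  assert (HA : 0 <= A) by (apply Rdiv_le_0_compat; [apply Cmod_ge_0 | exact Hk]).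
  assert (He := exp_pos (A + A ^ 2)).
  assert (HA3 : 0 <= A ^ 3) by now apply pow_le.
  assert (HAe : 0 <= A ^ 3 * exp (A + A ^ 2)) by (apply Rmult_le_pos; lra).
  (* 108 = 27 * 4: D + 2 <= 3 D for D >= 1 costs 27, and [majorant_cube] costs 4. The rest is the
     cubic bound at |u| <= A / D <= A. *)
  exists (2 * (A ^ 3 * exp (A + A ^ 2)) * 108). split.
  { lra. }
  intros [m n]. simpl fst. simpl snd.
  assert (Hmm : 0 <= majorantZ m * majorantZ n)
    by (apply Rmult_le_pos; apply majorantZ_nonneg).
  destruct (classic ((m, n) = (0%Z, 0%Z))) as [E | E].
  - rewrite (proj2 (point_eq_0 (m, n)) E), sigma_factor_0.
    replace (1 - 1)%C with (RtoC 0) by ring. rewrite Cmod_0.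
    apply Rmult_le_pos; lra.
  - set (D := Rmax (Rabs (IZR m)) (Rabs (IZR n))).
    assert (HD : 1 <= D).
    { assert (H : forall j : Z, j <> 0%Z -> 1 <= Rabs (IZR j)).
      { intros j Hj. rewrite <- abs_IZR. apply IZR_le. lia. }
      destruct (Z.eq_dec m 0) as [-> | Hm].
      - assert (n <> 0%Z) by (intros ->; now apply E).
        apply Rle_trans with (Rabs (IZR n)); [now apply H | apply Rmax_r].
      - apply Rle_trans with (Rabs (IZR m)); [now apply H | apply Rmax_l]. }
    assert (Hpt : k * D <= Cmod (point (m, n))).
    { assert (H1 := Rabs_Re_le_Cmod (point (m, n))). assert (H2 := Rabs_Im_le_Cmod (point (m, n))).
      rewrite point_components in *. cbn [fst snd] in H1, H2.
      rewrite !Rabs_mult, (Rabs_right 2), (Rabs_right omega1) in H1 by lra.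
      rewrite !Rabs_mult, (Rabs_right 2), (Rabs_right (Im omega3)) in H2
        by (destruct omega3_imaginary; lra).
      assert (Hk1 : k <= omega1) by apply Rmin_l. assert (Hk2 : k <= Im omega3) by apply Rmin_r.
      assert (P1 := Rabs_pos (IZR m)). assert (P2 := Rabs_pos (IZR n)).
      assert (Q1 := Rmult_le_compat_r _ _ _ P1 Hk1). assert (Q2 := Rmult_le_compat_r _ _ _ P2 Hk2).
      assert (Q3 := Rmult_le_pos _ _ (Rlt_le _ _ Hk) P1).
      assert (Q4 := Rmult_le_pos _ _ (Rlt_le _ _ Hk) P2).
      cbn [fst snd]. unfold D, Rmax.
      destruct (Rle_dec (Rabs (IZR m)) (Rabs (IZR n))); lra. }
    assert (Hu : Cmod (z / point (m, n)) <= A / D).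
    { rewrite Cmod_div by (intros E'; apply E; now apply point_eq_0).
      unfold A. replace (Cmod z / k / D) with (Cmod z * / (k * D)) by (field; lra).
      apply Rmult_le_compat_l; [apply Cmod_ge_0 |].
      apply Rinv_le_contravar; [nra | exact Hpt]. }
    assert (HuA : A / D <= A).
    { apply Rle_div_l; [lra |]. nra. }
    assert (Hu0 := Cmod_ge_0 (z / point (m, n))).
    eapply Rle_trans; [apply (primary_factor_minus_1_le (z / point (m, n))) |].
    set (u := Cmod (z / point (m, n))) in *.
    assert (H3 : u ^ 3 <= A ^ 3 * / D ^ 3).
    { replace (A ^ 3 * / D ^ 3) with ((A / D) ^ 3) by (field; lra).
      apply pow_incr. lra. }
    assert (H4 : exp (u + u ^ 2) <= exp (A + A ^ 2)).
    { assert (H4 : u + u ^ 2 <= A + A ^ 2) by nra.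
      destruct H4 as [H4 | H4]; [left; now apply exp_increasing | right; now f_equal]. }
    assert (H5 : / D ^ 3 <= 108 * (majorantZ m * majorantZ n)).
    { assert (H5 := majorant_cube (Rabs (IZR m)) (Rabs (IZR n)) D
        (conj (Rabs_pos _) (Rmax_l _ _)) (conj (Rabs_pos _) (Rmax_r _ _))).
      fold (majorantZ m) in H5. fold (majorantZ n) in H5.
      assert (H6 : / D ^ 3 <= 27 * / (D + 2) ^ 3); [| lra].
      replace (27 * / (D + 2) ^ 3) with (/ ((D + 2) / 3) ^ 3) by (field; lra).
      apply Rinv_le_contravar; [apply pow_lt; lra |]. apply pow_incr. lra. }
    assert (H6 : 0 <= u ^ 3) by (apply pow_le; exact Hu0).
    assert (H7 : 0 < / D ^ 3) by (apply Rinv_0_lt_compat, pow_lt; lra).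
    assert (H8 := exp_pos (u + u ^ 2)).
    apply Rle_trans with (2 * (A ^ 3 * / D ^ 3 * exp (A + A ^ 2))).
    + apply Rmult_le_compat_l; [lra |]. apply Rmult_le_compat; lra.
    + replace (2 * (A ^ 3 * / D ^ 3 * exp (A + A ^ 2)))
        with (2 * (A ^ 3 * exp (A + A ^ 2)) * / D ^ 3) by ring.
      rewrite (Rmult_assoc (2 * (A ^ 3 * exp (A + A ^ 2))) 108). apply Rmult_le_compat_l; [lra | exact H5].
Qed.

(** Upgrades the limit over squares in the definition of [sigma] to an unconditional one.
    Nonvanishing off the lattice serves twice: for the denominators of the QD expressions and for
    bounding [rectangle_sum]. *)
Lemma sigma_spec (z : C) : exists l,
  tendsto finite_lists (fun s => Cprod s (fun p => sigma_factor z (point p))) l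
  /\ sig z = (z * l)%C
  /\ (~ in_lattice omega1 omega3 z -> sig z <> 0%C).
Proof.
  assert (EF : Filter eventually) by apply eventually_filter.
  destruct (sigma_factor_le z) as (c & Hc & Hle).
  assert (Hh : forall p : Z * Z, 0 <= c * (majorantZ (fst p) * majorantZ (snd p))).
  { intros p. repeat apply Rmult_le_pos; try apply majorantZ_nonneg. exact Hc. }
  assert (Hsum : summable (fun p : Z * Z => c * (majorantZ (fst p) * majorantZ (snd p)))).
  { apply summable_le with (fun p : Z * Z => majorantZ (fst p) * majorantZ (snd p)) c.
    - exact Hc.
    - apply (summable_prod Z.eq_dec Z.eq_dec); auto using majorantZ_nonneg, summable_majorantZ.
    - intros p. apply Rle_refl. }
  assert (Hex := exhausts_list_prod _ _ exhausts_Zball exhausts_Zball).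
  destruct (Cprod_tendsto _ (fun p => sigma_factor z (point p)) _ Hex Hh Hsum Hle) as [l Hl].
  exists l. split; [exact Hl |].
  assert (E : sig z = (z * l)%C).
  { unfold sig, sigma. apply CLim_seq_tendsto. apply tendsto_scal; [exact EF |].
    apply tendsto_ext with (fun N => Cprod (list_prod (Zball N) (Zball N))
       (fun p => sigma_factor z (point p))).
    - exact EF.
    - apply filter_forall. intros N. unfold punctured_square. symmetry. apply Cprod_filter.
      intros [m n] Hp. apply Bool.negb_false_iff, andb_prop in Hp as [H1 H2].
      apply Z.eqb_eq in H1. apply Z.eqb_eq in H2. simpl in H1, H2. subst.
      fold (point (0, 0)%Z). rewrite (proj2 (point_eq_0 (0, 0)%Z) eq_refl). apply sigma_factor_0.
    - exact (tendsto_comp _ _ _ _ _ (exhausts_filterlim _ Hex) Hl). }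
  split; [exact E |]. intros Hz. rewrite E. apply Cmult_neq_0.
  - intros ->. apply Hz. exists (0, 0)%Z. symmetry. now apply (proj2 (point_eq_0 (0, 0)%Z)).
  - apply Cprod_limit_neq_0 with (3 := Hle) (5 := Hl); [exact Hh | exact Hsum |].
    intros p. destruct (classic (p = (0, 0)%Z)) as [Ep | Ep].
    + rewrite (proj2 (point_eq_0 p) Ep), sigma_factor_0. apply C1_neq_0.
    + assert (Hp : point p <> 0%C) by (intros E'; now apply Ep, point_eq_0).
      unfold sigma_factor. apply Cmult_neq_0; [| apply Cexp_neq_0].
      intros E'. apply Hz. exists p. fold (point p).
      replace z with (point p - point p * (1 - z / point p))%C by (now field).
      rewrite E'. ring.
Qed.

Definition rectangle (q : nat * nat) : list (Z * Z) := list_prod (Zball (fst q)) (Zball (snd q)).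

Definition rectangle_product (q : nat * nat) (z : C) : C :=
  (z * Cprod (rectangle q) (fun p => 1 - z / point p))%C.

Definition rectangle_sum (q : nat * nat) : C :=
  Csum (rectangle q) (fun p => / point p * / point p)%C.

(** The reflection of the rectangle changes the sign of the sum; the origin contributes the default
    inverse 0. *)
Lemma rectangle_linear_sum (q : nat * nat) : Csum (rectangle q) (fun p => / point p)%C = 0%C.
Proof.
  set (neg := fun p : Z * Z => (- fst p, - snd p)%Z).
  assert (P : Permutation (rectangle q) (map neg (rectangle q))).
  { assert (Hn : NoDup (rectangle q)) by (apply NoDup_list_prod; apply NoDup_Zball).
    apply NoDup_Permutation; [exact Hn | |].
    - apply FinFun.Injective_map_NoDup; [| exact Hn].
      intros [a b] [a' b'] H. apply pair_equal_spec in H as [H1 H2]. simpl in *. f_equal; lia.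
    - intros [a b]. rewrite in_map_iff. unfold rectangle. split.
      + intros H. apply in_prod_iff in H as [H1 H2]. exists (- a, - b)%Z. split.
        * unfold neg. simpl. f_equal; lia.
        * apply in_prod; apply In_Zball; apply In_Zball in H1; apply In_Zball in H2; lia.
      + intros ([a' b'] & E & H). apply pair_equal_spec in E as [<- <-].
        apply in_prod_iff in H as [H1 H2]. simpl.
        apply in_prod; apply In_Zball; apply In_Zball in H1; apply In_Zball in H2; lia. }
  set (S := Csum (rectangle q) (fun p => / point p)%C).
  assert (E : S = ((- (1)) * S)%C).
  { unfold S at 1. rewrite (Csum_perm _ _ _ P), Csum_map. unfold S. rewrite <- Csum_scal.
    apply Csum_ext. intros p _.
    replace (point (neg p)) with (- point p)%C.
    - rewrite Cinv_opp. ring.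
    - rewrite !point_components. unfold neg, Copp. simpl. rewrite !opp_IZR. f_equal; ring. }
  replace S with ((S - (- (1)) * S) / 2)%C by (field).
  rewrite <- E. field.
Qed.

Lemma rectangle_sigma_product (q : nat * nat) (z : C) :
  (z * Cprod (rectangle q) (fun p => sigma_factor z (point p)))%C
  = (rectangle_product q z * Cexp (z * z / 2 * rectangle_sum q))%C.
Proof.
  unfold sigma_factor, rectangle_product. rewrite Cprod_mult, Cexp_Csum.
  replace (Csum (rectangle q) (fun p => z / point p + z / point p * (z / point p) / 2))%C
    with (z * z / 2 * rectangle_sum q)%C; [ring |].
  rewrite Csum_plus. unfold rectangle_sum. rewrite <- Csum_scal.
  match goal with |- _ = (?a + _)%C => replace a with (RtoC 0) end.
  - rewrite Cplus_0_l. apply Csum_ext. intros p _. unfold Cdiv. ring.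
  - unfold Cdiv. rewrite Csum_scal, rectangle_linear_sum. ring.
Qed.

(** Any rectangle with both sides large contains a prescribed finite list, so the unconditional
    limit is also the iterated one. *)
Lemma rectangle_tendsto (z : C) :
  tendsto iterated (fun q => rectangle_product q z * Cexp (z * z / 2 * rectangle_sum q))%C (sig z).
Proof.
  destruct (sigma_spec z) as (l & Hl & -> & _).
  apply tendsto_ext with (fun q => z * Cprod (rectangle q) (fun p => sigma_factor z (point p)))%C.
  - apply filter_filter'.
  - apply filter_forall. intros q. apply rectangle_sigma_product.
  - apply tendsto_scal; [apply filter_filter' |].
    refine (tendsto_comp iterated _ _ _ _ _ Hl).
    intros P [s Hs]. unfold filtermap.
    destruct (eventually_incl _ s (proj2 (exhausts_list_prod _ _ exhausts_Zball exhausts_Zball)))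
      as [N0 HN0].
    exists N0. intros N HN. exists N0. intros M HM. apply Hs.
    + apply NoDup_list_prod; apply NoDup_Zball.
    + intros [a b] Hp. assert (H := HN0 N0 (Nat.le_refl _) _ Hp).
      apply in_prod_iff in H as [H1 H2]. apply In_Zball in H1. apply In_Zball in H2.
      apply in_prod; apply In_Zball; simpl; lia.
Qed.

(** exp(-L) is exp(i pi omega3 / omega1), the nome of the lattice. *)
Let L : R := PI * Im omega3 / omega1.

Lemma L_pos : 0 < L.
Proof.
  assert (H := PI_RGT_0). unfold L. apply Rdiv_lt_0_compat; [| exact omega1_pos].
  apply Rmult_lt_0_compat; tauto.
Qed.

(** Rescaling by 2 omega1 / pi gives the rows spacing pi, with row n shifted by i L n. *)
Lemma point_shift (m n : Z) :
  point (m, n) = (RtoC (2 * omega1 / PI) * (RtoC (IZR m) * PI + Ci * RtoC (L * IZR n)))%C.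
Proof.
  rewrite point_components. assert (H := PI_neq0). unfold L.
  unfold Ci, Cmult, Cplus, RtoC. simpl. f_equal; field; lra.
Qed.

Lemma rectangle_product_tendsto : exists c : C, forall z,
  tendsto iterated (fun q => rectangle_product q z) (c * theta L (- (RtoC (PI / (2 * omega1)) * z))).
Proof.
  assert (EF : Filter eventually) by apply eventually_filter.
  destruct sine_product_tendsto as (k & Hk & Hsin).
  destruct (theta_product_tendsto L L_pos) as (c & Hc).
  assert (HPI := PI_RGT_0).
  set (e := RtoC (2 * omega1 / PI)).
  exists (e * k * c)%C. intros z. set (x := (RtoC (PI / (2 * omega1)) * z)%C).
  assert (He : e <> 0%C).
  { apply RtoC_neq_0. assert (0 < 2 * omega1 / PI) by (apply Rdiv_lt_0_compat; lra). lra. }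
  assert (Hz : z = (e * x)%C).
  { unfold e, x. rewrite Cmult_assoc, <- RtoC_mult.
    replace (2 * omega1 / PI * (PI / (2 * omega1))) with 1 by (field; lra). ring. }
  set (row := fun (M : nat) (n : Z) => Cprod (Zball M) (fun m => 1 - z / point (m, n))%C).
  apply tendsto_iterated with (fun N => e * k * theta_product L N x)%C.
  - intros N.
    apply tendsto_ext with (fun M =>
       Cprod (Zball N) (fun n => if (n =? 0)%Z then z * row M n else row M n)%C).
    + exact EF.
    + apply filter_forall. intros M. rewrite Cprod_Zball_scal_0.
      unfold rectangle_product, rectangle, row. simpl fst. simpl snd.
      now rewrite Cprod_list_prod, Cprod_comm.
    + unfold theta_product.
      rewrite <- (Cprod_Zball_scal_0 N (e * k)).
      apply (tendsto_Cprod eventually (Zball N)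
               (fun n M => if (n =? 0)%Z then (z * row M n)%C else row M n)).
      intros n _. destruct (n =? 0)%Z eqn:En.
      (* Row 0: the origin contributes the factor 1, the prefactor z supplies the missing zero, and
         the sine constant k remains. *)
      * apply Z.eqb_eq in En. subst n.
        apply tendsto_ext with (fun M => e * sine_product M x)%C; [exact EF | |].
        -- apply filter_forall. intros M. unfold row. rewrite Cprod_Zball_seq.
           rewrite (proj2 (point_eq_0 (0, 0)%Z) eq_refl).
           replace (1 - z / 0)%C with (RtoC 1) by (unfold Cdiv; rewrite Cinv_0; ring).
           unfold sine_product. rewrite Cmult_1_l, Cmult_assoc, <- Hz. f_equal.
           apply Cprod_ext. intros j _. rewrite !point_shift. fold e.
           rewrite opp_IZR, <- INR_IZR_INZ, Rmult_0_r, RtoC_opp.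
           assert (Hp := pi_multiple_neq_0 j). unfold pi_multiple in *. rewrite Hz.
           set (p := (RtoC (INR (S j)) * PI)%C) in *.
           replace (- RtoC (INR (S j)) * PI)%C with (- p)%C by (unfold p; ring).
           replace (p + Ci * 0)%C with p by ring. replace (- p + Ci * 0)%C with (- p)%C by ring.
           field. split; [exact Hp | exact He].
        -- replace (e * k * dsin x)%C with (e * (k * dsin x))%C by ring.
           apply tendsto_scal; [exact EF | apply Hsin].
      (* Any other row is a quotient of two sine products, in which k cancels. *)
      * apply Z.eqb_neq in En.
        assert (Hn : L * IZR n <> 0).
        { assert (HL := L_pos). apply Rmult_integral_contrapositive. split; [lra |].
          intros E. apply En. now apply eq_IZR. }
        set (b := (Ci * RtoC (L * IZR n))%C).
        assert (Hb : forall m : Z, (RtoC (IZR m) * PI + b)%C <> 0%C).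
        { intros m E. apply (f_equal snd) in E. unfold b in E. simpl in E. apply Hn. lra. }
        assert (Hdb : dsin b <> 0%C) by now apply dsin_imaginary_neq_0.
        replace (dsin (b - x) / dsin b)%C with (k * dsin (b - x) / (k * dsin b))%C
          by (field; split; assumption).
        apply tendsto_quot with (fun M => sine_product M (b - x)) (fun M => sine_product M b).
        -- exact EF.
        -- intros M. rewrite <- (Cprod_shifted_quot M (b - x) b Hb). f_equal.
           apply Cprod_ext. intros m _. rewrite point_shift. fold e. fold b. rewrite Hz.
           field. split; [apply Hb | exact He].
        -- now apply Cmult_neq_0.
        -- apply Hsin.
        -- apply Hsin.
  - replace (e * k * c * theta L (- x))%C with (e * k * (c * theta L (- x)))%C by ring.
    apply tendsto_scal; [exact EF | apply Hc].
Qed.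

(** * Boundedness of the exponents and the three-term relation for sigma *)

Lemma rectangle_sum_lower (z : C) : ~ in_lattice omega1 omega3 z ->
  exists K, iterated (fun q => - K <= Re (z * z / 2 * rectangle_sum q)%C).
Proof.
  assert (EF : Filter iterated) by apply filter_filter'.
  intros Hz.
  assert (Hs : 0 < Cmod (sig z)).
  { destruct (sigma_spec z) as (l & _ & _ & H). now apply Cmod_gt_0, H. }
  destruct rectangle_product_tendsto as [c Hc].
  set (T := (c * theta L (- (RtoC (PI / (2 * omega1)) * z)))%C).
  assert (HB := tendsto_bounded iterated _ _ (Hc z)). fold T in HB.
  set (B := Cmod T + 1) in *.
  assert (HBp : 0 < B) by (assert (H := Cmod_ge_0 T); unfold B; lra).
  (* Eventually the full product exceeds |sigma(z)| / 2 while its polynomial part is at most B, so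
     the exponential has modulus at least d. *)
  set (d := Cmod (sig z) / 2 / B).
  assert (Hd : 0 < d) by (apply Rdiv_lt_0_compat; lra).
  exists (- ln d).
  generalize (filter_and2 HB (rectangle_tendsto z (Cmod (sig z) / 2) ltac:(lra)) _).
  apply filter_imp. intros q [H1 H2]. rewrite Ropp_involutive.
  assert (H3 := Cmod_triangle_inv (sig z) (rectangle_product q z * Cexp (z * z / 2 * rectangle_sum q))).
  rewrite Cmod_minus_sym in H2. rewrite Cmod_mult, Cmod_Cexp in H3.
  set (r := Re (z * z / 2 * rectangle_sum q)%C) in *.
  assert (H4 : d <= exp r).
  { unfold d. apply Rle_div_l; [exact HBp |].
    assert (H5 : Cmod (rectangle_product q z) * exp r <= B * exp r)
      by (apply Rmult_le_compat_r; [left; apply exp_pos | exact H1]). lra. }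
  rewrite <- (ln_exp r). destruct H4 as [H4 | ->]; [left; now apply ln_increasing | apply Rle_refl].
Qed.

(* The four points have squares proportional to 1, -1, i, -i. *)
Lemma rectangle_sum_bounded : exists K, iterated (fun q => Cmod (rectangle_sum q) <= K).
Proof.
  (* Nonzero coordinates of lattice points are at least twice omega1 or Im omega3, so a point with a
     coordinate equal to k is off the lattice. *)
  set (k := Rmin omega1 (Im omega3)).
  assert (Hk : 0 < k) by (apply Rmin_glb_lt; tauto).
  assert (Hk1 : k <= omega1) by apply Rmin_l. assert (Hk2 : k <= Im omega3) by apply Rmin_r.
  assert (Hno : forall (a : R) (j : Z), 0 < k <= a -> k <> 2 * a * IZR j).
  { intros a j Ha E. destruct (Z_lt_le_dec 0 j) as [Hj | Hj].
    - assert (H : 1 <= IZR j) by (apply IZR_le; lia). nra.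
    - assert (H : IZR j <= 0) by (apply IZR_le; lia). nra. }
  assert (HR : forall y : R, ~ in_lattice omega1 omega3 (k, y)).
  { intros y [p E]. fold (point p) in E. rewrite point_components in E.
    apply (f_equal fst) in E. simpl in E. revert E. apply Hno. lra. }
  assert (HI : forall x : R, ~ in_lattice omega1 omega3 (x, k)).
  { intros x [p E]. fold (point p) in E. rewrite point_components in E.
    apply (f_equal snd) in E. simpl in E. revert E. apply Hno. lra. }
  destruct (rectangle_sum_lower _ (HR 0)) as [K1 H1].
  destruct (rectangle_sum_lower _ (HI 0)) as [K2 H2].
  destruct (rectangle_sum_lower _ (HR k)) as [K3 H3].
  destruct (rectangle_sum_lower _ (HR (- k))) as [K4 H4].
  set (K := 2 * (Rabs K1 + Rabs K2 + Rabs K3 + Rabs K4) / (k * k)).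
  exists (2 * K).
  assert (EF : Filter iterated) by apply filter_filter'.
  generalize (filter_and2 (filter_and2 H1 H2 EF) (filter_and2 H3 H4 EF) EF).
  apply filter_imp. intros q [[E1 E2] [E3 E4]].
  destruct (rectangle_sum q) as [a b].
  assert (A1 := Rle_abs K1). assert (A2 := Rle_abs K2).
  assert (A3 := Rle_abs K3). assert (A4 := Rle_abs K4).
  assert (B1 := Rabs_pos K1). assert (B2 := Rabs_pos K2).
  assert (B3 := Rabs_pos K3). assert (B4 := Rabs_pos K4).
  assert (Hkk : 0 < k * k) by nra.
  replace (Re ((k, 0) * (k, 0) / 2 * (a, b))%C) with (k * k * a / 2) in E1 by (simpl; field).
  replace (Re ((0, k) * (0, k) / 2 * (a, b))%C) with (- (k * k * a / 2)) in E2 by (simpl; field).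
  replace (Re ((k, k) * (k, k) / 2 * (a, b))%C) with (- (k * k * b)) in E3 by (simpl; field).
  replace (Re ((k, (- k)%R) * (k, (- k)%R) / 2 * (a, b))%C) with (k * k * b) in E4 by (simpl; field).
  apply Cmod_le_2_components; simpl; unfold K; apply Rabs_le; split;
    match goal with
    | |- - (?x / ?y) <= ?v => replace (- (x / y)) with (- x / y) by (field; lra);
                             apply Rle_div_l; [exact Hkk | lra]
    | |- ?v <= ?x / ?y => apply Rle_div_r; [exact Hkk | lra]
    end.
Qed.

Lemma tendsto_three_term {T : Type} (F : (T -> Prop) -> Prop) {FF : Filter F}
  (u : T -> C -> C) (v : C -> C) (x y z : C) :
  (forall w, tendsto F (fun t => u t w) (v w)) ->
  tendsto F (fun t => three_term (u t) x y z) (three_term v x y z).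
Proof.
  intros H. unfold three_term.
  apply tendsto_minus; [exact FF | apply tendsto_plus; [exact FF | |] |];
    repeat (apply tendsto_mult; [exact FF | |]); apply H.
Qed.

Lemma sigma_three_term (x y z : C) : three_term sig x y z = 0%C.
Proof.
  assert (EF : Filter iterated) by apply filter_filter'.
  apply (tendsto_unique iterated) with (fun q =>
    three_term (fun z => rectangle_product q z * Cexp (z * z / 2 * rectangle_sum q))%C x y z).
  - apply (tendsto_three_term iterated
      (fun q z => rectangle_product q z * Cexp (z * z / 2 * rectangle_sum q))%C).
    apply rectangle_tendsto.
  - apply tendsto_ext with (fun q => Cexp ((x * x + y * y + z * z) * rectangle_sum q)
                                     * three_term (rectangle_product q) x y z)%C.
    + exact EF.
    + apply filter_forall. intros q. unfold three_term. set (r := rectangle_sum q).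
      (* The parallelogram law, (s+t)^2/2 + (s-t)^2/2 + p^2 = s^2 + t^2 + p^2, makes the factor
         symmetric in the three arguments. *)
      assert (E : forall s t p, (Cexp ((s + t) * (s + t) / 2 * r) * Cexp ((s - t) * (s - t) / 2 * r)
                     * (Cexp (p * p / 2 * r) * Cexp (p * p / 2 * r))
                     = Cexp ((s * s + t * t + p * p) * r))%C).
      { intros s t p. rewrite <- !Cexp_plus. f_equal. field. }
      assert (E1 := E x y z). assert (E2 := E y z x). assert (E3 := E x z y).
      replace ((x * x + z * z + y * y) * r)%C with ((x * x + y * y + z * z) * r)%C in E3 by ring.
      replace ((y * y + z * z + x * x) * r)%C with ((x * x + y * y + z * z) * r)%C in E2 by ring.
      match type of E1 with (?a1 * ?a2 * (?a3 * ?a3) = ?g)%C =>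
      match type of E2 with (?b1 * ?b2 * (?b3 * ?b3) = _)%C =>
      match type of E3 with (?c1 * ?c2 * (?c3 * ?c3) = _)%C =>
        set (A1 := a1) in *; set (A2 := a2) in *; set (A3 := a3) in *;
        set (B1 := b1) in *; set (B2 := b2) in *; set (B3 := b3) in *;
        set (C1 := c1) in *; set (C2 := c2) in *; set (C3 := c3) in *; set (G := g) in *
      end end end.
      set (f := rectangle_product q).
      transitivity (G * (f (x + y) * f (x - y) * (f z * f z)) + G * (f (y - z) * f (y + z) * (f x * f x))
                    - G * (f y * f y * (f (x + z) * f (x - z))))%C; [ring |].
      rewrite <- E1 at 1. rewrite <- E2 at 1. rewrite <- E3. ring.
    + destruct rectangle_sum_bounded as [K HK].
      (* The exponential is bounded, and the three-term expression of the polynomial parts tends to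
         c^4 times that of theta, which is 0. *)
      apply tendsto_0_bounded_mult with (exp (Cmod (x * x + y * y + z * z) * K)).
      * exact EF.
      * revert HK. apply filter_imp. intros q Hq. rewrite Cmod_Cexp.
        assert (H1 := re_le_Cmod ((x * x + y * y + z * z) * rectangle_sum q)).
        rewrite Cmod_mult in H1.
        assert (H2 := Rle_abs (Re ((x * x + y * y + z * z) * rectangle_sum q)%C)).
        assert (H3 : Cmod (x * x + y * y + z * z) * Cmod (rectangle_sum q)
                     <= Cmod (x * x + y * y + z * z) * K)
          by (apply Rmult_le_compat_l; [apply Cmod_ge_0 | exact Hq]).
        assert (H4 := Rle_trans _ _ _ H2 (Rle_trans _ _ _ H1 H3)).
        destruct H4 as [H4 | H4]; [left; now apply exp_increasing | right; now f_equal].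
      * destruct rectangle_product_tendsto as [c Hc].
        assert (H := tendsto_three_term iterated (fun q w => rectangle_product q w)
          (fun w => c * theta L (- (RtoC (PI / (2 * omega1)) * w)))%C x y z Hc).
        cbv beta in H.
        match type of H with tendsto _ _ ?l => replace l with (RtoC 0) in H end; [exact H |].
        set (s := RtoC (PI / (2 * omega1))).
        assert (Ht := theta_three_term L (- (s * x)) (- (s * y)) (- (s * z)) L_pos).
        unfold three_term in Ht |- *.
        replace (- (s * x) + - (s * y))%C with (- (s * (x + y)))%C in Ht by ring.
        replace (- (s * x) - - (s * y))%C with (- (s * (x - y)))%C in Ht by ring.
        replace (- (s * y) - - (s * z))%C with (- (s * (y - z)))%C in Ht by ring.
        replace (- (s * y) + - (s * z))%C with (- (s * (y + z)))%C in Ht by ring.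
        replace (- (s * x) + - (s * z))%C with (- (s * (x + z)))%C in Ht by ring.
        replace (- (s * x) - - (s * z))%C with (- (s * (x - z)))%C in Ht by ring.
        transitivity (c * c * (c * c) * 0)%C; [ring |]. rewrite <- Ht. ring.
Qed.

End Sigma.

(** * The QD relations *)

Section QD.

Variable br : C -> C.
Variables A B E : C.
Hypothesis br_three_term : forall x y z, three_term br x y z = 0%C.
Hypothesis br_A : forall j : Z, br (A + RtoC (IZR j)) <> 0%C.
Hypothesis br_B : forall (n : nat) (j : Z), br (B + (A + RtoC (IZR j)) * RtoC (INR n)) <> 0%C.

(** The expressions d and b with the level absorbed into [a]: raising l by one replaces [A] by A +
    1. *)
Let D (a : C) (n : R) : C :=
  (E * ((br (a - n) * br (B + (a + 1) * (n + 1)) * br (B + a * n))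
        / (br (a + n + 1) * br (B + (a + 1) * n) * br (B + a * (n + 1)))))%C.

Let F (a : C) (n : R) : C :=
  (- E * ((br n * br n * br (B + (a + 1) * (n + 1)) * br (B + a * (n - 1)))
          / (br (B + (a + 1) * n) * br (B + a * n) * br (a + n) * br (a + n + 1))))%C.

Lemma br_A_eq (u : C) (j : Z) : u = (A + RtoC (IZR j))%C -> br u <> 0%C.
Proof. intros ->. apply br_A. Qed.

Lemma br_B_eq (u : C) (n : nat) (j : Z) :
  u = (B + (A + RtoC (IZR j)) * RtoC (INR n))%C -> br u <> 0%C.
Proof. intros ->. apply br_B. Qed.

(** Each side, over a common denominator, has a numerator that one three-term relation factors. Both
    then equal -E br(X+c+n+1) br(X-n) br(c)^2 / (br(X) br(X+c) br(c+n) br(c+n+1)). *)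
Lemma qd_sum_relation (n : nat) :
  (F (A + 1) (INR n) - D (A + 1) (INR n))%C = (F A (INR (n + 1)) - D A (INR n))%C.
Proof.
  rewrite plus_INR. simpl (INR 1). unfold F, D. rewrite RtoC_plus.
  set (c := (A + 1)%C). set (nn := RtoC (INR n)). set (X := (B + c * nn)%C).
  assert (T1 := br_three_term X c nn). assert (T2 := br_three_term (X + c) c (nn + 1)%C).
  unfold three_term in T1, T2.
  replace (B + (c + 1) * (nn + 1))%C with (X + c + (nn + 1))%C by (unfold X; ring).
  replace (B + c * (nn - 1))%C with (X - c)%C by (unfold X; ring).
  replace (B + (c + 1) * nn)%C with (X + nn)%C by (unfold X; ring).
  replace (B + c * (nn + 1))%C with (X + c)%C by (unfold X; ring).
  replace (B + c * (nn + 1 + 1))%C with (X + c + c)%C by (unfold X; ring).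
  replace (B + A * (nn + 1 - 1))%C with (X - nn)%C by (unfold X, c; ring).
  replace (B + A * nn)%C with (X - nn)%C by (unfold X, c; ring).
  replace (B + A * (nn + 1))%C with (X + c - (nn + 1))%C by (unfold X, c; ring).
  replace (A + (nn + 1))%C with (c + nn)%C by (unfold c; ring).
  replace (A + nn + 1)%C with (c + nn)%C by (unfold c; ring).
  replace (A - nn)%C with (c - (nn + 1))%C by (unfold c; ring).
  replace (c + (nn + 1))%C with (c + nn + 1)%C in T2 by ring.
  replace (X + c - c)%C with X in T2 by ring.
  assert (N1 : br (X + nn) <> 0%C)
    by (apply br_B_eq with n 2%Z; unfold X, c, nn; ring).
  assert (N2 : br X <> 0%C) by (apply br_B_eq with n 1%Z; unfold X, c, nn; ring).
  assert (N3 : br (c + nn) <> 0%C)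
    by (apply br_A_eq with (Z.of_nat n + 1)%Z; unfold c, nn;
        rewrite plus_IZR, <- INR_IZR_INZ, RtoC_plus; ring).
  assert (N4 : br (c + nn + 1) <> 0%C)
    by (apply br_A_eq with (Z.of_nat n + 2)%Z; unfold c, nn;
        rewrite plus_IZR, <- INR_IZR_INZ, RtoC_plus; ring).
  assert (N5 : br (X + c) <> 0%C)
    by (apply br_B_eq with (S n) 1%Z; unfold X, c, nn; rewrite S_INR, RtoC_plus; ring).
  assert (N6 : br (X + c - (nn + 1)) <> 0%C)
    by (apply br_B_eq with (S n) 0%Z; unfold X, c, nn; rewrite S_INR, RtoC_plus; ring).
  set (p := br (X + nn)) in *. set (x := br X) in *. set (u := br (c + nn)) in *.
  set (v := br (c + nn + 1)) in *. set (y := br (X + c)) in *.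
  set (i := br (X + c - (nn + 1))) in *. set (h := br (X - nn)) in *.
  set (g := br (X + c + (nn + 1))) in *. set (xc := br (X - c)) in *.
  set (yc := br (X + c + c)) in *. set (cn := br (c - nn)) in *.
  set (cm := br (c - (nn + 1))) in *. set (m := br nn) in *. set (k := br (nn + 1)) in *.
  set (w := br c) in *.
  assert (S1 : (xc * y * (m * m) + cn * u * (x * x) = w * w * (p * h))%C).
  { transitivity ((y * xc * (m * m) + cn * u * (x * x) - w * w * (p * h)) + w * w * (p * h))%C;
      [ring | rewrite T1; ring]. }
  assert (S2 : (yc * x * (k * k) + cm * v * (y * y) = w * w * (g * i))%C).
  { transitivity ((yc * x * (k * k) + cm * v * (y * y) - w * w * (g * i)) + w * w * (g * i))%C;
      [ring | rewrite T2; ring]. }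
  transitivity (- E * g * (xc * y * (m * m) + cn * u * (x * x)) / (p * v * x * u * y))%C.
  { field. repeat split; assumption. }
  rewrite S1.
  transitivity (- E * h * (yc * x * (k * k) + cm * v * (y * y)) / (y * i * u * v * x))%C.
  - rewrite S2. field. repeat split; assumption.
  - field. repeat split; assumption.
Qed.

Lemma qd_product_relation (n : nat) : (1 <= n)%nat ->
  (F A (INR n) * D (A + 1) (INR n))%C = (D A (INR (n - 1)) * F (A + 1) (INR n))%C.
Proof.
  intros Hn. rewrite minus_INR by exact Hn. simpl (INR 1). unfold F, D. rewrite RtoC_minus.
  set (nn := RtoC (INR n)).
  replace (nn - 1 + 1)%C with nn by ring.
  replace (A + 1 - nn)%C with (A - (nn - 1))%C by ring.
  replace (A + (nn - 1) + 1)%C with (A + nn)%C by ring.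
  replace (A + 1 + nn)%C with (A + nn + 1)%C by ring.
  assert (N1 : br (B + (A + 1) * nn) <> 0%C) by (apply br_B_eq with n 1%Z; reflexivity).
  assert (N2 : br (B + A * nn) <> 0%C) by (apply br_B_eq with n 0%Z; unfold nn; ring).
  assert (N3 : br (A + nn) <> 0%C)
    by (apply br_A_eq with (Z.of_nat n); unfold nn; now rewrite <- INR_IZR_INZ).
  assert (N4 : br (A + nn + 1) <> 0%C)
    by (apply br_A_eq with (Z.of_nat n + 1)%Z; unfold nn;
        rewrite plus_IZR, <- INR_IZR_INZ, RtoC_plus; ring).
  assert (N5 : br (A + nn + 1 + 1) <> 0%C)
    by (apply br_A_eq with (Z.of_nat n + 2)%Z; unfold nn;
        rewrite plus_IZR, <- INR_IZR_INZ, RtoC_plus; ring).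
  assert (N6 : br (B + (A + 1 + 1) * nn) <> 0%C)
    by (apply br_B_eq with n 2%Z; unfold nn; ring).
  assert (N7 : br (B + (A + 1) * (nn + 1)) <> 0%C)
    by (apply br_B_eq with (S n) 1%Z; unfold nn; rewrite S_INR, RtoC_plus; ring).
  (* Here n >= 1 keeps n - 1 a natural number, as [br_B] requires. *)
  assert (N8 : br (B + (A + 1) * (nn - 1)) <> 0%C).
  { apply br_B_eq with (n - 1)%nat 1%Z. unfold nn.
    rewrite minus_INR, RtoC_minus by exact Hn. reflexivity. }
  field. repeat split; assumption.
Qed.

End QD.

(** * The QD relations for the elliptic expressions *)

Local Open Scope C_scope.

Theorem mainTheorem5 (omega1 : R) (omega3 : C) (w : R) (alpha beta gamma : C)
  (homega1 : (0 < omega1)%R)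
  (homega3 : Re omega3 = 0%R /\ (0 < Im omega3)%R)
  (hw : forall N1 N2 : Z, (N1, N2) <> (0%Z, 0%Z) ->
        (w * IZR N1)%R <> (omega1 * IZR N2)%R)
  (halpha : ~ exists (k : Z) (lambda : C),
        in_lattice omega1 omega3 lambda /\ alpha = w * IZR k + lambda)
  (hbeta : forall (n : nat) (l : Z),
        ~ in_lattice omega1 omega3 (beta + INR n * (alpha + IZR l * w))) :
  let d := qd_d omega1 omega3 w alpha beta gamma in
  let b := qd_b omega1 omega3 w alpha beta gamma in
  let f := qd_f omega1 omega3 w alpha beta gamma in
  let e := qd_e omega1 omega3 w alpha beta gamma in
  (forall l : Z, b 0%nat l = 0) /\
  (forall (l : Z) (n : nat), (1 <= n)%nat ->
     b n l * d n (l + 1)%Z = d (n - 1)%nat l * b n (l + 1)%Z) /\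
  (forall (l : Z) (n : nat),
     b n (l + 1)%Z - d n (l + 1)%Z = b (n + 1)%nat l - d n l) /\
  (forall (l : Z) (n : nat), (1 <= n)%nat ->
     e (n - 1)%nat (l + 1)%Z * f n (l + 1)%Z = e n l * f n l) /\
  (forall (l : Z) (n : nat),
     e n (l + 1)%Z + f n (l + 1)%Z = e n l + f (n + 1)%nat l).
Proof.
  intros d b f e.
  assert (Hw0 : RtoC w <> 0%C).
  { apply RtoC_neq_0. intros E. apply (hw 1%Z 0%Z); [discriminate |]. rewrite E. ring. }
  assert (Hnz : forall z, ~ in_lattice omega1 omega3 z -> sigma omega1 omega3 z <> 0%C).
  { intros z Hz. destruct (sigma_spec omega1 omega3 homega1 homega3 z) as (s & _ & _ & H).
    now apply H. }
  assert (Hsw : sigma omega1 omega3 w <> 0%C).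
  (* If w were a lattice point, its real part would give w = 2 m omega1, against [hw] at (1, 2m). *)
  { apply Hnz. intros [[m n] E]. apply (f_equal fst) in E.
    unfold lattice_point in E. destruct omega3 as [o1 o2]. simpl in E, homega3.
    apply (hw 1%Z (2 * m)%Z); [discriminate |]. rewrite mult_IZR.
    destruct homega3 as [H _]. rewrite H in E. rewrite E. ring. }
  set (br := ell omega1 omega3 w).
  assert (Hbr : forall z, ~ in_lattice omega1 omega3 (w * z)%C -> br z <> 0%C).
  { intros z Hz E. unfold br, ell in E. apply (Hnz _ Hz).
    replace (sigma omega1 omega3 (w * z))
      with (sigma omega1 omega3 (w * z) / sigma omega1 omega3 w * sigma omega1 omega3 w)%C
      by (now field).
    rewrite E. ring. }
  (* Homogeneity: rescale the arguments by w and divide by sigma(w)^4. *)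
  assert (H3 : forall x y z, three_term br x y z = 0%C).
  { intros x y z.
    assert (H := sigma_three_term omega1 omega3 homega1 homega3 (w * x) (w * y) (w * z)).
    unfold br, ell, three_term in *.
    rewrite <- !Cmult_plus_distr_l in H.
    replace (w * x - w * y)%C with (w * (x - y))%C in H by ring.
    replace (w * y - w * z)%C with (w * (y - z))%C in H by ring.
    replace (w * x - w * z)%C with (w * (x - z))%C in H by ring.
    set (s := sigma omega1 omega3 w) in *.
    transitivity (0 / (s * s * (s * s)))%C; [rewrite <- H; now field | now field]. }
  assert (HA : forall l j : Z, br (alpha_hat w alpha l + RtoC (IZR j)) <> 0%C).
  { intros l j. apply Hbr. unfold alpha_hat. intros Hin. apply halpha.
    exists (- (l + j))%Z, (w * (alpha / w + IZR l + IZR j))%C. split; [exact Hin |].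
    rewrite opp_IZR, plus_IZR, RtoC_opp, RtoC_plus. now field. }
  assert (HB : forall (l : Z) (n : nat) (j : Z),
    br (beta_hat w beta + (alpha_hat w alpha l + RtoC (IZR j)) * RtoC (INR n)) <> 0%C).
  { intros l n j. apply Hbr. unfold alpha_hat, beta_hat.
    replace (w * (beta / w + (alpha / w + IZR l + IZR j) * INR n))%C
      with (beta + INR n * (alpha + IZR (l + j) * w))%C.
    - apply hbeta.
    - rewrite plus_IZR, RtoC_plus. now field. }
  assert (Hl : forall l, alpha_hat w alpha (l + 1) = (alpha_hat w alpha l + 1)%C).
  { intros l. unfold alpha_hat. rewrite plus_IZR, RtoC_plus. ring. }
  assert (P1 : forall (l : Z) (n : nat), (1 <= n)%nat ->
     (b n l * d n (l + 1)%Z = d (n - 1)%nat l * b n (l + 1)%Z)%C).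
  { intros l n Hn. unfold b, d, qd_b, qd_d. cbv zeta. rewrite Hl. fold br.
    exact (qd_product_relation br _ _ (Cexp (gamma * w)) (HA l) (HB l) n Hn). }
  assert (P2 : forall (l : Z) (n : nat),
     (b n (l + 1)%Z - d n (l + 1)%Z = b (n + 1)%nat l - d n l)%C).
  { intros l n. unfold b, d, qd_b, qd_d. cbv zeta. rewrite Hl. fold br.
    exact (qd_sum_relation br _ _ (Cexp (gamma * w)) H3 (HA l) (HB l) n). }
  repeat split; [| exact P1 | exact P2 | |].
  (* b_0 vanishes because [0] = 0, through the prefactor z in the product for sigma. *)
  - intros l. unfold b, qd_b. cbv zeta.
    replace (ell omega1 omega3 w (RtoC (INR 0))) with (RtoC 0); [unfold Cdiv; ring |].
    unfold ell. simpl INR. replace (w * 0)%C with (RtoC 0) by ring.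
    destruct (sigma_spec omega1 omega3 homega1 homega3 0) as (s & _ & -> & _).
    now field.
  (* At level l + n - 1 the additive relation rewrites e_(n-1) as b_n - d_(n-1); multiplying by b_n
     one level up, the multiplicative relation exchanges the d terms. *)
  - intros l n Hn. unfold e, f, qd_e, qd_f. fold b. fold d.
    replace (l + 1 + Z.of_nat (n - 1))%Z with (l + Z.of_nat n - 1 + 1)%Z by lia.
    replace (l + 1 + Z.of_nat n - 1)%Z with (l + Z.of_nat n - 1 + 1)%Z by lia.
    assert (E1 := P1 (l + Z.of_nat n - 1)%Z n Hn).
    assert (E2 := P2 (l + Z.of_nat n - 1)%Z (n - 1)%nat).
    replace (n - 1 + 1)%nat with n in E2 by lia.
    rewrite E2. replace (l + Z.of_nat n - 1 + 1)%Z with (l + Z.of_nat n)%Z in * by lia.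
    unfold b, d in *.
    match type of E1 with (?p * ?q = ?r * ?s)%C =>
      transitivity (p * s - r * s)%C; [ring |]; rewrite <- E1; ring end.
  - intros l n. unfold e, f, qd_e, qd_f. fold b. fold d.
    replace (l + Z.of_nat (n + 1) - 1)%Z with (l + Z.of_nat n)%Z by lia.
    replace (l + 1 + Z.of_nat n - 1)%Z with (l + Z.of_nat n)%Z by lia.
    replace (l + 1 + Z.of_nat n)%Z with (l + Z.of_nat n + 1)%Z by lia.
    assert (E2 := P2 (l + Z.of_nat n)%Z n). unfold b, d in *. rewrite E2. ring.
Qed.
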